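(* Let $\{(X_n,Y_n):n\ge 1\}$ be independent copies of a random vector $(X,Y)$ (not assumed to have independent components) with continuous marginal distribution functions $G$ and $H$ and copula $\mathbb{C}$. Assume that $\mathbb{C}$ is twice continuously differentiable on $(0,1)^2$ and that all its partial derivatives of second order are continuous on $[0,1]^2$. Let $\{k_n\}_{n\ge1}$ be a sequence of positive constants such that, for all integers $n>1$: $0<k_n\le n$; $k_n\uparrow$ as $n\to\infty$ (monotone nondecreasing); $k_n/n\searrow\gamma$ as $n\to\infty$ (monotone nonincreasing with limit $\gamma$), where $0\le\gamma\le1$; and $k_n/\log_2 n\to\infty$ as $n\to\infty$. Let $\mathbb{G}_n^{**}$ and $\alpha_{n;0}^{**}$ be the processes on $[0,1]^2$ defined in the context. Then, almost surely: (i) when $0<\gamma\le 1/2$, $$\limsup_{n\to\infty} n^{1/2}k_n^{-1/4}(\log_2 n)^{-1/4}(\log_1 n)^{-1/2}\,\|\mathbb{G}_n^{**}-\alpha_{n;0}^{**}\|\le \left[3\times 2^{-1/4}+\gamma 2^{5/4}\right](1-\gamma)^{1/4};$$ (ii) when $1/2<\gamma\le 1$, $$\limsup_{n\to\infty} n^{1/2}k_n^{-1/4}(\log_2 n)^{-1/4}(\log_1 n)^{-1/2}\,\|\mathbb{G}_n^{**}-\alpha_{n;0}^{**}\|\le \left[3\times 2^{-3/4}+\gamma 2^{3/4}\right]\gamma^{-1/4}.$$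
   Context: Notation: $\log_1 u=\log(u\vee e)$ and $\log_p u=\log_1(\log_{p-1}u)$ for $p\ge2$. For a bounded function $f$ on $[0,1]^2$, $\|f\|=\sup_{x\in[0,1]^2}|f(x)|$. The copula of $(X,Y)$, with joint distribution function $\mathbb{F}(x,y)=\mathbb{P}(X\le x,Y\le y)$, is $\mathbb{C}(u,v)=\mathbb{F}(G^{-1}(u),H^{-1}(v))$, $(u,v)\in[0,1]^2$, where $G^{-1}(u)=\inf\{x:G(x)\ge u\}$, $H^{-1}(v)=\inf\{y:H(y)\ge v\}$; it satisfies $\mathbb{F}(x,y)=\mathbb{C}(G(x),H(y))$. On the boundary of $[0,1]^2$, partial derivatives of $\mathbb{C}$ are understood as continuous extensions from $(0,1)^2$. Let $U_i=G(X_i)$, $V_i=H(Y_i)$, $\mathbb{T}_n(u,v)=\frac1n\sum_{i=1}^n1\{U_i\le u,V_i\le v\}$, $\mathbb{U}_n(u)=\mathbb{T}_n(u,1)$, $\mathbb{V}_n(v)=\mathbb{T}_n(1,v)$, $\mathbb{U}_n^{-1}(u)=\inf\{s\ge0:\mathbb{U}_n(s)\ge u\}$, $\mathbb{V}_n^{-1}(v)=\inf\{t\ge0:\mathbb{V}_n(t)\ge v\}$, for $u,v\in[0,1]$. The local empirical copula process is $$\mathbb{G}_n^{**}(u,v)=n^{1/2}\left\{\mathbb{T}_n\left(\mathbb{U}_n^{-1}\left(\tfrac{uk_n}{n}\right),\mathbb{V}_n^{-1}\left(\tfrac{vk_n}{n}\right)\right)-\mathbb{C}\left(\tfrac{uk_n}{n},\tfrac{vk_n}{n}\right)\right\},\quad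 (u,v)\in[0,1]^2.$$ Let $\widetilde{\alpha}_n(u,v)=n^{1/2}(\mathbb{T}_n(u,v)-\mathbb{C}(u,v))$, $\alpha_{n;\mathbb{U}}(u)=n^{1/2}(\mathbb{U}_n(u)-u)$, $\alpha_{n;\mathbb{V}}(v)=n^{1/2}(\mathbb{V}_n(v)-v)$, and $$\alpha_{n;0}^{**}(u,v)=\widetilde{\alpha}_n\left(\tfrac{uk_n}{n},\tfrac{vk_n}{n}\right)-\frac{\partial\mathbb{C}}{\partial v}\left(\tfrac{uk_n}{n},\tfrac{vk_n}{n}\right)\alpha_{n;\mathbb{V}}\left(v\tfrac{k_n}{n}\right)-\frac{\partial\mathbb{C}}{\partial u}\left(\tfrac{uk_n}{n},\tfrac{vk_n}{n}\right)\alpha_{n;\mathbb{U}}\left(u\tfrac{k_n}{n}\right).$$ *)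

(* Defs.v *)
From HB Require Import structures.
From mathcomp Require Import all_boot all_order all_algebra.
From mathcomp Require Import all_classical all_reals all_analysis.

Set Implicit Arguments.
Unset Strict Implicit.
Unset Printing Implicit Defensive.

Import Order.TTheory GRing.Theory Num.Theory.
Import numFieldNormedType.Exports.

Local Open Scope classical_set_scope.
Local Open Scope ring_scope.

Section Calculus.
Context {R : realType}.
Implicit Types (f : R * R -> R) (p : R * R).

Definition log1 (u : R) : R := ln (Num.max u (expR 1)).

Definition iterlog (p : nat) (u : R) : R := iter p log1 u.

Definition open_square : set (R * R) :=
  [set p | 0 < p.1 < 1 /\ 0 < p.2 < 1].

Definition unit_square : set (R * R) :=
  [set p | 0 <= p.1 <= 1 /\ 0 <= p.2 <= 1].

(* Taken in the extended reals, so that it is +oo for an unbounded f. *)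
Definition sup_norm f : \bar R :=
  ereal_sup [set `|f p|%:E | p in unit_square].

Definition partial_u f p : R := 'D_((1, 0) : R * R) f p.

Definition partial_v f p : R := 'D_((0, 1) : R * R) f p.

Definition C1_on (A : set (R * R)) f : Prop :=
  (forall p, A p -> derivable f p (1, 0) /\ derivable f p (0, 1)) /\
  (forall p, A p -> {for p, continuous (partial_u f)} /\
                    {for p, continuous (partial_v f)}).

Definition C2_on (A : set (R * R)) f : Prop :=
  [/\ C1_on A f, C1_on A (partial_u f) & C1_on A (partial_v f)].

(* Off the open square, the limit is meaningful only when it exists; in
   that case it is the continuous extension of f from the open square. *)
Definition boundary_ext f p : R :=
  if p \in open_square then f p
  else lim (f q @[q --> within open_square (nbhs p)]).

Definition second_partials_continuous f : Prop :=
  [/\ {within unit_square, continuous boundary_ext (partial_u (partial_u f))},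
      {within unit_square, continuous boundary_ext (partial_u (partial_v f))},
      {within unit_square, continuous boundary_ext (partial_v (partial_u f))} &
      {within unit_square, continuous boundary_ext (partial_v (partial_v f))}].

End Calculus.

Section RandomVectors.
Context {d : measure_display} {Omega : measurableType d} {R : realType}.
Context {P : probability Omega R}.
Implicit Types X Y : {RV P >-> R}.

Definition distr_fun X (x : R) : R := fine (cdf X x).

(* The arguments range over the extended reals because a quantile at level
   0 or 1 may be infinite. *)
Definition joint_distr_fun X Y (x y : \bar R) : R :=
  fine (P [set w | ((X w)%:E <= x)%E /\ ((Y w)%:E <= y)%E]).

Definition quantile X (u : R) : \bar R :=
  ereal_inf [set x%:E | x in [set x : R | u <= distr_fun X x]].

Definition copula X Y (p : R * R) : R :=
  joint_distr_fun X Y (quantile X p.1) (quantile Y p.2).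

Definition vector_event X Y (A : set (R * R)) : set Omega :=
  [set w | A (X w, Y w)].

(* Mutual independence of the random vectors (Xs i, Ys i), i : nat; the two
   components of one vector may be dependent. *)
Definition independent_vectors (Xs Ys : nat -> {RV P >-> R}) : Prop :=
  forall (J : seq nat) (A : nat -> set (R * R)),
    uniq J -> (forall i, measurable (A i)) ->
    P (\bigcap_(i in [set` J]) vector_event (Xs i) (Ys i) (A i)) =
    (\prod_(i <- J) P (vector_event (Xs i) (Ys i) (A i)))%E.

Definition same_law X Y (X' Y' : {RV P >-> R}) : Prop :=
  forall A : set (R * R), measurable A ->
    P (vector_event X' Y' A) = P (vector_event X Y A).

Definition independent_copies X Y (Xs Ys : nat -> {RV P >-> R}) : Prop :=
  independent_vectors Xs Ys /\ forall i, same_law X Y (Xs i) (Ys i).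

End RandomVectors.

(* U and V are the observed samples, indexed from 0: the n-th process uses
   U 0, ..., U n.-1 and V 0, ..., V n.-1.  C is a (copula) function, and
   r stands for k_n / n. *)
Section Processes.
Context {R : realType}.
Implicit Types (U V : nat -> R) (C : R * R -> R) (n : nat) (r : R).

Definition emp_joint U V n (p : R * R) : R :=
  n%:R^-1 * \sum_(i < n) ((U i <= p.1) && (V i <= p.2))%:R.

Definition emp_fst U V n (u : R) : R := emp_joint U V n (u, 1).

Definition emp_snd U V n (v : R) : R := emp_joint U V n (1, v).

Definition emp_quantile (F : R -> R) (u : R) : R :=
  inf [set s | 0 <= s /\ u <= F s].

Definition local_emp_copula C U V n r (p : R * R) : R :=
  Num.sqrt n%:R *
  (emp_joint U V n (emp_quantile (emp_fst U V n) (p.1 * r),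
                    emp_quantile (emp_snd U V n) (p.2 * r))
   - C (p.1 * r, p.2 * r)).

Definition emp_process C U V n (p : R * R) : R :=
  Num.sqrt n%:R * (emp_joint U V n p - C p).

Definition emp_process_fst U V n (u : R) : R :=
  Num.sqrt n%:R * (emp_fst U V n u - u).

Definition emp_process_snd U V n (v : R) : R :=
  Num.sqrt n%:R * (emp_snd U V n v - v).

Definition local_approx C U V n r (p : R * R) : R :=
  let q := (p.1 * r, p.2 * r) in
  emp_process C U V n q
  - boundary_ext (partial_v C) q * emp_process_snd U V n q.2
  - boundary_ext (partial_u C) q * emp_process_fst U V n q.1.

Definition rate (k : nat -> R) n : R :=
  Num.sqrt n%:R * k n `^ (- 4^-1) * iterlog 2 n%:R `^ (- 4^-1)
  * iterlog 1 n%:R `^ (- 2^-1).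

End Processes.

(* Main.v *)
Require Import Defs.
From HB Require Import structures.
From mathcomp Require Import all_boot all_order all_algebra.
From mathcomp Require Import all_classical all_reals all_analysis.
From mathcomp Require Import ring lra.

Set Implicit Arguments.
Unset Strict Implicit.
Unset Printing Implicit Defensive.

Import Order.TTheory GRing.Theory Num.Theory.
Import numFieldNormedType.Exports.

Local Open Scope classical_set_scope.
Local Open Scope ring_scope.

(* Write U_n, V_n for the empirical marginals, s = U_n^{-1}(u), t = V_n^{-1}(v) and
   a, b for the partial derivatives of C at (u, v). Up to n^{1/2} times the size of
   the jumps of U_n and V_n,
     error = n^{1/2} { T_n(s,t) - T_n(u,v) - a (U_n(s) - U_n(u)) - b (V_n(t) - V_n(v)) },
   a normalized sum of i.i.d. terms which, for fixed s, t, u, v with |s - u|, |t - v| <= dl,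
   have mean O(dl^2) and, since a (1 - a) <= 1/4, variance at most dl/2 + O(dl^2).
   The law of the iterated logarithm for U_n and V_n allows
   dl ~ (2 v log_2 n / n)^{1/2} with v = gamma (1 - gamma) or v = 1/4.
   A union bound over a grid of mesh n^{-3/4} for (s, t, u, v), i.e. over n^3 quadruples,
   Bernstein's inequality and the Borel-Cantelli lemma along all n then bound the
   normalized error by any constant c with c^4 > 32 v; the terms
   3 * 2^{-1/4} (1 - gamma)^{1/4} and 3 * 2^{-3/4} gamma^{-1/4} of the statement
   correspond to c^4 = 81 v / 2. *)

(** * Exponential inequalities *)

(** The points s and t depend on the sample, so exponential inequalities apply only after replacing
    them by deterministic grid points; this forces the union bound. Origin of 32: for y = c n^{1/4}
    (log_2 n)^{1/4} (log_1 n)^{1/2} and variance n dl / 2, the Gaussian exponent is y^2 / (n dl) =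
    c^2 (2 v)^{-1/2} log n. It has to exceed 4 log n, three units for the n^3 quadruples and one for
    summability over n. Origin of the mesh: a cell of length n^{-3/4} holds about n^{1/4} sample
    points, which is negligible against y, so rounding to the grid is free in the limit. A finer
    grid would only raise the price of the union bound. Only arguments up to k_n / n, hence slightly
    above gamma, enter the process; so v is the maximum of x (1 - x) over [0, gamma], which
    distinguishes the two cases of the theorem. A sum attached to fixed thresholds sees each
    observation through finitely many comparisons. All expectations are therefore finite sums over
    the outcomes of these comparisons, and independence is used through cylinder events only. *)

Lemma MVT_everywhere (R : realType) (f df : R -> R) (a b : R) : a < b ->
  (forall x : R, is_derive x 1 f (df x)) ->
  exists2 c, a < c < b & f b - f a = df c * (b - a).
Proof.
move=> ab fdf.
have [|c] := @MVT R f df a b ab (fun x _ => fdf x).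
- apply: derivable_within_continuous => x _.
  by have [] := fdf x.
- by rewrite in_itv /= => ? ?; exists c.
Qed.

(** The polynomial times [expR (- y)] equals 1 at 0, and its derivative has a constant sign on each
    side: y^2 (5/2 - y) [expR (- y)] for y > 0, and -(y^2 / 2) [expR (- y)] for y < 0 with the
    quadratic polynomial alone. *)
Lemma expR_le_cubic (R : realType) (y : R) : y <= 1 ->
  expR y <= 1 + y + y ^+ 2 / 2 + `|y| ^+ 3.
Proof.
move=> y1.
have key (f : R -> R) : f y * expR (- y) >= 1 -> expR y <= f y.
  by rewrite expRN ler_pdivlMr ?expR_gt0// mul1r.
case: (ltgtP y 0) => y0; last first.
- by rewrite y0 expR0 normr0; lra.
- rewrite (gtr0_norm y0).
  apply: (key (fun y => 1 + y + y ^+ 2 / 2 + y ^+ 3)).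
  have [x|c /andP[c0 cy]] := @MVT_everywhere R
      (fun y => (1 + y + y ^+ 2 / 2 + y ^+ 3) * expR (- y))
      (fun y => y ^+ 2 * (5 / 2 - y) * expR (- y)) 0 y y0.
    by apply: is_derive_eq; rewrite /GRing.scale/=; field.
  rewrite oppr0 expR0 => E.
  have : 0 <= c ^+ 2 * (5 / 2 - c) * expR (- c) * (y - 0).
    by rewrite !mulr_ge0 ?sqr_ge0 ?expR_ge0//; lra.
  lra.
- rewrite (ltr0_norm y0).
  apply: (@le_trans _ _ (1 + y + y ^+ 2 / 2)); last first.
    by rewrite lerDl exprn_ge0// oppr_ge0 ltW.
  apply: (key (fun y => 1 + y + y ^+ 2 / 2)).
  have [x|c /andP[c0 cy]] := @MVT_everywhere R
      (fun y => (1 + y + y ^+ 2 / 2) * expR (- y))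
      (fun y => - y ^+ 2 / 2 * expR (- y)) y 0 y0.
    by apply: is_derive_eq; rewrite /GRing.scale/=; field.
  rewrite oppr0 expR0 => E.
  have : 0 <= c ^+ 2 / 2 * expR (- c) * (0 - y).
    apply: mulr_ge0; last by lra.
    by apply: mulr_ge0; [have := sqr_ge0 c; lra | exact: expR_ge0].
  lra.
Qed.

Ltac nneg := lazymatch goal with
  | |- is_true (0 <= _ + _) => apply: addr_ge0; nneg
  | |- is_true (0 <= _ * _) => apply: mulr_ge0; nneg
  | |- is_true (0 <= _ ^+ 2) => exact: sqr_ge0
  | |- is_true (0 <= _ ^+ _) => apply: exprn_ge0; nneg
  | |- is_true (0 <= _ ^-1) => rewrite invr_ge0; nneg
  | |- is_true (0 <= Num.sqrt _) => exact: sqrtr_ge0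
  | |- is_true (0 <= expR _) => exact: expR_ge0
  | |- is_true (0 <= powR _ _) => exact: powR_ge0
  | |- is_true (0 <= `|_|) => exact: normr_ge0
  | |- _ => first [done | by apply: ltW | by rewrite ler0n]
  end.

(** * Observations seen through finitely many classes, and a maximal exponential bound *)

Section FiniteValuedSample.
Context {d : measure_display} {Omega : measurableType d} {R : realType}.
Variable P : probability Omega R.

Definition Pr (A : set Omega) : R := fine (P A).

Lemma PrE (A : set Omega) : measurable A -> P A = (Pr A)%:E.
Proof. by move=> mA; rewrite fineK// fin_num_measure. Qed.

Lemma Pr_ge0 (A : set Omega) : 0 <= Pr A.
Proof. by rewrite fine_ge0. Qed.

Lemma Pr_set0 : Pr set0 = 0.
Proof. by rewrite /Pr measure0. Qed.

Lemma Pr_setT : Pr setT = 1.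
Proof. by rewrite /Pr probability_setT. Qed.

Lemma le_Pr (A B : set Omega) : measurable A -> measurable B ->
  A `<=` B -> Pr A <= Pr B.
Proof.
move=> mA mB AB; rewrite -lee_fin -!PrE//.
by apply: le_measure => //; rewrite inE.
Qed.

Lemma Pr_fin_subadditive (T : finType) (A : set Omega) (F : T -> set Omega) :
  measurable A -> (forall t, measurable (F t)) ->
  (forall w, A w -> exists t, F t w) -> Pr A <= \sum_t Pr (F t).
Proof.
move=> mA mF AF.
have mbig (s : seq T) : measurable (\big[setU/set0]_(t <- s) F t).
  by apply: bigsetU_measurable.
have H (s : seq T) : Pr (\big[setU/set0]_(t <- s) F t) <= \sum_(t <- s) Pr (F t).
  elim: s => [|t s IH]; first by rewrite !big_nil Pr_set0.
  rewrite !big_cons -lee_fin -PrE; last exact: measurableU.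
  apply: (le_trans (measureU2 _ (mF t) (mbig s))).
  by move: IH; rewrite EFinD -(PrE (mF t)) -lee_fin -(PrE (mbig s)) => IH; exact: leeD2l.
apply: (le_trans _ (H _)); apply: le_Pr => // w /AF [t Ft].
by rewrite -bigcup_seq; exists t => //=; rewrite mem_index_enum.
Qed.

Lemma Pr_fin_additive (T : finType) (A : set Omega) (F : T -> set Omega) :
  measurable A -> (forall t, measurable (F t)) ->
  (forall w, A w <-> exists t, F t w) ->
  (forall w t t', F t w -> F t' w -> t = t') -> Pr A = \sum_t Pr (F t).
Proof.
move=> mA mF AF FF.
have -> : A = \big[setU/set0]_(t <- index_enum T) F t.
  apply/seteqP; split => w.
    by move=> /AF [t Ft]; rewrite -bigcup_seq; exists t => //=; rewrite mem_index_enum.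
  by rewrite -bigcup_seq => -[t _ Ft]; apply/AF; exists t.
elim: (index_enum T) (index_enum_uniq T) => [|t s IH].
  by rewrite !big_nil Pr_set0.
rewrite cons_uniq => /andP[ts us]; rewrite !big_cons.
have mbig : measurable (\big[setU/set0]_(t <- s) F t).
  by apply: bigsetU_measurable.
apply: EFin_inj; rewrite -IH// -PrE; last exact: measurableU.
rewrite EFinD -(PrE (mF t)) -(PrE mbig); apply: measureU => //.
apply/seteqP; split => w //=; rewrite -bigcup_seq => -[Ft [t' /= t's Ft']].
by move: ts; rewrite (FF _ _ _ Ft Ft') t's.
Qed.

Variable Z : nat -> Omega -> R * R.

(** The factors on the right all use [Z 0], so one product formula expresses both independence and
    equality in law. Other finite index sets are reached by taking the full set for some [B i]. *)
Definition iid_sample : Prop :=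
  (forall i, measurable_fun setT (Z i)) /\
  forall m (B : nat -> set (R * R)), (forall i, measurable (B i)) ->
    P (\bigcap_(i in `I_m) Z i @^-1` B i) =
    (\prod_(i < m) P (Z 0%N @^-1` B i))%E.

Hypothesis Z_iid : iid_sample.

Lemma measurable_sample (i : nat) (B : set (R * R)) :
  measurable B -> measurable (Z i @^-1` B).
Proof. by move=> mB; rewrite -[_ @^-1` _]setTI; apply: Z_iid.1. Qed.

Context {T : finType}.
Variable h : R * R -> T.
Hypothesis mh : forall t, measurable (h @^-1` [set t]).

(** The law of the class [h z] of an observation on the finite type [T]; it turns expectations of
    functions of the class into finite sums. *)
Definition class_prob (t : T) : R := Pr (Z 0%N @^-1` (h @^-1` [set t])).

Lemma class_prob_ge0 t : 0 <= class_prob t.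
Proof. exact: Pr_ge0. Qed.

Lemma measurable_class_pred (Q : pred T) : measurable [set z | Q (h z)].
Proof.
have -> : [set z | Q (h z)] = \bigcup_(t in [set` Q]) (h @^-1` [set t]).
  by apply/seteqP; split => [z Qz|z [t Qt /= ht]]; [exists (h z)|rewrite /= ht].
by apply: fin_bigcup_measurable => //; exact: finite_finset.
Qed.

Lemma mean_class_pred (Q : pred T) :
  \sum_t class_prob t * (Q t)%:R = Pr (Z 0%N @^-1` [set z | Q (h z)]).
Proof.
rewrite (@Pr_fin_additive T _
  (fun t => if Q t then Z 0%N @^-1` (h @^-1` [set t]) else set0)).
- apply: eq_bigr => t _; case: (Q t); first by rewrite mulr1.
  by rewrite mulr0 Pr_set0.
- by apply: measurable_sample; exact: measurable_class_pred.
- by move=> t; case: ifP => // _; apply: measurable_sample.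
- move=> w; split => /=; first by move=> Qw; exists (h (Z 0%N w)); rewrite Qw.
  by move=> [t]; case: ifP => // Qt /= ->.
- move=> w t t'; case: ifP => // _; case: ifP => // _ /= <- <- //.
Qed.

Lemma sum_class_prob : \sum_t class_prob t = 1.
Proof.
have := mean_class_pred predT; under eq_bigr do rewrite mulr1.
by move=> ->; rewrite -Pr_setT; congr Pr; apply/seteqP; split.
Qed.

Lemma class_prob_out t : (forall z, h z <> t) -> class_prob t = 0.
Proof.
move=> ht; rewrite /class_prob (_ : _ @^-1` _ = set0) ?Pr_set0//.
by apply/seteqP; split => // w /= /ht.
Qed.

(** Classes that no point realizes have probability zero, so the comparison is required on the range
    of [h] only. This discards contradictory combinations of threshold comparisons. *)
Lemma le_mean (c e : T -> R) : (forall z, c (h z) <= e (h z)) ->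
  \sum_t class_prob t * c t <= \sum_t class_prob t * e t.
Proof.
move=> ce; apply: ler_sum => t _.
have [[z <-]|/forallNP zt] := pselect (exists z, h z = t).
  by rewrite ler_wpM2l ?class_prob_ge0.
by rewrite class_prob_out ?mul0r.
Qed.

Let cyl (s : seq T) : set Omega :=
  \bigcap_(i in `I_(size s)) Z i @^-1` (h @^-1` [set nth (h (0, 0)) s i]).

Let measurable_cyl s : measurable (cyl s).
Proof.
by apply: fin_bigcap_measurable => [|i _]; [exact: finite_II | apply: measurable_sample].
Qed.

Let Pr_cyl s : Pr (cyl s) = \prod_(t <- s) class_prob t.
Proof.
apply: EFin_inj; rewrite -PrE// Z_iid.2//.
rewrite (big_nth (h (0, 0))) big_mkord -prodEFin.
by apply: eq_bigr => i _; rewrite PrE//; exact: measurable_sample.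
Qed.

Let hit (c : T -> R) (N m : nat) (x : R) : set Omega :=
  [set w | exists2 n, (n <= N)%N & x <= \sum_(m <= i < m + n) c (h (Z i w))].

Let measurable_class_fun (c : T -> R) i :
  measurable_fun setT (fun w => c (h (Z i w))).
Proof.
move=> _ Y mY; rewrite setTI.
have := @measurable_sample i _ (measurable_class_pred (fun t => `[< Y (c t) >])).
congr measurable; apply/seteqP; split => w /=; first by move=> /asboolP.
by move=> ?; apply/asboolP.
Qed.

Lemma measurable_class_sum_ge (c : T -> R) (m n : nat) (x : R) :
  measurable [set w | x <= \sum_(m <= i < n) c (h (Z i w))].
Proof.
have mf : measurable_fun setT (fun w => \sum_(m <= i < n) c (h (Z i w))).
  by apply: measurable_sum => i.
have := mf measurableT `[x, +oo[%classic (measurable_itv _).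
rewrite setTI; congr measurable; apply/seteqP; split => w /=.
  by rewrite in_itv /= andbT.
by rewrite in_itv /= andbT.
Qed.

Let measurable_hit c N m x : measurable (hit c N m x).
Proof.
rewrite (_ : hit _ _ _ _ = \bigcup_(n in `I_N.+1)
    [set w | x <= \sum_(m <= i < m + n) c (h (Z i w))]).
  by apply: bigcup_measurable => n _; exact: measurable_class_sum_ge.
by apply/seteqP; split => w [n nN xn]; exists n.
Qed.

(* Conditioning on one more observation at each induction step replaces optional
   stopping; [1 <= phi] covers the paths that have already reached the level. *)
Let hit_bound (c : T -> R) (lambda phi : R) (N : nat) (s : seq T) (x : R) :
  0 <= lambda -> \sum_t class_prob t * expR (lambda * c t) <= phi -> 1 <= phi ->
  Pr (cyl s `&` hit c N (size s) x) <= Pr (cyl s) * (expR (- (lambda * x)) * phi ^+ N).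
Proof.
move=> l0 hphi phi1; elim: N s x => [|N IH] s x; have [x0|x0] := leP x 0.
- rewrite expr0 mulr1 (le_trans (le_Pr _ _ (@subIsetl _ _ _)))//.
    exact: measurableI.
  by rewrite ler_peMr ?Pr_ge0// -expR0 ler_expR oppr_ge0 mulr_ge0_le0.
- rewrite (_ : _ `&` _ = set0) ?Pr_set0 ?mulr_ge0 ?Pr_ge0 ?expR_ge0//.
  apply/seteqP; split => // w [_ [n]]; rewrite leqn0 => /eqP ->.
  by rewrite addn0 big_geq// leNgt x0.
- rewrite (le_trans (le_Pr _ _ (@subIsetl _ _ _)))//.
    exact: measurableI.
  rewrite ler_peMr ?Pr_ge0// mulr_ege1 ?exprn_ege1//.
  by rewrite -expR0 ler_expR oppr_ge0 mulr_ge0_le0.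
- pose F t := cyl (rcons s t) `&` hit c N (size s).+1 (x - c t).
  have cylr w t : cyl (rcons s t) w <-> cyl s w /\ h (Z (size s) w) = t.
    rewrite /cyl size_rcons; split => [H|[H1 H2] i /= ilt].
      split => [i /= ilt|].
        by have := H i (ltnW ilt); rewrite /= nth_rcons ilt.
      by have := H (size s) (ltnSn _); rewrite /= nth_rcons ltnn eqxx.
    rewrite nth_rcons; case: ltnP => [/H1//|si].
    have -> : i = size s by apply/eqP; rewrite eqn_leq si andbT -ltnS.
    by rewrite eqxx.
  apply: (@le_trans _ _ (\sum_t Pr (F t))).
    apply: Pr_fin_subadditive => [|t|w [ws [[|n] nN]]].
    - exact: measurableI.
    - exact: measurableI.
    - by rewrite addn0 big_geq// leNgt x0.
    rewrite big_ltn ?addnS ?ltnS ?leq_addr// => xw.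
    exists (h (Z (size s) w)); split; first exact/cylr.
    by exists n => //; rewrite addSn lerBlDl.
  apply: (@le_trans _ _ (\sum_t Pr (cyl s) * class_prob t *
      (expR (- (lambda * (x - c t))) * phi ^+ N))).
    apply: ler_sum => t _.
    have := IH (rcons s t) (x - c t); rewrite size_rcons => /le_trans -> //.
    by rewrite !Pr_cyl -cats1 big_cat big_seq1.
  rewrite exprS; under eq_bigr do rewrite -mulrA.
  rewrite -mulr_sumr ler_wpM2l ?Pr_ge0//.
  apply: (@le_trans _ _ ((\sum_t class_prob t * expR (lambda * c t)) *
      (expR (- (lambda * x)) * phi ^+ N))).
    rewrite mulr_suml ler_sum// => t _; rewrite mulrBr opprB expRD expRN.
    by rewrite !mulrA.
  rewrite [leRHS]mulrCA ler_wpM2r// mulr_ge0 ?expR_ge0// exprn_ge0// (le_trans ler01)//.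
Qed.

Lemma maximal_exponential_bound (c : T -> R) (lambda phi x : R) (N : nat) :
  0 <= lambda -> \sum_t class_prob t * expR (lambda * c t) <= phi -> 1 <= phi ->
  Pr [set w | exists2 n, (n <= N)%N & x <= \sum_(i < n) c (h (Z i w))] <=
  expR (- (lambda * x)) * phi ^+ N.
Proof.
move=> l0 hphi phi1; have := @hit_bound c lambda phi N [::] x l0 hphi phi1.
rewrite Pr_cyl big_nil mul1r; congr (_ <= _); congr Pr.
apply/seteqP; split => w /=.
  by move=> [_ [n nN xn]]; exists n => //; rewrite add0n big_mkord in xn.
by move=> [n nN xn]; split => //; exists n => //; rewrite add0n big_mkord.
Qed.

Lemma measurable_hit0 (c : T -> R) (x : R) (N : nat) :
  measurable [set w | exists2 n, (n <= N)%N & x <= \sum_(i < n) c (h (Z i w))].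
Proof.
have := measurable_hit c N 0 x; congr measurable; apply/seteqP; split => w /=.
  by move=> [n nN xn]; exists n => //; rewrite add0n big_mkord in xn.
by move=> [n nN xn]; exists n => //; rewrite add0n big_mkord.
Qed.

End FiniteValuedSample.

(** * Bernstein inequalities for maxima of partial sums *)

Section Bernstein.
Context {d : measure_display} {Omega : measurableType d} {R : realType}.
Context {P : probability Omega R} {Z : nat -> Omega -> R * R}.
Hypothesis Z_iid : iid_sample P Z.

Section FiniteClasses.
Context {T : finType} {h : R * R -> T}.
Hypothesis mh : forall t, measurable (h @^-1` [set t]).
Local Notation p := (class_prob P Z h).

(** The exponential parameter is l = x / q, the Gaussian optimum for variance q. [M * x <= q] gives
    l c <= 1, so the cubic bound on [expR] applies; its remainder costs the factor 1 - 2 M x / q and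
    leaves the sharp leading term x^2 / (2 q). *)
Let bernstein_one_sided (c : T -> R) (v M x q : R) (N : nat) :
  \sum_t p t * c t = 0 -> (forall t, `|c t| <= M) ->
  \sum_t p t * c t ^+ 2 <= v -> N%:R * v <= q -> 0 < q -> 0 <= x ->
  M * x <= q ->
  Pr P [set w | exists2 n, (n <= N)%N & x <= \sum_(i < n) c (h (Z i w))] <=
  expR (- (x ^+ 2 / (2 * q) * (1 - 2 * M * x / q))).
Proof.
move=> c0 cM cv Nv q0 x0 Mxq.
have v0 : 0 <= v.
  apply: (le_trans _ cv); apply: sumr_ge0 => t _.
  by rewrite mulr_ge0 ?class_prob_ge0 ?sqr_ge0.
pose l := x / q.
have l0 : 0 <= l by rewrite divr_ge0// ltW.
pose e := l ^+ 2 * v / 2 * (1 + 2 * l * M).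
have lM : l * M <= 1 by rewrite /l mulrAC ler_pdivrMr// mul1r mulrC.
have [tM|noT] := pselect (exists t : T, True); last first.
  exfalso; have := @sum_class_prob _ _ _ P Z Z_iid T h mh.
  rewrite big1; first by move/eqP; rewrite eq_sym oner_eq0.
  by move=> t _; exfalso; apply: noT; exists t.
have M0 : 0 <= M by case: tM => t _; apply: (le_trans _ (cM t)).
have e0 : 0 <= e.
  by rewrite /e; nneg.
have mgf : \sum_t p t * expR (l * c t) <= expR e.
  apply: (@le_trans _ _ (\sum_t (p t + l * (p t * c t) +
      (l ^+ 2 / 2 + l ^+ 3 * M) * (p t * c t ^+ 2)))).
    apply: ler_sum => t _.
    have lc : l * c t <= 1.
      apply: (le_trans (ler_norm _)); rewrite normrM (ger0_norm l0).
      by apply: (le_trans _ lM); rewrite ler_wpM2l.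
    apply: (le_trans (ler_wpM2l (class_prob_ge0 _ _ _ _) (expR_le_cubic lc))).
    have -> : p t + l * (p t * c t) + (l ^+ 2 / 2 + l ^+ 3 * M) * (p t * c t ^+ 2) =
        p t * (1 + l * c t + (l * c t) ^+ 2 / 2 + l ^+ 3 * (M * c t ^+ 2)) by field.
    rewrite ler_wpM2l ?class_prob_ge0// lerD2l normrM (ger0_norm l0) exprMn.
    rewrite ler_wpM2l ?exprn_ge0// exprS -[_ ^+ 2 in leRHS]real_normK ?num_real//.
    by rewrite ler_wpM2r// exprn_ge0.
  rewrite !big_split/= (sum_class_prob Z_iid mh) -!mulr_sumr c0 mulr0 addr0.
  apply: (le_trans _ (expR_ge1Dx _)); rewrite lerD2l.
  have -> : e = (l ^+ 2 / 2 + l ^+ 3 * M) * v by rewrite /e; field.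
  by rewrite ler_wpM2l//; nneg.
apply: (le_trans (maximal_exponential_bound Z_iid mh x N l0 mgf _)).
  by rewrite -expR0 ler_expR.
rewrite -expRM_natl -expRD ler_expR.
have -> : - (x ^+ 2 / (2 * q) * (1 - 2 * M * x / q)) =
    - (l * x) + l ^+ 2 / 2 * (1 + 2 * l * M) * q.
  by rewrite /l; field; rewrite gt_eqF.
rewrite lerD2l /e.
have -> : N%:R * (l ^+ 2 * v / 2 * (1 + 2 * l * M)) =
    l ^+ 2 / 2 * (1 + 2 * l * M) * (N%:R * v) by field.
by rewrite ler_wpM2l//; nneg.
Qed.

Lemma measurable_abs_hit (c : T -> R) (x : R) (N : nat) :
  measurable [set w | exists2 n, (n <= N)%N & x <= `|\sum_(i < n) c (h (Z i w))|].
Proof.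
have mA := measurable_hit0 Z_iid mh c x N.
have mB := measurable_hit0 Z_iid mh (fun t => - c t) x N.
have := measurableU _ _ mA mB; congr measurable; apply/seteqP; split => w /=.
  move=> [[n nN xn]|[n nN xn]]; exists n => //.
    by rewrite (le_trans xn)// ler_norm.
  by move: xn; rewrite sumrN => /le_trans -> //; rewrite -normrN ler_norm.
move=> [n nN]; rewrite ler_normr => /orP[xn|xn]; [left|right]; exists n => //.
by rewrite sumrN.
Qed.

Lemma bernstein_maximal (c : T -> R) (v M x q : R) (N : nat) :
  \sum_t p t * c t = 0 -> (forall t, `|c t| <= M) ->
  \sum_t p t * c t ^+ 2 <= v -> N%:R * v <= q -> 0 < q -> 0 <= x ->
  M * x <= q ->
  Pr P [set w | exists2 n, (n <= N)%N & x <= `|\sum_(i < n) c (h (Z i w))|] <=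
  2 * expR (- (x ^+ 2 / (2 * q) * (1 - 2 * M * x / q))).
Proof.
move=> c0 cM cv Nv q0 x0 Mxq.
pose A b := [set w | exists2 n, (n <= N)%N &
  x <= \sum_(i < n) ((if b then c else fun t => - c t) (h (Z i w)))].
apply: (@le_trans _ _ (\sum_b Pr P (A b))).
  apply: Pr_fin_subadditive => [|b|w [n nN]].
  - exact: measurable_abs_hit.
  - exact: (measurable_hit0 Z_iid mh _ x N).
  - rewrite ler_normr => /orP[xn|xn].
      by exists true, n.
    by exists false, n => //; rewrite sumrN.
rewrite big_bool mulr2n mulrDl !mul1r lerD//.
  exact: (@bernstein_one_sided c v).
apply: (@bernstein_one_sided (fun t => - c t) v) => //.
- by under eq_bigr do rewrite mulrN; rewrite sumrN c0 oppr0.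
- by move=> t; rewrite normrN.
- by under eq_bigr do rewrite sqrrN.
Qed.

End FiniteClasses.

Section Intervals.
Variable g : R * R -> R.
Hypothesis mg : measurable_fun setT g.

Let thresholds (a b : R) (z : R * R) : bool * bool := (g z <= a, g z <= b).

Let measurable_le (a : R) (e : bool) : measurable [set z | (g z <= a) = e].
Proof.
have mga : measurable [set z | g z <= a].
  have := mg measurableT (measurable_itv `]-oo, a]).
  rewrite setTI; congr measurable; apply/seteqP; split => z /=;
  by rewrite in_itv.
case: e => //; have := measurableC mga; congr measurable.
by apply/seteqP; split => z /=; [move/negP/negbTE|move=> ->].
Qed.

Let measurable_thresholds (a b : R) t : measurable (thresholds a b @^-1` [set t]).
Proof.
case: t => t1 t2; have := measurableI _ _ (measurable_le a t1) (measurable_le b t2).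
congr measurable; apply/seteqP; split => z /=.
  by move=> [e1 e2]; rewrite /thresholds e1 e2.
by rewrite /thresholds => -[-> ->].
Qed.

Lemma measurable_level (a : R) : measurable [set w | g (Z 0%N w) <= a].
Proof. exact: (measurable_sample Z_iid 0 (measurable_le a true)). Qed.

Variables (a b m : R).
Hypothesis ab : a <= b.
Hypothesis m_def :
  m = Pr P [set w | g (Z 0%N w) <= b] - Pr P [set w | g (Z 0%N w) <= a].

Let dev (i : nat) (w : Omega) : R := (g (Z i w) <= b)%R%:R - (g (Z i w) <= a)%R%:R - m.

Lemma measurable_interval_dev_hit (x : R) (N : nat) :
  measurable [set w | exists2 n, (n <= N)%N & x <= `|\sum_(i < n) dev i w|].
Proof.
exact: (measurable_abs_hit (measurable_thresholds a b)
  (fun t : bool * bool => t.2%:R - t.1%:R - m)).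
Qed.

(** The difference of the two nested indicators is a Bernoulli variable of mean m. Keeping its exact
    variance m (1 - m), and not m, is what produces gamma (1 - gamma) in the end. *)
Lemma bernstein_interval (x q : R) (N : nat) :
  N%:R * (m * (1 - m)) <= q -> 0 < q -> 0 <= x -> 2 * x <= q ->
  Pr P [set w | exists2 n, (n <= N)%N & x <= `|\sum_(i < n) dev i w|] <=
  2 * expR (- (x ^+ 2 / (2 * q) * (1 - 4 * x / q))).
Proof.
move=> Nq q0 x0 xq.
have mh := measurable_thresholds a b.
pose p := class_prob P Z (thresholds a b).
have p1 : \sum_t p t = 1 by exact: sum_class_prob.
have p_diff : \sum_t p t * (t.2%:R - t.1%:R) = m.
  under eq_bigr do rewrite mulrBr.
  rewrite sumrB m_def.
  by rewrite (mean_class_pred Z_iid mh (fun t => t.2))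
     (mean_class_pred Z_iid mh (fun t => t.1)).
have m01 : 0 <= m <= 1.
  rewrite -p_diff; apply/andP; split.
    rewrite -[leLHS](_ : \sum_t p t * 0 = 0); last by rewrite big1// => t _; rewrite mulr0.
    apply: (@le_mean _ _ _ P Z _ (thresholds a b) (fun=> 0)
      (fun t : bool * bool => t.2%:R - t.1%:R)) => z.
    by rewrite /thresholds /= subr_ge0 ler_nat; case: (leP (g z) a) => //= /le_trans ->.
  rewrite -[leRHS](_ : \sum_t p t * 1 = 1); last by under eq_bigr do rewrite mulr1.
  apply: (@le_mean _ _ _ P Z _ (thresholds a b)
    (fun t : bool * bool => t.2%:R - t.1%:R) (fun=> 1)) => z.
  by rewrite /thresholds /=; case: (g z <= a); case: (g z <= b); rewrite /=; lra.
have := @bernstein_maximal _ _ mh (fun t => t.2%:R - t.1%:R - m) (m * (1 - m)) 2 x q N.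
have -> : 2 * 2 = 4 :> R by ring.
apply => //.
- under eq_bigr do rewrite mulrBr.
  by rewrite sumrB p_diff -mulr_suml p1 mul1r subrr.
- by case/andP: m01 => ? ? [[] []] /=; rewrite ler_norml; lra.
(* A number D in {0, 1} satisfies D^2 = D, so (D - m)^2 is affine in D and its mean follows from
   that of D. *)
- apply: (@le_trans _ _ (\sum_t p t * ((1 - 2 * m) * (t.2%:R - t.1%:R) + m ^+ 2))).
    apply: (@le_mean _ _ _ P Z _ (thresholds a b) (fun t => (t.2%:R - t.1%:R - m) ^+ 2)
      (fun t => (1 - 2 * m) * (t.2%:R - t.1%:R) + m ^+ 2)) => z /=.
    case: (leP (g z) a) => [/le_trans ->//|_] /=; first lra.
    by case: (g z <= b) => /=; lra.
  under eq_bigr do rewrite mulrDr mulrCA.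
  rewrite big_split/= -mulr_sumr p_diff -mulr_suml p1; lra.
Qed.

End Intervals.
End Bernstein.

(** * Moments and tails of the oscillation sums *)

Section Oscillation.
Context {d : measure_display} {Omega : measurableType d} {R : realType}.
Context {P : probability Omega R} {Z : nat -> Omega -> R * R}.
Hypothesis Z_iid : iid_sample P Z.

Definition sample_cdf (s t : R) : R :=
  Pr P [set w | (Z 0%N w).1 <= s /\ (Z 0%N w).2 <= t].
Local Notation F := sample_cdf.

Definition osc (s t u v a b : R) (z : R * R) : R :=
  ((z.1 <= s) && (z.2 <= t))%R%:R - ((z.1 <= u) && (z.2 <= v))%R%:R
  - a * ((z.1 <= s)%R%:R - (z.1 <= u)%R%:R)
  - b * ((z.2 <= t)%R%:R - (z.2 <= v)%R%:R).

Let T : finType := ((bool * bool) * (bool * bool))%type.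

Let thresholds (s t u v : R) (z : R * R) : T :=
  ((z.1 <= s, z.1 <= u), (z.2 <= t, z.2 <= v)).

Let measurable_coord (g : R * R -> R) (a : R) (e : bool) :
  measurable_fun setT g -> measurable [set z | (g z <= a) = e].
Proof.
move=> mg.
have mga : measurable [set z | g z <= a].
  have := mg measurableT _ (measurable_itv `]-oo, a]).
  by rewrite setTI; congr measurable; apply/seteqP; split => z /=; rewrite in_itv.
case: e => //; have := measurableC mga; congr measurable.
by apply/seteqP; split => z /=; [move/negP/negbTE|move=> ->].
Qed.

Let measurable_thresholds s t u v k :
  measurable (thresholds s t u v @^-1` [set k]).
Proof.
case: k => -[k1 k2] [k3 k4].
have mf a e := @measurable_coord fst a e measurable_fst.
have ms a e := @measurable_coord snd a e measurable_snd.
have := measurableI _ _ (measurableI _ _ (mf s k1) (mf u k2))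
  (measurableI _ _ (ms t k3) (ms v k4)).
congr measurable; apply/seteqP; split => z /=.
  by move=> [[e1 e2] [e3 e4]]; rewrite /thresholds e1 e2 e3 e4.
by rewrite /thresholds => -[-> -> -> ->].
Qed.

Variables s t u v a b K dl : R.
Hypothesis s_law : Pr P [set w | (Z 0%N w).1 <= s] = s.
Hypothesis u_law : Pr P [set w | (Z 0%N w).1 <= u] = u.
Hypothesis t_law : Pr P [set w | (Z 0%N w).2 <= t] = t.
Hypothesis v_law : Pr P [set w | (Z 0%N w).2 <= v] = v.
Hypothesis a1 : `|a| <= 1.
Hypothesis b1 : `|b| <= 1.
Hypothesis su : `|s - u| <= dl.
Hypothesis tv : `|t - v| <= dl.
Hypothesis Fu : `|F s v - F u v - a * (s - u)| <= K.
Hypothesis Fv : `|F u t - F u v - b * (t - v)| <= K.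
Hypothesis Fuv : `|F s t - F s v - F u t + F u v| <= K.

Let h := thresholds s t u v.
Let mh := measurable_thresholds s t u v.
Local Notation p := (class_prob P Z h).

(** Linear combinations of indicators are encoded as lists of coefficients and predicates, so that
    one formula computes the mean of [f] and the mean of the function that dominates its square. *)
Let mean_lin (l : seq (R * pred T)) :
  \sum_k p k * (\sum_(x <- l) x.1 * (x.2 k)%:R) =
  \sum_(x <- l) x.1 * Pr P (Z 0%N @^-1` [set z | x.2 (h z)]).
Proof.
elim: l => [|x l IH].
  by rewrite big_nil big1// => k _; rewrite big_nil mulr0.
rewrite big_cons -IH -(mean_class_pred Z_iid mh) mulr_sumr -big_split.
by apply: eq_bigr => k _ /=; rewrite big_cons; ring.
Qed.

Let F_and (x y : R) :
  Pr P (Z 0%N @^-1` [set z | (z.1 <= x) && (z.2 <= y)]) = F x y.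
Proof. by congr Pr; apply/seteqP; split => w /=; [move/andP|move=> ?; apply/andP]. Qed.

Let f (k : T) : R :=
  (k.1.1 && k.2.1)%:R - (k.1.2 && k.2.2)%:R
  - a * (k.1.1%:R - k.1.2%:R) - b * (k.2.1%:R - k.2.2%:R).

Let f3 k : `|f k| <= 3.
Proof.
move: a1 b1; rewrite !ler_norml /f.
by case: k => -[[] []] [[] []] /=; lra.
Qed.

Let f_mean : \sum_k p k * f k =
  (F s t - F s v - F u t + F u v) + (F s v - F u v - a * (s - u))
  + (F u t - F u v - b * (t - v)).
Proof.
have := mean_lin [:: (1, fun k : T => k.1.1 && k.2.1); (-1, fun k : T => k.1.2 && k.2.2);
  (- a, fun k : T => k.1.1); (a, fun k : T => k.1.2);
  (- b, fun k : T => k.2.1); (b, fun k : T => k.2.2)].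
rewrite [RHS]big_cons !big_cons big_nil /= !F_and.
rewrite s_law u_law t_law v_law => E.
transitivity (\sum_k p k * \sum_(x <- [:: (1, fun k : T => k.1.1 && k.2.1); (-1, fun k : T => k.1.2 && k.2.2);
  (- a, fun k : T => k.1.1); (a, fun k : T => k.1.2);
  (- b, fun k : T => k.2.1); (b, fun k : T => k.2.2)]) x.1 * (x.2 k)%:R).
  by apply: eq_bigr => k _; rewrite !big_cons big_nil /f /=; congr (_ * _); ring.
by rewrite E; ring.
Qed.

(* With A = 1(z.1 <= s) - 1(z.1 <= u) and B = 1(z.2 <= t) - 1(z.2 <= v), the summand is
   A (1(z.2 <= v) - a) + B (1(z.1 <= u) - b) + A B; the signs make [e1 * A] and [e2 * B]
   indicators, and E|A B| <= K. *)
Let e1 : R := if u <= s then 1 else - 1.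
Let e2 : R := if v <= t then 1 else - 1.

Let f_sqr_mean : \sum_k p k * f k ^+ 2 <= dl / 2 + 23 * K.
Proof.
(* The list encodes |A| (1(z.2 <= v) - a)^2 + |B| (1(z.1 <= u) - b)^2 + 17 |A B|. As |1(z.2 <= v) -
   a| and |1(z.1 <= u) - b| are at most 2, the remaining terms of the square are at most (8 + 4 + 4
   + 1) |A B|. In the mean, the first two terms give a (1 - a) |s - u| and b (1 - b) |t - v| up to 3
   K each, and 3 + 3 + 17 = 23. *)
pose l : seq (R * pred T) :=
  [:: (e1 * (1 - 2 * a) - 17 * e1 * e2, fun k : T => k.1.1 && k.2.2);
      (17 * e1 * e2 - e1 * (1 - 2 * a) - e2 * (1 - 2 * b), fun k : T => k.1.2 && k.2.2);
      (e1 * a ^+ 2, fun k : T => k.1.1); (- e1 * a ^+ 2, fun k : T => k.1.2);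
      (e2 * (1 - 2 * b) - 17 * e1 * e2, fun k : T => k.1.2 && k.2.1);
      (e2 * b ^+ 2, fun k : T => k.2.1); (- e2 * b ^+ 2, fun k : T => k.2.2);
      (17 * e1 * e2, fun k : T => k.1.1 && k.2.1)].
apply: (@le_trans _ _ (\sum_k p k * (\sum_(x <- l) x.1 * (x.2 k)%:R))).
  apply: (@le_mean _ _ _ P Z _ h (fun k => f k ^+ 2)
    (fun k => \sum_(x <- l) x.1 * (x.2 k)%:R)) => z.
  rewrite /l !big_cons big_nil /h /thresholds /f /=.
  have ab : -1 <= a * b <= 1.
    by rewrite -ler_norml normrM -[leRHS]mulr1 ler_pM.
  have ha : -1 <= a <= 1 by rewrite -ler_norml.
  have hb : -1 <= b <= 1 by rewrite -ler_norml.
  rewrite /e1 /e2.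
  (* The order of the two thresholds excludes the outcomes for which [e1 * A] would be negative;
     only the consistent ones are compared. *)
  have Hx : (u <= s) /\ (z.1 <= u -> z.1 <= s) \/ ~~ (u <= s) /\ (z.1 <= s -> z.1 <= u).
    case: (leP u s) => us; [left|right]; split => // ?.
      exact: le_trans us.
    exact: le_trans (ltW us).
  have Hy : (v <= t) /\ (z.2 <= v -> z.2 <= t) \/ ~~ (v <= t) /\ (z.2 <= t -> z.2 <= v).
    case: (leP v t) => vt; [left|right]; split => // ?.
      exact: le_trans vt.
    exact: le_trans (ltW vt).
  move: Hx Hy => [[-> Hx]|[/negbTE -> Hx]] [[-> Hy]|[/negbTE -> Hy]];
  move: Hx Hy; case: (z.1 <= s); case: (z.1 <= u); case: (z.2 <= t); case: (z.2 <= v);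
  move=> /= Hx Hy; (try by move: (Hx isT)); (try by move: (Hy isT));
  clear Hx Hy; rewrite /= ?mulr1n ?mulr0n; lra.
rewrite mean_lin /l !big_cons big_nil /= !F_and s_law u_law t_law v_law.
have E1 : e1 * (s - u) <= dl.
  rewrite /e1; case: (leP u s) => us.
    by rewrite mul1r (le_trans (ler_norm _)).
  by rewrite mulN1r (le_trans _ su)// -normrN ler_norm.
have E2 : e2 * (t - v) <= dl.
  rewrite /e2; case: (leP v t) => us.
    by rewrite mul1r (le_trans (ler_norm _)).
  by rewrite mulN1r (le_trans _ tv)// -normrN ler_norm.
have E1' : 0 <= e1 * (s - u).
  by rewrite /e1; case: (leP u s) => us; [rewrite mul1r subr_ge0|rewrite mulN1r opprB subr_ge0 ltW].
have E2' : 0 <= e2 * (t - v).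
  by rewrite /e2; case: (leP v t) => us; [rewrite mul1r subr_ge0|rewrite mulN1r opprB subr_ge0 ltW].
have K0 : 0 <= K by apply: le_trans Fu; exact: normr_ge0.
pose X := F s v - F u v - a * (s - u).
pose Y := F u t - F u v - b * (t - v).
pose W := F s t - F s v - F u t + F u v.
have ne1 : `|e1| = 1 by rewrite /e1; case: ifP; rewrite ?normrN normr1.
have ne2 : `|e2| = 1 by rewrite /e2; case: ifP; rewrite ?normrN normr1.
have BX : e1 * (1 - 2 * a) * X <= 3 * K.
  apply: (le_trans (ler_norm _)); rewrite !normrM ne1 mul1r ler_pM//.
  by move: a1; rewrite !ler_norml; lra.
have BY : e2 * (1 - 2 * b) * Y <= 3 * K.
  apply: (le_trans (ler_norm _)); rewrite !normrM ne2 mul1r ler_pM//.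
  by move: b1; rewrite !ler_norml; lra.
have BW : 17 * e1 * e2 * W <= 17 * K.
  apply: (le_trans (ler_norm _)); rewrite !normrM ne1 ne2 !mulr1.
  by rewrite ger0_norm// ler_wpM2l.
have Q1 : e1 * (s - u) * (a * (1 - a)) <= dl / 4.
  apply: (@le_trans _ _ (e1 * (s - u) * 4^-1)); last by rewrite ler_wpM2r.
  by rewrite ler_wpM2l//; have := sqr_ge0 (a - 2^-1); lra.
have Q2 : e2 * (t - v) * (b * (1 - b)) <= dl / 4.
  apply: (@le_trans _ _ (e2 * (t - v) * 4^-1)); last by rewrite ler_wpM2r.
  by rewrite ler_wpM2l//; have := sqr_ge0 (b - 2^-1); lra.
rewrite [leLHS](_ : _ = e1 * (s - u) * (a * (1 - a)) + e2 * (t - v) * (b * (1 - b))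
  + e1 * (1 - 2 * a) * X + e2 * (1 - 2 * b) * Y + 17 * e1 * e2 * W); last first.
  by rewrite /X /Y /W; ring.
lra.
Qed.

Lemma measurable_osc_event (n : nat) (y : R) :
  measurable [set w | y <= `|\sum_(i < n) osc s t u v a b (Z i w)|].
Proof.
have mA := measurable_class_sum_ge Z_iid mh f 0 n y.
have mB := measurable_class_sum_ge Z_iid mh (fun k => - f k) 0 n y.
have := measurableU _ _ mA mB; congr measurable; apply/seteqP; split => w /=;
by rewrite !big_mkord sumrN ler_normr => /orP.
Qed.

(** The mean of a summand is a sum of three remainders of size K, so centering lowers the threshold
    by at most 3 K n. The centered summand is bounded by 3 + 3 = 6, whence 12, and its variance by
    the second moment. *)
Lemma bernstein_osc (n : nat) (y q : R) :
  n%:R * (dl / 2 + 23 * K) <= q -> 0 < q ->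
  3 * K * n%:R <= y -> 6 * y <= q ->
  Pr P [set w | y <= `|\sum_(i < n) osc s t u v a b (Z i w)|] <=
  2 * expR (- ((y - 3 * K * n%:R) ^+ 2 / (2 * q) * (1 - 12 * y / q))).
Proof.
move=> nq q0 Ky yq.
pose mu := \sum_k p k * f k.
have mu3K : `|mu| <= 3 * K.
  rewrite /mu f_mean; have -> : 3 * K = K + K + K by ring.
  apply: (le_trans (ler_normD _ _)); rewrite lerD//.
  by apply: (le_trans (ler_normD _ _)); rewrite lerD.
have p1 : \sum_k p k = 1 by exact: sum_class_prob.
have K0 : 0 <= K by apply: le_trans Fu; exact: normr_ge0.
have mu3 : `|mu| <= 3.
  rewrite /mu; apply: (le_trans (ler_norm_sum _ _ _)).
  apply: (@le_trans _ _ (\sum_k p k * 3)); last by rewrite -mulr_suml p1 mul1r.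
  apply: ler_sum => k _; rewrite normrM (ger0_norm (class_prob_ge0 _ _ _ _)).
  by apply: ler_wpM2l; [exact: class_prob_ge0 | exact: f3].
pose x := y - 3 * K * n%:R.
have x0 : 0 <= x by rewrite subr_ge0.
have xy : x <= y by rewrite gerBl !mulr_ge0.
have := @bernstein_maximal _ _ _ P Z Z_iid _ h mh (fun k => f k - mu)
   (dl / 2 + 23 * K) 6 x q n.
move=> H; apply: (le_trans (le_trans _ (H _ _ _ _ _ _ _))) => //.
- apply: le_Pr => [||w /=].
  + exact: measurable_osc_event.
  + exact: (measurable_abs_hit Z_iid mh (fun k => f k - mu)).
  move=> yw; exists n => //.
  have -> : \sum_(i < n) (f (h (Z i w)) - mu) =
      \sum_(i < n) osc s t u v a b (Z i w) - n%:R * mu.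
    by rewrite sumrB sumr_const card_ord mulr_natl.
  apply: le_trans (lerB_dist _ _); rewrite /x; apply: lerB => //.
  by rewrite normrM ger0_norm// mulrC ler_wpM2r.
- under eq_bigr do rewrite mulrBr.
  by rewrite sumrB -mulr_suml p1 mul1r subrr.
- move=> k; apply: (le_trans (ler_normB _ _)).
  by have := f3 k; lra.
- apply: (le_trans _ f_sqr_mean).
  rewrite [leLHS](_ : _ = \sum_k p k * f k ^+ 2 - mu ^+ 2).
    by rewrite gerBl sqr_ge0.
  transitivity (\sum_k (p k * f k ^+ 2 - 2 * mu * (p k * f k) + mu ^+ 2 * p k)).
    by apply: eq_bigr => k _; ring.
  by rewrite big_split sumrB -!mulr_sumr p1 -/mu /=; ring.
- lra.
rewrite ler_wpM2l// ler_expR lerN2 -/x.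
apply: ler_wpM2l.
  by rewrite divr_ge0 ?sqr_ge0// mulr_ge0// ltW.
rewrite lerD2l lerN2 ler_pM2r ?invr_gt0//.
lra.
Qed.

End Oscillation.

(** * Calculus on the unit square *)

Section UnitSquareCalculus.
Context {R : realType}.
Implicit Types f C : R * R -> R.

Lemma MVT_line f (phi : R -> R * R) (e : R * R) (a b : R) :
  (forall x h, phi (h + x) = h *: e + phi x) ->
  (forall x, 0 < x < 1 -> derivable f (phi x) e) ->
  0 < a < 1 -> 0 < b < 1 ->
  exists2 c, 0 < c < 1 /\ (a <= c <= b \/ b <= c <= a) &
    f (phi b) - f (phi a) = 'D_e f (phi c) * (b - a).
Proof.
move=> phiD df; wlog ab : a b / a <= b => [W|] a01 b01.
  have [|/ltW] := leP a b; first by move=> /W; exact.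
  move=> /W /(_ b01 a01)[c [c01 cab] E].
  by exists c; [split => //; case: cab; [right|left]|rewrite -opprB E -mulrN opprB].
have E x : (fun h : R => h^-1 *: ((f \o shift (phi x)) (h *: e) - f (phi x))) =
  (fun h : R => h^-1 *: (((f \o phi) \o shift x) (h *: (1 : R)) - (f \o phi) x)).
  by apply/funext => h /=; rewrite -phiD /GRing.scale /= mulr1.
have dfphi x : 0 < x < 1 -> derivable (f \o phi) x 1.
  by move=> /df; rewrite /derivable E.
have [||c cab ->] := @MVT_segment R (f \o phi) (fun x => 'D_e f (phi x)) a b ab.
- move=> x; rewrite in_itv /= => /andP[ax xb].
  have x01 : 0 < x < 1.
    by rewrite (lt_trans _ ax) ?(lt_trans xb)//; [case/andP: b01|case/andP: a01].
  split; first exact: dfphi.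
  by rewrite /derive E.
- apply: derivable_within_continuous => x; rewrite in_itv /= => /andP[ax xb].
  apply: dfphi; rewrite (lt_le_trans _ ax) ?(le_lt_trans xb)//.
    by case/andP: b01.
  by case/andP: a01.
move: cab; rewrite in_itv /= => /andP[ac cb].
exists c => //; split; last by left; rewrite ac cb.
rewrite (lt_le_trans _ ac) ?(le_lt_trans cb)//; first by case/andP: b01.
by case/andP: a01.
Qed.

Lemma MVT_u f (a b v : R) :
  (forall p, open_square p -> derivable f p (1, 0)) ->
  0 < a < 1 -> 0 < b < 1 -> 0 < v < 1 ->
  exists2 c, 0 < c < 1 /\ (a <= c <= b \/ b <= c <= a) &
    f (b, v) - f (a, v) = partial_u f (c, v) * (b - a).
Proof.
move=> df a01 b01 v01; apply: (@MVT_line f (fun x => (x, v)) (1, 0)) => //.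
  by move=> x h; apply/pair_equal_spec; split => /=; rewrite /GRing.scale /= ?mulr1 ?mulr0 ?add0r.
by move=> x x01; apply: df.
Qed.

Lemma MVT_v f (a b u : R) :
  (forall p, open_square p -> derivable f p (0, 1)) ->
  0 < a < 1 -> 0 < b < 1 -> 0 < u < 1 ->
  exists2 c, 0 < c < 1 /\ (a <= c <= b \/ b <= c <= a) &
    f (u, b) - f (u, a) = partial_v f (u, c) * (b - a).
Proof.
move=> df a01 b01 u01; apply: (@MVT_line f (fun x => (u, x)) (0, 1)) => //.
  by move=> x h; apply/pair_equal_spec; split => /=; rewrite /GRing.scale /= ?mulr1 ?mulr0 ?add0r.
by move=> x x01; apply: df.
Qed.

Lemma unit_square_compact : compact (@unit_square R).
Proof.
have -> : @unit_square R = `[0, 1]%classic `*` `[0, 1]%classic.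
  by apply/seteqP; split => -[x y] /=; rewrite !in_itv.
by apply: compact_setX; exact: segment_compact.
Qed.

Lemma bounded_of_boundary_ext f :
  {within unit_square, continuous boundary_ext f} ->
  exists M, forall p, open_square p -> `|f p| <= M.
Proof.
move=> cf; have := continuous_compact cf unit_square_compact.
move=> /compact_bounded [M [_ HM]]; exists (M + 1) => p Op.
have -> : f p = boundary_ext f p by rewrite /boundary_ext mem_set.
apply: (HM (M + 1)); first by rewrite ltrDl.
exists p => //; case: Op => /andP[a b] /andP[c e].
by split; rewrite !ltW.
Qed.

Definition l1dist (p q : R * R) : R := `|p.1 - q.1| + `|p.2 - q.2|.

Lemma lipschitz_open_square f :
  C1_on open_square f ->
  {within unit_square, continuous boundary_ext (partial_u f)} ->
  {within unit_square, continuous boundary_ext (partial_v f)} ->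
  exists2 L, 0 <= L & forall p q, open_square p -> open_square q ->
    `|f p - f q| <= L * l1dist p q.
Proof.
move=> [df _] /bounded_of_boundary_ext[Mu Hu] /bounded_of_boundary_ext[Mv Hv].
pose L := `|Mu| + `|Mv|.
have LM p : open_square p -> `|partial_u f p| <= L /\ `|partial_v f p| <= L.
  move=> Op; split.
    apply: (le_trans (Hu _ Op)); apply: (le_trans (ler_norm _)).
    by rewrite lerDl.
  apply: (le_trans (Hv _ Op)); apply: (le_trans (ler_norm _)).
  by rewrite lerDr.
exists L => [|[p1 p2] [q1 q2] [/= p1_ p2_] [/= q1_ q2_]]; first exact: addr_ge0.
have [c [c01 _] E1] := @MVT_u f q1 p1 p2 (fun p Op => (df p Op).1) q1_ p1_ p2_.
have [e [e01 _] E2] := @MVT_v f q2 p2 q1 (fun p Op => (df p Op).2) q2_ p2_ q1_.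
have -> : f (p1, p2) - f (q1, q2) =
   (f (p1, p2) - f (q1, p2)) + (f (q1, p2) - f (q1, q2)) by ring.
rewrite E1 E2; apply: (le_trans (ler_normD _ _)); rewrite !normrM /l1dist /= mulrDr.
by rewrite lerD// ler_wpM2r//; [case: (LM (c, p2))|case: (LM (q1, e))].
Qed.

(** The Lipschitz bound makes the values of f along the open square a Cauchy filter at the boundary
    point, so the [lim] in [boundary_ext] is a true limit, and the bound passes to it. *)
Lemma boundary_ext_lipschitz f L :
  0 <= L ->
  (forall p q, open_square p -> open_square q -> `|f p - f q| <= L * l1dist p q) ->
  forall p q, unit_square p -> open_square q ->
    `|boundary_ext f p - f q| <= L * l1dist p q.
Proof.
move=> L0 fL p q Up Oq; rewrite /boundary_ext; case: ifP => [/set_mem|_].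
  by move=> Op; exact: fL.
have near_p (e : R) : 0 < e ->
    \forall x \near within open_square (nbhs p), open_square x /\ l1dist x p < e.
  move=> e0; apply: filterI; first exact: withinT.
  apply: cvg_within; apply/nbhs_ballP; exists (e / 2); first by rewrite /= divr_gt0.
  move=> x [/= x1 x2]; rewrite /l1dist.
  move: x1 x2; rewrite /ball /= => x1 x2.
  by rewrite (distrC x.1) (distrC x.2) (splitr e) ltrD.
have PF : ProperFilter (within open_square (nbhs p)).
  apply: within_nbhs_proper => B /nbhs_ballP[e /= e0 eB].
  (* Shrinking towards the center (1/2, 1/2) by the factor 1 - t moves any point of the closed
     square into the open one, by less than e in each coordinate. *)
  pose t := Num.min (e / 2) (1 / 2).
  have t0 : 0 < t by rewrite lt_min !divr_gt0.
  have te : t < e by rewrite gt_min gtr_pMr// invf_lt1// ltr1n.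
  have t1 : t < 1 by rewrite gt_min; apply/orP; right; lra.
  pose m (x : R) := (1 - t) * x + t / 2.
  have m01 x : 0 <= x <= 1 -> 0 < m x < 1.
    by move=> /andP[x0 x1]; rewrite /m; apply/andP; split; nra.
  have mx x : 0 <= x <= 1 -> `|x - m x| < e.
    move=> /andP[x0 x1]; rewrite (le_lt_trans _ te)// /m ler_norml.
    by apply/andP; split; nra.
  case: p Up eB near_p => p1 p2 [/= p1_ p2_] eB _.
  exists (m p1, m p2); split; first by split; apply: m01.
  by apply: eB; split; rewrite /ball /=; exact: mx.
have cvgf : cvg (f x @[x --> within open_square (nbhs p)]).
  apply: cauchy_cvg; apply: cauchy_exP => e e0.
  have eL : 0 < e / (2 * (L + 1)) by rewrite divr_gt0// mulr_gt0// ltr_wpDl.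
  have [x0 [Ox0 x0p]] := filter_ex (near_p _ eL).
  exists (f x0).
  apply: filterS (near_p _ eL) => x [Ox xp].
  apply: (le_lt_trans (fL _ _ Ox0 Ox)).
  have H : l1dist x0 x <= l1dist x0 p + l1dist x p.
    rewrite /l1dist; have := ler_distD p.1 x0.1 x.1; have := ler_distD p.2 x0.2 x.2.
    by rewrite (distrC p.1) (distrC p.2); lra.
  have : l1dist x0 x < e / (L + 1).
    apply: (le_lt_trans H); have -> : e / (L + 1) = e / (2 * (L + 1)) + e / (2 * (L + 1)).
      by field; rewrite gt_eqF// ltr_wpDl.
    exact: ltrD.
  rewrite ltr_pdivlMr ?ltr_wpDl//; apply: le_lt_trans.
  rewrite mulrC ler_wpM2l//; last by rewrite lerDl.
  by rewrite /l1dist addr_ge0.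
set l := lim _.
have fl : f x @[x --> within open_square (nbhs p)] --> l by [].
apply/ler_addgt0Pr => e e0.
have eL : 0 < e / (2 * (L + 1)) by rewrite divr_gt0// mulr_gt0// ltr_wpDl.
have e2 : 0 < e / 2 by rewrite divr_gt0.
have : \forall x \near within open_square (nbhs p), `|l - f x| < e / 2.
  by move/cvgr_dist_lt : fl => /(_ _ e2).
move=> /(filterI (near_p _ eL)) /filter_ex [x [[Ox xp] lx]].
have := fL _ _ Ox Oq; have := ler_distD (f x) l (f q).
have : l1dist x q <= l1dist p q + l1dist x p.
  rewrite /l1dist; have := ler_distD p.1 x.1 q.1; have := ler_distD p.2 x.2 q.2.
  by lra.
move=> /(ler_wpM2l L0); rewrite mulrDr.
have : L * l1dist x p <= e / 2.
  apply: (@le_trans _ _ ((L + 1) * (e / (2 * (L + 1))))).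
    by apply: ler_pM => //; [rewrite /l1dist addr_ge0 | rewrite lerDl | exact: ltW].
  by rewrite le_eqVlt; apply/orP; left; apply/eqP; field; rewrite gt_eqF// ltr_wpDl.
lra.
Qed.

(** The mean value theorem is applied in one variable at a time, and the first partial derivative at
    the intermediate point is compared by its Lipschitz bound. In the mixed difference the two
    intermediate points are up to 2 dl apart in the first coordinate and dl in the second, which
    explains the factor 3. *)
Lemma C2_expansion C : C2_on open_square C -> second_partials_continuous C ->
  exists2 L, 0 <= L & [/\
    (forall s t u v dl, 0 < s < 1 -> 0 < t < 1 -> 0 < u < 1 -> 0 < v < 1 ->
      `|s - u| <= dl -> `|t - v| <= dl -> [/\
      `|C (s, v) - C (u, v) - partial_u C (u, v) * (s - u)| <= L * dl ^+ 2,
      `|C (u, t) - C (u, v) - partial_v C (u, v) * (t - v)| <= L * dl ^+ 2 &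
      `|C (s, t) - C (s, v) - C (u, t) + C (u, v)| <= L * dl ^+ 2]),
    (forall p q, unit_square p -> open_square q ->
      `|boundary_ext (partial_u C) p - partial_u C q| <= L * l1dist p q) &
    (forall p q, unit_square p -> open_square q ->
      `|boundary_ext (partial_v C) p - partial_v C q| <= L * l1dist p q)].
Proof.
move=> [[dC _] Cu Cv] [uu uv vu vv].
have [L1 L10 HL1] := lipschitz_open_square Cu uu vu.
have [L2 L20 HL2] := lipschitz_open_square Cv uv vv.
have l1_ge0 p q : 0 <= l1dist p q by rewrite addr_ge0.
exists (3 * (L1 + L2)); first by rewrite mulr_ge0// addr_ge0.
have dCu p (Op : open_square p) := (dC p Op).1.
have dCv p (Op : open_square p) := (dC p Op).2.
split; last 2 first.
- move=> p q Up Oq; apply: (le_trans (boundary_ext_lipschitz L10 HL1 Up Oq)).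
  by rewrite ler_wpM2r//; lra.
- move=> p q Up Oq; apply: (le_trans (boundary_ext_lipschitz L20 HL2 Up Oq)).
  by rewrite ler_wpM2r//; lra.
move=> s t u v dl s01 t01 u01 v01 su tv.
have dl0 : 0 <= dl by apply: le_trans su.
have near_u c : u <= c <= s \/ s <= c <= u -> `|c - u| <= dl.
  move=> H; apply: le_trans su; case: H => /andP[x1 x2].
    by rewrite !ger0_norm ?subr_ge0 ?lerD2r// (le_trans x1).
  by rewrite !ler0_norm ?subr_le0 ?lerN2 ?lerD2r// (le_trans x1).
have near_v c : v <= c <= t \/ t <= c <= v -> `|c - v| <= dl.
  move=> H; apply: le_trans tv; case: H => /andP[x1 x2].
    by rewrite !ger0_norm ?subr_ge0 ?lerD2r// (le_trans x1).
  by rewrite !ler0_norm ?subr_le0 ?lerN2 ?lerD2r// (le_trans x1).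
have [c1 [c101 /near_u c1u] E1] := MVT_u dCu u01 s01 v01.
have [c2 [c201 /near_v c2v] E2] := MVT_v dCv v01 t01 u01.
have [c3 [c301 /near_u c3u] E3] := MVT_u dCu u01 s01 t01.
have bound x y (L : R) : 0 <= L -> L <= L1 + L2 -> x <= L * (3 * dl) -> 0 <= y -> y <= dl ->
    x * y <= 3 * (L1 + L2) * dl ^+ 2.
  move=> L0 LL xL y0 ydl; apply: (@le_trans _ _ (L * (3 * dl) * dl)).
    apply: (@le_trans _ _ (L * (3 * dl) * y)); first by rewrite ler_wpM2r.
    by rewrite ler_wpM2l// mulr_ge0// mulr_ge0.
  rewrite [leLHS](_ : _ = 3 * L * dl ^+ 2); last by ring.
  by rewrite ler_wpM2r ?sqr_ge0// ler_wpM2l.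
split.
- rewrite E1 -mulrBl normrM.
  apply: (bound _ _ L1) => //; first by rewrite lerDl.
  apply: (le_trans (HL1 (c1, v) (u, v) _ _)) => //.
  by rewrite ler_wpM2l// /l1dist /= subrr normr0; lra.
- rewrite E2 -mulrBl normrM.
  apply: (bound _ _ L2) => //; first by rewrite lerDr.
  apply: (le_trans (HL2 (u, c2) (u, v) _ _)) => //.
  by rewrite ler_wpM2l// /l1dist /= subrr normr0; lra.
have -> : C (s, t) - C (s, v) - C (u, t) + C (u, v) =
    (C (s, t) - C (u, t)) - (C (s, v) - C (u, v)) by ring.
rewrite E1 E3 -mulrBl normrM.
apply: (bound _ _ L1) => //; first by rewrite lerDl.
apply: (le_trans (HL1 (c3, t) (c1, v) _ _)) => //.
rewrite ler_wpM2l// /l1dist /=; have := ler_distD u c3 c1.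
by rewrite (distrC u c1); lra.
Qed.

(** Difference quotients of a 1-Lipschitz function are at most 1, and a is their limit by the
    quadratic expansion. A copula is 1-Lipschitz in each variable, so this bounds its partial
    derivatives. *)
Lemma slope_le1 (g : R -> R) (a L u : R) : 0 <= L -> 0 < u < 1 ->
  (forall s, 0 < s < 1 -> `|g s - g u - a * (s - u)| <= L * `|s - u| ^+ 2) ->
  (forall s, 0 < s < 1 -> `|g s - g u| <= `|s - u|) -> `|a| <= 1.
Proof.
move=> L0 /andP[u0 u1] ga g1; apply/ler_addgt0Pr => e e0.
pose x := Num.min (e / (L + 1)) ((1 - u) / 2).
have x0 : 0 < x by rewrite lt_min !divr_gt0 ?subr_gt0// ltr_wpDl.
have xe : L * x <= e.
  apply: (@le_trans _ _ ((L + 1) * (e / (L + 1)))).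
    by apply: ler_pM => //; [exact: ltW | rewrite lerDl | rewrite ge_min lexx].
  by rewrite mulrC divfK// gt_eqF// ltr_wpDl.
have x1 : x <= (1 - u) / 2 by rewrite ge_min lexx orbT.
have s01 : 0 < u + x < 1 by apply/andP; split; lra.
have := ga _ s01; have := g1 _ s01; rewrite addrAC subrr add0r (gtr0_norm x0) => H1 H2.
have : `|a| * x <= (1 + e) * x.
  rewrite -[in leLHS](gtr0_norm x0) -normrM.
  have -> : a * x = (g (u + x) - g u) - (g (u + x) - g u - a * x) by ring.
  apply: (le_trans (ler_normB _ _)); rewrite mulrDl mul1r lerD//.
  apply: (le_trans H2); rewrite expr2 mulrA ler_wpM2r//; exact: ltW.
by rewrite ler_pM2r.
Qed.

End UnitSquareCalculus.

(** * Convergent series, the Borel-Cantelli lemma and growth of iterated logarithms *)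

Section Series.
Context {R : realType}.

(** The summand is k^-p, except that [ln 0 = 0] makes it 1 at k = 0. From k = 2 on the sum is
    dominated by a telescoping one: with b = p - 1, (k + 1)^-p <= (k^-b - (k + 1)^-b) / b. *)
Lemma pseries_bounded (p : R) : 1 < p ->
  forall n, \sum_(k < n) expR (- (p * ln k%:R)) <= 2 + (p - 1)^-1.
Proof.
move=> p1 n; pose b := p - 1; have b0 : 0 < b by rewrite subr_gt0.
pose e (k : nat) := expR (- (b * ln k%:R)).
have step k : (0 < k)%N -> expR (- (p * ln k.+1%:R)) <= (e k - e k.+1) / b.
  move=> k0; rewrite ler_pdivlMr// /e.
  have k0' : 0 < k%:R :> R by rewrite ltr0n.
  have -> : p = b + 1 by rewrite /b subrK.
  rewrite mulrDl mul1r opprD expRD (expRN (ln _)) lnK ?posrE ?ltr0n//.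
  have H : ln k%:R <= ln k.+1%:R - (k.+1%:R)^-1 :> R.
    have -> : k%:R = k.+1%:R * (1 - (k.+1%:R)^-1) :> R.
      by rewrite mulrBr mulr1 mulfV ?pnatr_eq0// -(natr1 k) addrK.
    have i1 : 0 < 1 - (k.+1%:R)^-1 :> R.
      by rewrite subr_gt0 invf_lt1 ?ltr1n ?ltr0n.
    rewrite lnM ?posrE ?ltr0n// lerD2l.
    by apply: le_ln1Dx; rewrite ltrN2 invf_lt1 ?ltr1n ?ltr0n.
  have Hx : expR (- (b * (ln k.+1%:R - (k.+1%:R)^-1))) <= expR (- (b * ln k%:R)) :> R.
    by rewrite ler_expR lerN2 ler_pM2l.
  rewrite lerBrDl; apply: le_trans Hx.
  have -> : - (b * (ln k.+1%:R - k.+1%:R^-1)) = - (b * ln k.+1%:R) + b / k.+1%:R by ring.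
  set E := expR (- _).
  rewrite expRD -/E (_ : _ + _ = E * (1 + b / k.+1%:R)); last by ring.
  by rewrite ler_wpM2l ?expR_ge0// expR_ge1Dx.
case: n => [|n]; first by rewrite big_ord0 addr_ge0// invr_ge0 ltW.
rewrite big_ord_recl /= ln0// mulr0 oppr0 expR0.
have : \sum_(i < n) expR (- (p * ln (lift ord0 i)%:R)) <= 1 + (1 - e n) / b.
  elim: n => [|n IH].
    rewrite big_ord0 /e ln0// mulr0 oppr0 expR0 subrr mul0r addr0; exact: ler01.
  rewrite big_ord_recr /=; case: n IH => [|n] IH.
    rewrite big_ord0 add0r /bump /= /e ln1 !mulr0 oppr0 expR0 subrr mul0r addr0.
    exact: lexx.
  have := step n.+1 isT; rewrite /bump /= add1n => H.
  apply: (le_trans (lerD IH H)); rewrite -addrA -mulrDl.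
  by rewrite addrA subrK.
move=> H; have -> : 2 = 1 + 1 :> R by [].
rewrite -addrA lerD2l; apply: (le_trans H).
rewrite lerD2l -[leRHS]mul1r ler_pM2r ?invr_gt0// gerBl.
exact: expR_ge0.
Qed.

End Series.

Section BorelCantelli.
Context {d : measure_display} {Omega : measurableType d} {R : realType}.
Variable P : probability Omega R.

Lemma borel_cantelli_ae (A : nat -> set Omega) (u : nat -> R) (C : R) :
  (forall k, measurable (A k)) -> (forall k, 0 <= u k) ->
  (forall n, \sum_(k < n) u k <= C) ->
  (\forall k \near \oo, Pr P (A k) <= u k) ->
  {ae P, forall w, \forall k \near \oo, ~ A k w}.
Proof.
move=> mA u0 uC [k0 _ Hk].
pose B k := A (k + k0)%N.
have mB k : measurable (B k) by exact: mA.
have B0 : P (lim_sup_set B) = 0%E.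
  apply: lim_sup_set_cvg0 => //.
  apply: (@le_lt_trans _ _ C%:E); last exact: ltry.
  apply: lime_le; first by apply: is_cvg_nneseries.
  apply: nearW => n.
  apply: (@le_trans _ _ (\sum_(k < n) u (k + k0)%N)%:E).
    rewrite big_mkord -sumEFin; apply: lee_sum => k _.
    have : Pr P (B k) <= u (k + k0)%N by apply: Hk; rewrite /= leq_addl.
    by rewrite -lee_fin -(PrE P (mB k)).
  rewrite lee_fin (le_trans _ (uC (n + k0)%N))//.
  rewrite -(big_mkord xpredT u) -(big_mkord xpredT (fun k => u (k + k0)%N)).
  rewrite [leRHS](@big_cat_nat _ _ _ k0) ?leq_addl//=.
  have -> : \sum_(k0 <= i < n + k0) u i = \sum_(0 <= i < n) u (i + k0)%N.
    by rewrite -{1}(add0n k0) big_addn addnK.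
  rewrite lerDr.
  by apply: sumr_ge0.
have mlim : measurable (lim_sup_set B).
  apply: bigcap_measurableType => // k _.
  by apply: bigcup_measurable => j _.
exists (lim_sup_set B); split => //.
move=> w /= Hw n _; apply: contrapT => H; apply: Hw.
exists (n + k0)%N => // k /= nk Akw; apply: H.
exists (k - k0)%N; first by rewrite /= leq_subRL ?(leq_trans _ nk) ?leq_addl// addnC.
by rewrite /B subnK// (leq_trans _ nk) ?leq_addl.
Qed.

End BorelCantelli.

Section Growth.
Context {R : realType}.

Lemma sqr_le_expR (C c : R) : 0 < c ->
  exists x0, forall x, x0 <= x -> C * x ^+ 2 <= expR (c * x).
Proof.
move=> c0; exists (Num.max 0 (6 * C / c ^+ 3)) => x; rewrite ge_max => /andP[x0 xC].
have := @expR_ge1Dxn R (c * x) 2 (mulr_ge0 (ltW c0) x0).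
apply: le_trans; apply: ler_wpDl => //.
rewrite [in leRHS](_ : 3`!%:R = 6 :> R)// ler_pdivlMr// exprMn.
move: xC; rewrite ler_pdivrMr ?exprn_gt0// => H.
have -> : C * x ^+ 2 * 6 = 6 * C * x ^+ 2 by ring.
have -> : c ^+ 3 * x ^+ 3 = x * c ^+ 3 * x ^+ 2 by ring.
by rewrite ler_wpM2r ?sqr_ge0.
Qed.

Lemma near_natr_ge (C : R) : \forall n \near \oo, C <= n%:R.
Proof. exact: nbhs_infty_ger. Qed.

Lemma near_ln_ge (C : R) : \forall n \near \oo, C <= ln n%:R.
Proof.
apply: filterS (near_natr_ge (expR C)) => n Cn.
by rewrite -[leLHS]expRK ler_ln// posrE ?expR_gt0// (lt_le_trans _ Cn)// expR_gt0.
Qed.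

Lemma near_sqr_ln_le (C c : R) : 0 < c ->
  \forall k \near \oo, C * (ln k%:R) ^+ 2 <= expR (c * k%:R).
Proof.
move=> c0; have [x0 H] := sqr_le_expR `|C| c0.
apply: filterS2 (near_natr_ge x0) (near_natr_ge 1) => k x0k k1.
apply: (le_trans _ (H _ x0k)); apply: (@le_trans _ _ (`|C| * ln k%:R ^+ 2)).
  by rewrite ler_wpM2r ?sqr_ge0// ler_norm.
rewrite ler_wpM2l// ler_sqr ?nnegrE ?ln_ge0//.
by rewrite ltW// ln_sublinear// (lt_le_trans _ k1).
Qed.

Lemma log1_ge1 (u : R) : 1 <= log1 u.
Proof.
rewrite /log1 -{1}(expRK (1 : R)) ler_ln ?posrE ?expR_gt0//.
  by rewrite le_max lexx orbT.
by rewrite lt_max expR_gt0 orbT.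
Qed.

Lemma log1E (u : R) : expR 1 <= u -> log1 u = ln u.
Proof. by rewrite /log1 => /max_idPl ->. Qed.

Lemma iterlog2_le1 (u : R) : iterlog 2 u <= iterlog 1 u.
Proof.
rewrite /iterlog /= {1}/log1; set x := log1 u.
have x1 : 1 <= x by exact: log1_ge1.
rewrite /Num.max; case: ifP => _; first by rewrite expRK.
by rewrite ltW// ln_sublinear// (lt_le_trans _ x1).
Qed.

Lemma near_iterlog1E :
  \forall n \near \oo, iterlog 1 n%:R = ln n%:R :> R.
Proof. by apply: filterS (near_natr_ge (expR 1)) => n; exact: log1E. Qed.

Lemma near_iterlog2E :
  \forall n \near \oo, iterlog 2 n%:R = ln (ln n%:R) :> R.
Proof.
apply: filterS2 near_iterlog1E (near_ln_ge (expR 1)) => n E.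
rewrite /iterlog /=; have -> : log1 n%:R = ln n%:R :> R by [].
exact: log1E.
Qed.

Lemma near_iterlog2_ge (C : R) : \forall n \near \oo, C <= iterlog 2 n%:R.
Proof.
apply: filterS2 near_iterlog2E (near_ln_ge (expR C)) => n -> Cn.
by rewrite -[leLHS]expRK ler_ln// posrE ?expR_gt0// (lt_le_trans _ Cn)// expR_gt0.
Qed.

Lemma near_iterlog1_ge (C : R) : \forall n \near \oo, C <= iterlog 1 n%:R.
Proof.
apply: filterS (near_iterlog2_ge C) => n /le_trans; apply; exact: iterlog2_le1.
Qed.

Lemma near_sqr_iterlog1_le (C c : R) : 0 < c ->
  \forall n \near \oo, C * (iterlog 1 n%:R) ^+ 2 <= expR (c * iterlog 1 n%:R).
Proof.
move=> c0; have [x0 H] := sqr_le_expR C c0.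
by apply: filterS (near_iterlog1_ge x0) => n /H.
Qed.

End Growth.

(** * The law of the iterated logarithm for the uniform empirical process *)

Section Chaining.
Context {R : realType}.

(** [i %/ 16] indexes the nearest point to the left on the next coarser grid, so the chain from
    level m down to level L never leaves the region below b. The increments add up geometrically. *)
Lemma chaining_bound (S : R -> R) (b x0 A : R) (L m : nat) : (L <= m)%N ->
  (forall j, (j <= 16 ^ L)%N -> j%:R / 16 ^+ L <= b ->
     `|S (j%:R / 16 ^+ L)| <= x0) ->
  (forall l i, (L <= l < m)%N -> (i <= 16 ^ l.+1)%N ->
     `|S (i%:R / 16 ^+ l.+1) - S ((i %/ 16)%:R / 16 ^+ l)| <= A * 2 ^- l.+1) ->
  forall i, (i <= 16 ^ m)%N -> i%:R / 16 ^+ m <= b ->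
    `|S (i%:R / 16 ^+ m)| <= x0 + A * (2 ^- L - 2 ^- m).
Proof.
move=> Lm S0; rewrite -(subnKC Lm); elim: (m - L)%N => [|j IH] SA i im ib.
  by rewrite !addn0 in im ib *; rewrite subrr mulr0 addr0; exact: S0.
rewrite addnS in im ib SA *.
have im' : (i %/ 16 <= 16 ^ (L + j))%N.
  by rewrite (leq_trans (leq_div2r 16 im))// expnS mulKn.
have ib' : (i %/ 16)%:R / 16 ^+ (L + j) <= b.
  apply: le_trans ib; rewrite exprS invfM mulrA ler_pM2r ?invr_gt0 ?exprn_gt0//.
  by rewrite ler_pdivlMr// -natrM ler_nat leq_divM.
have H1 : `|S ((i %/ 16)%:R / 16 ^+ (L + j))| <= x0 + A * (2 ^- L - 2 ^- (L + j)).
  by apply: IH => // l i' /andP[Ll lj]; apply: SA; rewrite Ll ltnW.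
have H2 : `|S (i%:R / 16 ^+ (L + j).+1) - S ((i %/ 16)%:R / 16 ^+ (L + j))| <=
    A * 2 ^- (L + j).+1 by apply: SA => //; rewrite leq_addr ltnSn.
have -> : S (i%:R / 16 ^+ (L + j).+1) = S ((i %/ 16)%:R / 16 ^+ (L + j)) +
   (S (i%:R / 16 ^+ (L + j).+1) - S ((i %/ 16)%:R / 16 ^+ (L + j))) by ring.
apply: (le_trans (ler_normD _ _)); apply: (le_trans (lerD H1 H2)).
rewrite exprS invfM; set y := 2 ^- (L + j).
have -> : x0 + A * (2 ^- L - y) + A * (2^-1 * y) = x0 + A * (2 ^- L - 2^-1 * y) by field.
exact: lexx.
Qed.

(** By monotonicity F x lies between its values at the two neighboring grid points, where the linear
    term differs by at most n / N. The right neighbor may exceed b, which is why the grid bound is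
    assumed up to b'. *)
Lemma grid_sandwich (F : R -> R) (n B b b' : R) (N : nat) : (0 < N)%N ->
  0 <= n -> {homo F : x y / x <= y} -> b + N%:R^-1 <= b' ->
  (forall i, (i <= N)%N -> i%:R / N%:R <= b' ->
     `|F (i%:R / N%:R) - n * (i%:R / N%:R)| <= B) ->
  forall x, 0 <= x <= 1 -> x <= b -> `|F x - n * x| <= B + n / N%:R.
Proof.
move=> N0 n0 Fhomo bb' HB x /andP[x0 x1] xb.
have N0' : 0 < N%:R :> R by rewrite ltr0n.
have Ni : 0 < N%:R^-1 :> R by rewrite invr_gt0.
have [x1'|x1'] := ltP x 1; last first.
  have xE : x = N%:R / N%:R by rewrite divff ?gt_eqF//; apply/eqP; rewrite eq_le x1.
  rewrite xE (le_trans (HB N _ _))//; first by rewrite -xE (le_trans xb)// (le_trans _ bb')// lerDl ltW.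
  by rewrite lerDl divr_ge0.
pose i := Num.truncn (x * N%:R).
have /andP[ix xi] : i%:R <= x * N%:R < i.+1%:R by apply: truncn_itv; rewrite mulr_ge0// ltW.
have iN : (i < N)%N.
  by rewrite -(ltr_nat R) (le_lt_trans ix)// gtr_pMl.
have xlo : i%:R / N%:R <= x by rewrite ler_pdivrMr.
have xhi : x <= i.+1%:R / N%:R by rewrite ler_pdivlMr// ltW.
have step : i.+1%:R / N%:R = i%:R / N%:R + N%:R^-1 :> R by rewrite -natr1 mulrDl mul1r.
have := HB i (ltnW iN).
have := HB i.+1 iN.
rewrite step => H1 H2.
have {H1} := H1 (le_trans (lerD (le_trans xlo xb) (lexx _)) bb').
have {H2} := H2 (le_trans (le_trans xlo xb) (le_trans (ler_wpDr (ltW Ni) (lexx b)) bb')).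
have := Fhomo _ _ xlo; have := Fhomo _ _ xhi; rewrite step.
rewrite !ler_norml => F1 F2 /andP[A1 A2] /andP[A3 A4].
have : n * (i%:R / N%:R) <= n * x by rewrite ler_wpM2l.
have : n * x <= n * (i%:R / N%:R + N%:R^-1) by rewrite ler_wpM2l// -step.
move: A4 A3 A2 A1 F1 F2; rewrite !mulrDr => *.
by apply/andP; split; lra.
Qed.

End Chaining.

Section Smirnov.
Context {d : measure_display} {Omega : measurableType d} {R : realType}.
Context {P : probability Omega R} {Z : nat -> Omega -> R * R}.
Hypothesis Z_iid : iid_sample P Z.
Variable g : R * R -> R.
Hypothesis mg : measurable_fun setT g.
Hypothesis g_ge0 : forall i w, 0 <= g (Z i w).
Hypothesis g_law : forall x, 0 <= x <= 1 ->
  Pr P [set w | g (Z 0%N w) <= x] = x.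

(* The lower endpoint [a = -1] stands for "no lower endpoint", as [g] is nonnegative
   on the sample. *)
Definition interval_hit (a b m x : R) (N : nat) : set Omega :=
  [set w | exists2 n, (n <= N)%N &
    x <= `|\sum_(i < n) ((g (Z i w) <= b)%R%:R - (g (Z i w) <= a)%R%:R - m)|].

Let g_lawN1 : Pr P [set w | g (Z 0%N w) <= -1] = 0.
Proof.
rewrite (_ : [set _ | _] = set0) ?Pr_set0//; apply/seteqP; split => // w /=.
by move=> /(le_trans (g_ge0 _ _)); rewrite lerNr oppr0 ler10.
Qed.

Let measurable_hit a b m x N : measurable (interval_hit a b m x N).
Proof. exact: (measurable_interval_dev_hit Z_iid mg). Qed.

Section Block.
Variables (s2 c0 h : R) (k N : nat).
Hypothesis s2_gt0 : 0 < s2.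
Hypothesis c0_gt0 : 0 < c0.
(** Block k gathers the sample sizes n with k <= ln n / h < k + 1. Hence M = s^2 exceeds every n of
    the block, and rho^2 = ln k stands for log log n. *)
Let s : R := expR (h / 2 * k.+1%:R).
Let M : R := s ^+ 2.
Let rho : R := Num.sqrt (ln k%:R).
Hypothesis NM : N%:R <= M.
Hypothesis lnk1 : 1 <= ln k%:R :> R.

Let s0 : 0 < s. Proof. exact: expR_gt0. Qed.
Let M0 : 0 < M. Proof. exact: exprn_gt0. Qed.
Let rho2 : rho ^+ 2 = ln k%:R. Proof. by rewrite sqr_sqrtr// (le_trans ler01). Qed.
Let rho1 : 1 <= rho. Proof. by rewrite -sqrtr1 ler_wsqrtr. Qed.

(** Bernstein's inequality with q = M s2 has the leading exponent tau ln k. The last hypothesis says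
    that s is large enough for the correction factor to be at least p / tau. *)
Lemma coarse_tail (b tau p : R) : 0 <= b <= 1 -> b * (1 - b) <= s2 ->
  tau = c0 ^+ 2 / (2 * s2) -> 1 < p -> p < tau ->
  4 * c0 * tau * rho <= (tau - p) * s2 * s ->
  Pr P (interval_hit (-1) b b (c0 * (s * rho)) N) <= 2 * expR (- (p * ln k%:R)).
Proof.
move=> b01 bs2 tauE p1 ptau Hs.
have tau0 : 0 < tau by rewrite (lt_trans _ ptau)// (lt_trans ltr01).
have tauE' : c0 ^+ 2 = tau * (2 * s2).
  by rewrite tauE divfK// gt_eqF// mulr_gt0.
have hs : 4 * c0 * rho <= (1 - p / tau) * s2 * s.
  rewrite -(ler_pM2r tau0).
  have -> : (1 - p / tau) * s2 * s * tau = (tau - p) * s2 * s.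
    by field; rewrite gt_eqF.
  by apply: le_trans Hs; rewrite le_eqVlt; apply/orP; left; apply/eqP; ring.
have ptau1 : 0 < p / tau by rewrite divr_gt0// (lt_trans ltr01).
have q0 : 0 < M * s2 by rewrite mulr_gt0.
have xq : 4 * (c0 * (s * rho)) <= (1 - p / tau) * (M * s2).
  have := ler_wpM2l (ltW s0) hs.
  have -> : s * (4 * c0 * rho) = 4 * (c0 * (s * rho)) by ring.
  by have -> : s * ((1 - p / tau) * s2 * s) = (1 - p / tau) * (M * s2) by rewrite /M; ring.
have x0 : 0 <= c0 * (s * rho) by rewrite !mulr_ge0 ?sqrtr_ge0// ltW.
have N1b : -1 <= b by case/andP: b01 => /(le_trans _) -> //; rewrite lerN10.
have mE : b = Pr P [set w | g (Z 0%N w) <= b] - Pr P [set w | g (Z 0%N w) <= -1].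
  by rewrite g_law// g_lawN1 subr0.
apply: (le_trans (bernstein_interval Z_iid mg N1b mE (q := M * s2) _ _ _ _)) => //.
- by apply: ler_pM => //; case/andP: b01 => *; rewrite mulr_ge0// subr_ge0.
- have : (1 - p / tau) * (M * s2) <= M * s2.
    by rewrite -[leRHS]mul1r ler_wpM2r ?ltW// gtrBl.
  by lra.
rewrite ler_wpM2l// ler_expR lerN2.
have -> : (c0 * (s * rho)) ^+ 2 / (2 * (M * s2)) = tau * ln k%:R.
  rewrite !exprMn rho2 tauE' /M; field.
  by rewrite !gt_eqF.
rewrite (_ : p * _ = tau * ln k%:R * (p / tau)); last by field; rewrite gt_eqF.
rewrite ler_wpM2l ?mulr_ge0 ?(ltW tau0) ?(le_trans ler01)//.
rewrite lerBrDl -lerBrDr ler_pdivrMr//.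
Qed.

(* Base 16: the increments over cells of length 16^-l have standard deviation of order
   4^-l, which the summable thresholds 2^-l exceed by the factor 2^l that pays for the
   16^l cells. *)
Lemma fine_tail (l i : nat) : (i <= 16 ^ l.+1)%N -> 16 ^+ l <= s ->
  128 ^+ 4 * ln k%:R ^+ 2 <= s ->
  Pr P (interval_hit ((i %/ 16)%:R / 16 ^+ l) (i%:R / 16 ^+ l.+1)
     (i%:R / 16 ^+ l.+1 - (i %/ 16)%:R / 16 ^+ l) (32 * (s * rho) * 2 ^- l.+1) N) <=
  2 * (expR (- (2 * ln k%:R)) * 32 ^- l).
Proof.
move=> il ls Hs.
pose y : R := 2 ^+ l; have y1 : 1 <= y by rewrite exprn_ege1// ler1n.
have y0 : 0 < y by rewrite (lt_le_trans _ y1).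
have y4 : 16 ^+ l = y ^+ 4 :> R.
  by rewrite /y -exprM mulnC exprM; congr (_ ^+ _); rewrite -natrX.
have p16 : 0 < 16 ^+ l :> R by rewrite exprn_gt0.
set a := (i %/ 16)%:R / 16 ^+ l; set b := i%:R / 16 ^+ l.+1.
have ab : a <= b.
  rewrite /a /b exprS invfM mulrA ler_pM2r ?invr_gt0// ler_pdivlMr// -natrM ler_nat.
  exact: leq_divM.
have a0 : 0 <= a by rewrite divr_ge0// ltW.
have b1 : b <= 1.
  by rewrite ler_pdivrMr ?exprn_gt0// mul1r -natrX ler_nat.
have ba : b - a <= 16 ^- l.
  rewrite lerBlDl /b /a exprS invfM mulrA -{3}[16 ^- l]mul1r -mulrDl ler_pM2r ?invr_gt0//.
  rewrite ler_pdivrMr// natr1 -natrM ler_nat ltnW//.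
  by rewrite ltn_ceil.
have mE : b - a = Pr P [set w | g (Z 0%N w) <= b] - Pr P [set w | g (Z 0%N w) <= a].
  by rewrite !g_law// ?a0 ?b1 ?(le_trans a0) ?(le_trans ab).
pose q := M / 16 ^+ l.
have q0 : 0 < q by rewrite divr_gt0.
have r0 : 0 < rho by rewrite (lt_le_trans _ rho1).
set x := 32 * _ * _.
have xE : x = 16 * (s * rho) / y.
  by rewrite /x exprS -/y; field; rewrite gt_eqF.
have x0 : 0 <= x by rewrite xE !mulr_ge0 ?invr_ge0 ?ltW.
have key : 128 * y ^+ 3 * rho <= s.
  rewrite -(@ler_pXn2r _ 4)// ?nnegrE; last 2 first.
  - by rewrite !mulr_ge0 ?exprn_ge0 ?ltW.
  - exact: ltW.
  have -> : (128 * y ^+ 3 * rho) ^+ 4 = (128 ^+ 4 * ln k%:R ^+ 2) * (y ^+ 4) ^+ 3.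
    by rewrite -rho2; ring.
  rewrite (_ : s ^+ 4 = s * s ^+ 3); last by ring.
  apply: ler_pM => //; [by nneg | by nneg |].
  by apply: lerXn2r; rewrite ?nnegrE -?y4 ?(ltW p16) ?(ltW s0).
have xq : 8 * x <= q.
  rewrite xE /q y4 ler_pdivlMr ?exprn_gt0//.
  have -> : 8 * (16 * (s * rho) / y) * y ^+ 4 = s * (128 * y ^+ 3 * rho).
    by field; rewrite gt_eqF.
  by rewrite /M expr2 ler_pM2l.
apply: (le_trans (bernstein_interval Z_iid mg ab mE (q := q) _ _ _ _)) => //.
- rewrite /q; apply: ler_pM => //.
    by rewrite mulr_ge0 ?subr_ge0// lerBlDr (le_trans b1)// lerDl.
  apply: le_trans ba; rewrite -[leRHS]mulr1 ler_wpM2l ?subr_ge0// gerBl subr_ge0//.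
- lra.
rewrite ler_wpM2l//.
have E : 64 * y ^+ 2 * ln k%:R <= x ^+ 2 / (2 * q) * (1 - 4 * x / q).
  have -> : 64 * y ^+ 2 * ln k%:R = x ^+ 2 / (2 * q) * 2^-1.
    rewrite xE /q y4 /M -rho2; field.
    by rewrite !gt_eqF.
  apply: ler_wpM2l; first by nneg.
  have : 4 * x / q <= 2^-1 by rewrite ler_pdivrMr//; lra.
  lra.
(* The exponent is split into 2 ln k, summable over the blocks, and 5 l, where expR 5 >= 32 pays for
   the 16^{l+1} + 1 cells and still leaves 2^-l for the sum over levels. *)
apply: (@le_trans _ _ (expR (- (2 * ln k%:R + 5 * l%:R)))).
  rewrite ler_expR lerN2; apply: (le_trans _ E).
  have yl : l%:R <= y.
    by rewrite /y -natrX ler_nat ltnW// ltn_expl.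
  have y2 : y <= y ^+ 2 by rewrite expr2 ler_peMr// ltW.
  have y2l : y ^+ 2 <= y ^+ 2 * ln k%:R by rewrite ler_peMr// exprn_ge0// ltW.
  have lny : ln k%:R <= y ^+ 2 * ln k%:R.
    by rewrite ler_peMl ?(le_trans ler01)// (le_trans y1).
  have := lnk1; have : 0 <= l%:R :> R by []. 
  lra.
rewrite opprD expRD ler_wpM2l ?expR_ge0//.
rewrite mulrC -mulrN expRM_natl -exprVn.
apply: lerXn2r; rewrite ?nnegrE ?expR_ge0 ?invr_ge0//.
rewrite expRN lef_pV2 ?posrE ?expR_gt0//.
have -> : 5 = 5%:R * 1 :> R by rewrite mulr1.
rewrite expRM_natl; have -> : 32 = 2 ^+ 5 :> R by rewrite -natrX.
apply: lerXn2r; rewrite ?nnegrE ?expR_ge0//.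
by have := expR_ge1Dx (1 : R); rewrite -natr1.
Qed.

End Block.
End Smirnov.

Lemma measurable_exists_fin (d : measure_display) (Omega : measurableType d)
  (T : finType) (F : T -> set Omega) :
  (forall t, measurable (F t)) -> measurable [set w | exists t, F t w].
Proof.
move=> mF; rewrite (_ : [set w | _] = \bigcup_(t in [set: T]) F t).
  by apply: fin_bigcup_measurable => //; exact: finite_finset.
by apply/seteqP; split => w [t]; exists t.
Qed.

Lemma exists_expn_small (R : realType) (e : R) : 0 < e ->
  exists L : nat, 2 ^- L <= e.
Proof.
move=> e0; exists (Num.truncn e^-1).+1.
rewrite -[leRHS]invrK lef_pV2 ?posrE ?exprn_gt0 ?invr_gt0//.
rewrite (le_trans (ltW (truncnS_gt _)))// -natrX ler_nat ltnW//.
exact: ltn_expl.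
Qed.

(** This m is the finest chaining level: the levels below it satisfy the condition 16^l <= s of
    [fine_tail], and rounding at level m costs n / 16^m <= s^2 / 16^m <= s. *)
Lemma exists_expn_floor (R : realType) (s : R) :
  exists m : nat, s < 16 ^+ m /\ forall l, (l < m)%N -> 16 ^+ l <= s.
Proof.
have ex : exists m, s < 16 ^+ m.
  exists (Num.truncn s).+1; rewrite (lt_trans (truncnS_gt _))// -natrX ltr_nat.
  exact: ltn_expl.
exists (ex_minn ex); case: ex_minnP => m sm mmin; split => // l lm.
by rewrite leNgt; apply/negP => /mmin; rewrite leqNgt lm.
Qed.

Section Smirnov.
Context {d : measure_display} {Omega : measurableType d} {R : realType}.
Context {P : probability Omega R} {Z : nat -> Omega -> R * R}.
Hypothesis Z_iid : iid_sample P Z.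
Variable g : R * R -> R.
Hypothesis mg : measurable_fun setT g.
Hypothesis g_ge0 : forall i w, 0 <= g (Z i w).
Hypothesis g_law : forall x, 0 <= x <= 1 ->
  Pr P [set w | g (Z 0%N w) <= x] = x.

(** Upper half of the Chung-Smirnov law, localized to x <= b. The finitely many points of one fixed
    grid carry the sharp variance constant; the passage from them to all x is a chaining sum of
    relative size 32 * 2^-L, made negligible by the choice of L. The maximal inequality treats all n
    of a geometric block at once. *)
Lemma smirnov (b b' s2 D : R) : b < b' -> 0 < s2 -> 0 < D -> 2 * s2 < D ^+ 2 ->
  (forall x, 0 <= x <= 1 -> x <= b' -> x * (1 - x) <= s2) ->
  {ae P, forall w, \forall n \near \oo, forall x, 0 <= x <= 1 -> x <= b ->
    `|\sum_(i < n) (g (Z i w) <= x)%R%:R - n%:R * x| <=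
    D * Num.sqrt (n%:R * iterlog 2 n%:R)}.
Proof.
move=> bb' s20 D0 s2D Hs2.
pose t := Num.sqrt (2 * s2).
have t2 : t ^+ 2 = 2 * s2 by rewrite sqr_sqrtr// mulr_ge0// ltW.
have t0 : 0 < t by rewrite sqrtr_gt0 mulr_gt0.
have tD : t < D by rewrite -(@ltr_pXn2r _ 2) ?nnegrE ?(ltW t0) ?(ltW D0)// t2.
(* Coarse deviations below c0, plus twice e for the chaining and rounding errors, make c1. *)
pose c0 := (t + D) / 2; pose e := (D - c0) / 4; pose c1 := (D + c0) / 2.
have tc0 : t < c0 by rewrite /c0; lra.
have c0D : c0 < D by rewrite /c0; lra.
have c00 : 0 < c0 by rewrite (lt_trans t0).
have e0 : 0 < e by rewrite /e; lra.
have c1E : c1 = c0 + 2 * e by rewrite /c1 /e; field.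
have c10 : 0 < c1 by rewrite /c1; lra.
have c1D : c1 < D by rewrite /c1; lra.
(* Blocks have ratio expR h = D / c1. The squared slack (D / c1)^2 is spent half on M against n and
   half on [ln k] against log log n. *)
pose h := ln (D / c1).
have h0 : 0 < h by rewrite ln_gt0// ltr_pdivlMr// mul1r.
have eh : expR h = D / c1 by rewrite lnK// posrE divr_gt0.
pose tau := c0 ^+ 2 / (2 * s2).
have tau1 : 1 < tau.
  by rewrite ltr_pdivlMr ?mulr_gt0// mul1r -t2 ltr_pXn2r ?nnegrE ?(ltW t0) ?(ltW c00).
(* Above 1 for summability over the blocks, below tau for [coarse_tail], and at most 2 because
   [fine_tail] provides the exponent 2. *)
pose p := Num.min ((1 + tau) / 2) 2.
have p1 : 1 < p by rewrite lt_min; apply/andP; split; lra.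
have ptau : p < tau by rewrite gt_min; apply/orP; left; lra.
have p2 : p <= 2 by rewrite ge_min lexx orbT.
have [L HL] : exists L, 2 ^- L <= Num.min (e / 32) (b' - b).
  by apply: exists_expn_small; rewrite lt_min divr_gt0//= subr_gt0.
move: HL; rewrite le_min => /andP[Le Lb].
pose s k : R := expR (h / 2 * k.+1%:R).
have s0 k : 0 < s k by exact: expR_gt0.
pose N k := Num.truncn (s k ^+ 2).
have NM k : (N k)%:R <= s k ^+ 2.
  by rewrite /N truncn_le exprn_ge0// ltW.
pose rho k : R := Num.sqrt (ln k%:R).
have [m Hm] := choice (fun k => exists_expn_floor (s k)).
pose coarse k (j : 'I_(16 ^ L).+1) : set Omega :=
  if j%:R / 16 ^+ L <= b' then
    interval_hit g (Z := Z) (-1) (j%:R / 16 ^+ L) (j%:R / 16 ^+ L)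
      (c0 * (s k * rho k)) (N k)
  else set0.
pose fine k (l : 'I_(m k)) (i : 'I_(16 ^ l.+1).+1) : set Omega :=
  interval_hit g (Z := Z) ((i %/ 16)%:R / 16 ^+ l) (i%:R / 16 ^+ l.+1)
     (i%:R / 16 ^+ l.+1 - (i %/ 16)%:R / 16 ^+ l)
     (32 * (s k * rho k) * 2 ^- l.+1) (N k).
have mhit a1 b1 m1 x N1 : measurable (interval_hit (Z := Z) g a1 b1 m1 x N1).
  exact: (measurable_interval_dev_hit Z_iid mg).
have mcoarse k j : measurable (coarse k j) by rewrite /coarse; case: ifP.
pose E0 k := [set w | exists j, coarse k j w].
pose E1 k l := [set w | exists i, fine k l i w].
have mE0 k : measurable (E0 k) by apply: measurable_exists_fin.
have mE1 k l : measurable (E1 k l) by apply: measurable_exists_fin => i; exact: mhit.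
pose F k := [set w | exists l, E1 k l w].
have mF k : measurable (F k) by apply: measurable_exists_fin.
pose A k := [set w | E0 k w \/ F k w].
have mA k : measurable (A k) by exact: measurableU.
pose C : R := 2 * ((16 ^ L).+1)%:R + 128.
have near_s : forall K, \forall k \near \oo, K * (ln k%:R) ^+ 2 <= s k.
  move=> K; have h2 : 0 < h / 2 by rewrite divr_gt0.
  apply: filterS (near_sqr_ln_le K h2) => k /le_trans; apply.
  by rewrite ler_expR ler_pM2l// ler_nat.
have facts : \forall k \near \oo, [/\ 1 <= ln k%:R :> R,
    128 ^+ 4 * ln k%:R ^+ 2 <= s k,
    4 * c0 * tau * rho k <= (tau - p) * s2 * s k,
    1 <= e * rho k & 16 ^+ L <= s k].
  pose K1 := 4 * c0 * tau / ((tau - p) * s2).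
  have q0 : 0 < (tau - p) * s2 by rewrite mulr_gt0// subr_gt0.
  have K10 : 0 <= K1.
    have tau0 : 0 < tau by rewrite (lt_trans ltr01).
    by apply: divr_ge0; [nneg | exact: ltW].
  apply: filterS2 (filterI (near_ln_ge 1) (near_ln_ge (e^-1 ^+ 2)))
    (filterI (near_s (128 ^+ 4)) (filterI (near_s K1) (near_s (16 ^+ L)))).
  move=> k [k1 k2] [k3 [k4 k5]].
  have {}k1 : 1 <= ln k%:R :> R := k1.
  have l0 : 0 <= ln k%:R :> R := le_trans ler01 k1.
  have l2 : 1 <= ln k%:R ^+ 2 :> R by rewrite exprn_ege1.
  have rl : rho k <= ln k%:R ^+ 2.
    rewrite -(@ler_pXn2r _ 2) ?nnegrE ?sqrtr_ge0 ?exprn_ge0// sqr_sqrtr//.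
    exact: (le_trans (ler_eXnr (isT : (0 < 2)%N) k1) (ler_eXnr (isT : (0 < 2)%N) l2)).
  split => //.
  - have : K1 * rho k <= s k by rewrite (le_trans _ k4)// ler_wpM2l.
    by rewrite /K1 mulrAC ler_pdivrMr// [s k * _]mulrC.
  - rewrite mulrC -ler_pdivrMr// mul1r -[leLHS]ger0_norm ?invr_ge0 ?(ltW e0)//.
    by rewrite -sqrtr_sqr ler_wsqrtr.
  - by rewrite (le_trans _ k5)// -[leLHS]mulr1 ler_pM2l// exprn_gt0.
have PA : \forall k \near \oo, Pr P (A k) <= C * expR (- (p * ln k%:R)).
  apply: filterS facts => k [k1 k2 k3 k4 k5].
  have PE0 : Pr P (E0 k) <= 2 * ((16 ^ L).+1)%:R * expR (- (p * ln k%:R)).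
    apply: (@le_trans _ _ (\sum_(j < (16 ^ L).+1) Pr P (coarse k j))).
      by apply: Pr_fin_subadditive.
    apply: (@le_trans _ _ (\sum_(j < (16 ^ L).+1) 2 * expR (- (p * ln k%:R)))).
      apply: ler_sum => j _; rewrite /coarse; case: ifPn => jb'.
        have jb01 : 0 <= (j%:R : R) / 16 ^+ L <= 1.
          rewrite divr_ge0//= ler_pdivrMr ?exprn_gt0// mul1r -natrX ler_nat.
          by rewrite -ltnS.
        exact: (coarse_tail Z_iid mg g_ge0 g_law s20 c00 (NM k) k1 jb01 (Hs2 _ jb01 jb') erefl p1 ptau k3).
      by rewrite Pr_set0 mulr_ge0 ?expR_ge0.
    by rewrite sumr_const card_ord -[leLHS]mulr_natl; rewrite le_eqVlt; apply/orP; left; apply/eqP; ring.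
  have PE1 l : Pr P (E1 k l) <= 64 * expR (- (p * ln k%:R)) * 2 ^- l.
    apply: (@le_trans _ _ (\sum_(i < (16 ^ l.+1).+1) Pr P (fine k l i))).
      by apply: Pr_fin_subadditive => // i; exact: mhit.
    apply: (@le_trans _ _ (\sum_(i < (16 ^ l.+1).+1)
        2 * (expR (- (p * ln k%:R)) * 32 ^- l))).
      apply: ler_sum => i _.
      apply: (le_trans (fine_tail Z_iid mg g_law (NM k) k1 _ _ k2)).
      - by rewrite -ltnS.
      - by apply: (Hm k).2.
      rewrite ler_wpM2l// ler_pM2r ?invr_gt0 ?exprn_gt0// ler_expR lerN2.
      by rewrite ler_pM2r// (lt_le_trans ltr01).
    rewrite sumr_const card_ord -[leLHS]mulr_natl.
    have -> : 32 ^- l = 16 ^- l * 2 ^- l :> R.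
      by rewrite -invfM -exprMn -natrM.
    have H16 : ((16 ^ l.+1).+1)%:R * 16 ^- l <= 32 :> R.
      rewrite ler_pdivrMr ?exprn_gt0// -natr1 natrX exprS.
      have : 1 <= 16 ^+ l :> R by rewrite exprn_ege1// ler1n.
      by lra.
    have : 0 <= 2 * expR (- (p * ln k%:R)) * 2 ^- l by nneg.
    move=> /ler_wpM2r /(_ _ _ H16); move: (16 ^- l) (2 ^- l) => x y.
    by congr (_ <= _); ring.
  have PF : Pr P (F k) <= 128 * expR (- (p * ln k%:R)).
    apply: (@le_trans _ _ (\sum_(l < m k) Pr P (E1 k l))).
      by apply: Pr_fin_subadditive.
    apply: (@le_trans _ _ (\sum_(l < m k) 64 * expR (- (p * ln k%:R)) * 2 ^- l)).
      by apply: ler_sum => l _; exact: PE1.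
    rewrite -mulr_sumr.
    have geo n : \sum_(l < n) 2 ^- l = 2 - 2 * 2 ^- n :> R.
      elim: n => [|n IH]; first by rewrite big_ord0 expr0 invr1 mulr1 subrr.
      by rewrite big_ord_recr /= IH exprS invfM; field; rewrite expf_neq0.
    rewrite geo (_ : 128 * _ = 64 * expR (- (p * ln k%:R)) * 2); last by ring.
    apply: ler_wpM2l; first by nneg.
    by rewrite gerBl; nneg.
  apply: (@le_trans _ _ (\sum_(x : bool) Pr P (if x then E0 k else F k))).
    apply: Pr_fin_subadditive => [//|[]//|w [?|?]]; first by exists true.
    by exists false.
  by rewrite big_bool /= (le_trans (lerD PE0 PF))// -mulrDl lexx.
have C0 : 0 <= C by rewrite /C; nneg.
have uC n : \sum_(k < n) C * expR (- (p * ln k%:R)) <= C * (2 + (p - 1)^-1).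
  by rewrite -mulr_sumr ler_wpM2l// pseries_bounded.
have := borel_cantelli_ae mA (fun k => mulr_ge0 C0 (expR_ge0 _)) uC PA.
apply: filterS => w HA.
have [k0 _ Hk0] := filterI facts HA.
have Dc : 0 < D - c1 by rewrite subr_gt0.
near=> n.
have n1 : 1 <= n%:R :> R by near: n; exact: near_natr_ge.
have n0 : 0 < n%:R :> R by rewrite (lt_le_trans ltr01).
have lnn0 : 0 <= ln n%:R :> R by rewrite ln_ge0.
pose k := Num.truncn (ln n%:R / h).
have /andP[kn nk] : k%:R <= ln n%:R / h < k.+1%:R.
  by apply: truncn_itv; rewrite divr_ge0// ltW.
have nM : n%:R < s k ^+ 2.
  rewrite -(lnK (n0 : n%:R \is Num.pos)) -expRM_natl ltr_expR.
  by move: nk; rewrite ltr_pdivrMr// => /lt_le_trans; apply; rewrite le_eqVlt; apply/orP; left; apply/eqP; field.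
have Mn : s k ^+ 2 <= D / c1 * n%:R.
  rewrite -(lnK (n0 : n%:R \is Num.pos)) -eh -expRD -expRM_natl ler_expR.
  move: kn; rewrite ler_pdivlMr// => kn; rewrite -(natr1 k); lra.
have k0k : (k0 <= k)%N.
  rewrite /k truncn_ge_nat ?divr_ge0 ?(ltW h0)// ler_pdivlMr//.
  by near: n; exact: near_ln_ge.
have [[k1 k2 k3 k4 k5] nA] := Hk0 k k0k.
have nN : (n <= N k)%N.
  by rewrite /N truncn_ge_nat ?exprn_ge0 ?(ltW (s0 k))// ltW.
have Lm : (L <= m k)%N.
  rewrite ltnW// -(@ltn_exp2l 16)// -(ltr_nat R) !natrX (le_lt_trans k5)//.
  exact: (Hm k).1.
pose S x : R := \sum_(i < n) (g (Z i w) <= x)%R%:R - n%:R * x.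
have SD a1 b1 : S b1 - S a1 =
    \sum_(i < n) ((g (Z i w) <= b1)%R%:R - (g (Z i w) <= a1)%R%:R - (b1 - a1)).
  rewrite !sumrB !sumr_const card_ord /S -(mulr_natl b1) -(mulr_natl a1); ring.
have r0 : 0 <= s k * rho k by rewrite mulr_ge0 ?sqrtr_ge0// ltW.
have grid i : (i <= 16 ^ m k)%N -> i%:R / 16 ^+ m k <= b' ->
    `|S (i%:R / 16 ^+ m k)| <= c0 * (s k * rho k) +
       32 * (s k * rho k) * (2 ^- L - 2 ^- m k).
  apply: (chaining_bound Lm) => [j jL jb|l j /andP[Ll lm] jl].
    rewrite leNgt; apply/negP => H; apply: nA; left.
    exists (Ordinal (jL : j < (16 ^ L).+1)%N); rewrite /coarse /= jb.
    exists n => //; rewrite (le_trans (ltW H))//.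
    rewrite le_eqVlt; apply/orP; left; apply/eqP; congr (`|_|).
    rewrite /S !sumrB sumr_const card_ord -(mulr_natl (j%:R / 16 ^+ L)).
    rewrite [X in _ - X - _]big1 ?subr0// => i1 _.
    by rewrite leNgt (lt_le_trans _ (g_ge0 i1 w))// ltrN10.
  rewrite leNgt; apply/negP => H; apply: nA; right.
  exists (Ordinal lm), (Ordinal (jl : j < (16 ^ l.+1).+1)%N); rewrite /fine /=.
  by exists n => //; rewrite -SD ltW.
have m16 : 0 < 16 ^+ m k :> R by rewrite exprn_gt0.
move=> x x01 xb.
have := @grid_sandwich R (fun x => \sum_(i < n) (g (Z i w) <= x)%R%:R) n%:R
  (c0 * (s k * rho k) + 32 * (s k * rho k) * (2 ^- L - 2 ^- m k)) b b' (16 ^ m k).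
rewrite natrX => /(_ _ _ _ _ grid x x01 xb); rewrite expn_gt0/= => H.
apply: (le_trans (H _ _ _ _)) => //.
- move=> y z yz; apply: ler_sum => i _; rewrite ler_nat.
  by case: (leP (g (Z i w)) y) => // /le_trans ->.
- rewrite -lerBrDl (le_trans _ Lb)//.
  rewrite lef_pV2 ?posrE ?exprn_gt0//.
  apply: (@le_trans _ _ (2 ^+ m k)); first by rewrite ler_weXn2l// ler1n.
  by apply: lerXn2r; rewrite ?nnegrE// ler_nat.
apply: (@le_trans _ _ (c1 * (s k * rho k))).
  have H1 : 32 * (s k * rho k) * (2 ^- L - 2 ^- m k) <= e * (s k * rho k).
    rewrite mulrAC ler_wpM2r//.
    apply: (@le_trans _ _ (32 * 2 ^- L)); last by rewrite mulrC -ler_pdivlMr.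
    by rewrite ler_wpM2l// gerBl; nneg.
  have H2 : n%:R / 16 ^+ m k <= e * (s k * rho k).
    apply: (@le_trans _ _ (s k)); last first.
      by rewrite mulrCA ler_pMr.
    rewrite ler_pdivrMr// (le_trans (ltW nM))// expr2 ler_pM2l// ltW//.
    exact: (Hm k).1.
  have -> : c1 * (s k * rho k) =
      c0 * (s k * rho k) + e * (s k * rho k) + e * (s k * rho k).
    by rewrite c1E; ring.
  exact: lerD (lerD (lexx _) H1) H2.
have LLE : iterlog 2 n%:R = ln (ln n%:R) :> R by near: n; exact: near_iterlog2E.
have LL0 : 0 <= iterlog 2 n%:R :> R by rewrite (le_trans ler01)// log1_ge1.
rewrite -(@ler_pXn2r _ 2)// ?nnegrE; last 2 first.
- by rewrite mulr_ge0// ltW.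
- by rewrite mulr_ge0 ?sqrtr_ge0// ltW.
have lnk0 : 0 <= ln k%:R :> R := le_trans ler01 k1.
rewrite (exprMn 2 c1) (exprMn 2 (s k)) (exprMn 2 D) (sqr_sqrtr lnk0) (sqr_sqrtr (mulr_ge0 (ltW n0) LL0)).
have lnn_pos : 0 < ln n%:R :> R.
  by apply: (lt_le_trans ltr01); near: n; exact: near_ln_ge.
have k_pos : 0 < k%:R :> R.
  by rewrite ltr0n lt0n; apply/eqP => E; move: k1; rewrite E ln0// ler10.
(* As k <= ln n / h, the two logarithms differ by [ln h], possibly negative; [LLbig] absorbs this
   constant in the slack D - c1. *)
have lnk : ln k%:R <= iterlog 2 n%:R - ln h :> R.
  by rewrite LLE -ln_div ?posrE// ler_ln ?posrE// divr_gt0.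
have LLbig : c1 * `|ln h| / (D - c1) <= iterlog 2 n%:R.
  by near: n; exact: near_iterlog2_ge.
move: LLbig; rewrite ler_pdivrMr// => LLbig.
have H3 : c1 * (iterlog 2 n%:R - ln h) <= D * iterlog 2 n%:R.
  rewrite mulrBr -lerBrDl -mulrN (mulrC D) (mulrC c1 (iterlog 2 _)) -mulrBr.
  by apply: le_trans LLbig; rewrite ler_pM2l// -normrN ler_norm.
apply: (@le_trans _ _ (c1 ^+ 2 * (D / c1 * n%:R * ln k%:R))).
  by rewrite ler_wpM2l ?exprn_ge0 ?(ltW c10)// ler_wpM2r// (le_trans ler01).
have -> : c1 ^+ 2 * (D / c1 * n%:R * ln k%:R) = D * n%:R * (c1 * ln k%:R).
  by field; rewrite gt_eqF.
have -> : D ^+ 2 * (n%:R * iterlog 2 n%:R) = D * n%:R * (D * iterlog 2 n%:R) by ring.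
rewrite ler_wpM2l ?mulr_ge0 ?(ltW D0) ?(ltW n0)//.
by apply: le_trans H3; rewrite ler_pM2l.
Unshelve. all: by end_near.
Qed.

End Smirnov.

(** * Reduction of the error to oscillations at grid points *)

Section CountingFunction.
Context {R : realType}.
Variables (c : R -> R) (N : nat) (rho : R).
Hypothesis c_homo : {homo c : x y / x <= y}.
Hypothesis c_ge0 : forall x, 0 <= c x.
Hypothesis N2 : (1 < N)%N.
Hypothesis cell0 : c 0 <= rho.
Hypothesis cell : forall j, (j < N)%N -> c (j.+1%:R / N%:R) - c (j%:R / N%:R) <= rho.

Let N0 : 0 < N%:R :> R. Proof. by rewrite ltr0n ltnW. Qed.

Lemma grid_floor (x : R) : 0 <= x < 1 ->
  exists2 j, (j < N)%N & j%:R / N%:R <= x < j.+1%:R / N%:R.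
Proof.
move=> /andP[x0 x1]; exists (Num.truncn (x * N%:R)).
  by rewrite truncn_lt_nat ?mulr_ge0// ?(ltW N0)// gtr_pMl.
rewrite ler_pdivrMr// ltr_pdivlMr//; apply: truncn_itv.
by rewrite mulr_ge0// ltW.
Qed.

Lemma grid_ceil (x : R) : 0 < x <= 1 ->
  exists2 j, (j < N)%N & j%:R / N%:R < x <= j.+1%:R / N%:R.
Proof.
move=> /andP[x0 x1].
have [|j jN /andP[j1 j2]] := @grid_floor (1 - x).
  by rewrite subr_ge0 x1 gtrBl.
exists (N - j.+1)%N; first by rewrite ltn_subrL/= ltnW.
rewrite -subSn// subSS !natrB// ?(ltnW jN)// !mulrBl divff ?gt_eqF//.
by apply/andP; split; lra.
Qed.

(** Rounding avoids 0 and 1, because the expansion of the copula holds in the open square. The left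
    end of the cell of x is taken, except in the first cell, where the right end 1 / N serves. *)
Lemma interior_round (x : R) : 0 <= x <= 1 ->
  exists2 j, (0 < j < N)%N &
    `|x - j%:R / N%:R| <= N%:R^-1 /\ `|c x - c (j%:R / N%:R)| <= rho.
Proof.
have step j : j.+1%:R / N%:R = j%:R / N%:R + N%:R^-1 :> R.
  by rewrite -natr1 mulrDl mul1r.
have close j (y : R) : (j < N)%N -> j%:R / N%:R <= y <= j.+1%:R / N%:R ->
    [/\ `|y - j%:R / N%:R| <= N%:R^-1, `|c y - c (j%:R / N%:R)| <= rho,
        `|y - j.+1%:R / N%:R| <= N%:R^-1 & `|c y - c (j.+1%:R / N%:R)| <= rho].
  move=> jN /andP[jy yj]; have := cell jN.
  have := c_homo jy; have := c_homo yj; move: jy yj; rewrite step => *.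
  by split; rewrite ler_norml; apply/andP; split; lra.
move=> /andP[x0]; rewrite le_eqVlt => /predU1P[->|x1].
  exists N.-1; first by rewrite -ltnS prednK ?(ltnW N2)// N2 leqnn.
  have H : (N.-1 < N)%N by rewrite prednK// ltnW.
  have [] := close N.-1 1 H.
    by rewrite prednK ?(ltnW N2)// divff ?gt_eqF// lexx andbT ler_pdivrMr// mul1r ler_nat leq_pred.
  by move=> *; split.
have [|[|j] jN /andP[jx xj]] := @grid_floor x; first by rewrite x0.
  exists 1%N; first by rewrite N2.
  by have [|_ _ ? ?] := close 0%N x jN; [rewrite jx ltW|split].
exists j.+1; first by rewrite jN.
by have [|? ? _ _] := close j.+1 x jN; [rewrite jx ltW|split].
Qed.

Variable n : nat.
Hypothesis n_gt0 : (0 < n)%N.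
Hypothesis c1 : c 1 = n%:R.
Let F (x : R) : R := n%:R^-1 * c x.
Let n0 : 0 < n%:R :> R. Proof. by rewrite ltr0n. Qed.

Let leF (u x : R) : (u <= F x) = (n%:R * u <= c x).
Proof. by rewrite /F mulrC ler_pdivlMr// mulrC. Qed.

Variable u : R.
Hypothesis u01 : 0 <= u <= 1.
Let A : set R := [set s | 0 <= s /\ u <= F s].
Let q : R := emp_quantile F u.

Let A1 : A 1.
Proof. by split=> //; rewrite leF c1 ler_piMr//; case/andP: u01. Qed.

Let A_lb : has_lbound A.
Proof. by exists 0 => s []. Qed.

Lemma emp_quantile_le (x : R) : 0 <= x -> n%:R * u <= c x -> q <= x.
Proof. by move=> x0 ux; apply: ge_inf => //; split; rewrite ?leF. Qed.

Lemma emp_quantile01 : 0 <= q <= 1.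
Proof.
apply/andP; split; last first.
  by apply: emp_quantile_le => //; have [_] := A1; rewrite leF.
by apply: lb_le_inf; [exists 1|move=> s []].
Qed.

(** The level is crossed at q within one grid cell, whose increment is at most rho; [cell0] covers q
    = 0. This replaces an argument that ties in the sample have probability zero. *)
Lemma count_emp_quantile : `|c q - n%:R * u| <= rho.
Proof.
have /andP[q0 q1] := emp_quantile01; have /andP[u0 u1] := u01.
rewrite ler_norml; apply/andP; split.
  rewrite lerNl opprB lerBlDl.
  move: q1; rewrite le_eqVlt => /predU1P[qE|q1].
    rewrite qE c1 ler_wpDr ?(le_trans _ cell0)//.
    by rewrite ler_piMr.
  have [|j jN /andP[jq qj]] := @grid_floor q; first by rewrite q0.
  have [a [a0 ua] aj] := inf_lt (ex_intro A 1 A1) qj.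
  move: ua; rewrite leF => /le_trans; apply.
  apply: (le_trans (c_homo (ltW aj))).
  have := cell jN; have := c_homo jq; lra.
move: q0; rewrite le_eqVlt => /predU1P[qE|q0].
  rewrite -qE lerBlDl (le_trans cell0)// lerDr mulr_ge0//.
have [|j jN /andP[jq qj]] := @grid_ceil q; first by rewrite q0.
have : c (j%:R / N%:R) < n%:R * u.
  rewrite ltNge; apply/negP => /emp_quantile_le.
  by rewrite divr_ge0// => /(_ isT); rewrite leNgt jq.
have := cell jN; have := c_homo qj; lra.
Qed.

End CountingFunction.

Section ErrorBound.
Context {R : realType}.
Variables (U V : nat -> R) (C : R * R -> R) (n N : nat).
Variables (r b rho E L zeta dl : R).

Definition count (X : nat -> R) (n : nat) (x : R) : R :=
  \sum_(i < n) (X i <= x)%R%:R.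

Let count2 (x y : R) : R := \sum_(i < n) ((U i <= x) && (V i <= y))%R%:R.

Hypothesis n_gt0 : (0 < n)%N.
Hypothesis N2 : (1 < N)%N.
Hypothesis U01 : forall i, 0 <= U i <= 1.
Hypothesis V01 : forall i, 0 <= V i <= 1.
Hypothesis cellU0 : count U n 0 <= rho.
Hypothesis cellV0 : count V n 0 <= rho.
Hypothesis cellU : forall j, (j < N)%N ->
  count U n (j.+1%:R / N%:R) - count U n (j%:R / N%:R) <= rho.
Hypothesis cellV : forall j, (j < N)%N ->
  count V n (j.+1%:R / N%:R) - count V n (j%:R / N%:R) <= rho.
Hypothesis L0 : 0 <= L.
Hypothesis extu : forall p q, unit_square p -> open_square q ->
  `|boundary_ext (partial_u C) p - partial_u C q| <= L * l1dist p q.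
Hypothesis extv : forall p q, unit_square p -> open_square q ->
  `|boundary_ext (partial_v C) p - partial_v C q| <= L * l1dist p q.
Hypothesis Cu1 : forall q, open_square q -> `|partial_u C q| <= 1.
Hypothesis Cv1 : forall q, open_square q -> `|partial_v C q| <= 1.
Hypothesis r01 : 0 <= r <= 1.
Hypothesis b_ge0 : 0 <= b.
Hypothesis devU : forall x, 0 <= x <= 1 -> x <= b -> `|count U n x - n%:R * x| <= E.
Hypothesis devV : forall x, 0 <= x <= 1 -> x <= b -> `|count V n x - n%:R * x| <= E.
Hypothesis slack : b < 1 -> n%:R * r + E <= n%:R * b.
Hypothesis dlE : (E + rho) / n%:R + 2 / N%:R <= dl.
Hypothesis grid_osc : forall i j k l,
  (0 < i < N)%N -> (0 < j < N)%N -> (0 < k < N)%N -> (0 < l < N)%N ->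
  `|i%:R / N%:R - k%:R / N%:R| <= dl -> `|j%:R / N%:R - l%:R / N%:R| <= dl ->
  `|\sum_(a < n) osc (i%:R / N%:R) (j%:R / N%:R) (k%:R / N%:R) (l%:R / N%:R)
     (partial_u C (k%:R / N%:R, l%:R / N%:R))
     (partial_v C (k%:R / N%:R, l%:R / N%:R)) (U a, V a)| <= zeta.

Let n0 : 0 < n%:R :> R. Proof. by rewrite ltr0n. Qed.
Let N0 : 0 < N%:R :> R. Proof. by rewrite ltr0n ltnW. Qed.

Let count_homo X : {homo count X n : x y / x <= y}.
Proof.
move=> x y xy; apply: ler_sum => i _; rewrite ler_nat.
by case: (leP (X i) x) => // /le_trans ->.
Qed.

Let count_ge0 X x : 0 <= count X n x.
Proof. by apply: sumr_ge0 => i _. Qed.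

Let count_1 X : (forall i, 0 <= X i <= 1) -> count X n 1 = n%:R.
Proof.
move=> X01; rewrite /count; under eq_bigr => i _.
  by have /andP[_ ->] := X01 i; over.
by rewrite sumr_const card_ord.
Qed.

Let count_diff X x y : `|count X n x - count X n y| <= n%:R.
Proof.
rewrite /count -sumrB (le_trans (ler_norm_sum _ _ _))//.
apply: (@le_trans _ _ (\sum_(i < n) 1)); last by rewrite sumr_const card_ord.
apply: ler_sum => i _; case: (X i <= x); case: (X i <= y) => /=;
by rewrite ?subrr ?subr0 ?sub0r ?normrN ?normr0 ?normr1.
Qed.

Let count2_diff s t s' t' : `|count2 s t - count2 s' t'| <=
  `|count U n s - count U n s'| + `|count V n t - count V n t'|.
Proof.
have aux X x y : `|count X n x - count X n y| =
    \sum_(i < n) `|(X i <= x)%R%:R - (X i <= y)%R%:R : R|.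
  wlog xy : x y / y <= x => [W|].
    have [/W //|/ltW /W E1] := leP y x.
    by rewrite distrC E1; apply: eq_bigr => i _; rewrite distrC.
  rewrite ger0_norm ?subr_ge0 ?count_homo// /count -sumrB.
  apply: eq_bigr => i _; rewrite ger0_norm// subr_ge0 ler_nat.
  by case: (leP (X i) y) => // /le_trans ->.
rewrite !aux -big_split /count2 -sumrB (le_trans (ler_norm_sum _ _ _))//.
apply: ler_sum => i _ /=.
case: (U i <= s); case: (U i <= s'); case: (V i <= t); case: (V i <= t') => /=;
by rewrite ?subrr ?subr0 ?sub0r ?normrN ?normr0 ?normr1 ?addr0 ?add0r ?lerDl.
Qed.

Let emp_fstE : emp_fst U V n = (fun x => n%:R^-1 * count U n x).
Proof.
apply/funext => x; rewrite /emp_fst /emp_joint /count /=; congr (_ * _).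
by apply: eq_bigr => i _; have /andP[_ ->] := V01 i; rewrite andbT.
Qed.

Let emp_sndE : emp_snd U V n = (fun x => n%:R^-1 * count V n x).
Proof.
apply/funext => x; rewrite /emp_snd /emp_joint /count /=; congr (_ * _).
by apply: eq_bigr => i _; have /andP[_ ->] := U01 i.
Qed.

Let two (x : R) : 2 * x = x + x. Proof. by rewrite mulr_natl mulr2n. Qed.

Let E0 : 0 <= E.
Proof. by apply: (le_trans _ (devU _ b_ge0)); rewrite ?lexx ?ler01. Qed.

(** By [slack] the count at b already reaches the level n r, so the quantile s stays at most b, and
    for b >= 1 this is s <= 1. The deviation bound at s then converts the level error rho into the
    distance (E + rho) / n. *)
Let quantile_close X (x : R) :
  (forall i, 0 <= X i <= 1) -> count X n 0 <= rho ->
  (forall j, (j < N)%N ->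
    count X n (j.+1%:R / N%:R) - count X n (j%:R / N%:R) <= rho) ->
  (forall x, 0 <= x <= 1 -> x <= b -> `|count X n x - n%:R * x| <= E) ->
  0 <= x <= 1 -> let s := emp_quantile (fun y => n%:R^-1 * count X n y) (x * r) in
  [/\ 0 <= s <= 1, `|count X n s - n%:R * (x * r)| <= rho &
    `|s - x * r| <= (E + rho) / n%:R].
Proof.
move=> X01 cell0 cell dev /andP[x0 x1] s.
have /andP[r0 r1] := r01.
have xr01 : 0 <= x * r <= 1 by rewrite mulr_ge0//= mulr_ile1.
have s01 : 0 <= s <= 1.
  exact: (emp_quantile01 n_gt0 (count_1 X01) xr01).
have cs : `|count X n s - n%:R * (x * r)| <= rho.
  exact: (count_emp_quantile (@count_homo X) (@count_ge0 X) N2 cell0 cell n_gt0 (count_1 X01) xr01).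
split => //.
have sb : s <= b.
  have [b1|b1] := leP 1 b; first by case/andP: s01 => _ /le_trans; apply.
  apply: (emp_quantile_le n_gt0) => //.
  have := dev b; rewrite b_ge0 (ltW b1) lexx => /(_ isT isT).
  rewrite ler_norml => /andP[H _].
  have := slack b1; have : n%:R * (x * r) <= n%:R * r.
    by rewrite ler_pM2l// ler_piMl.
  lra.
rewrite ler_pdivlMr// -[X in _ * X]ger0_norm ?ler0n// -normrM.
have -> : (s - x * r) * n%:R = (count X n s - n%:R * (x * r)) - (count X n s - n%:R * s) by ring.
by apply: (le_trans (ler_normB _ _)); rewrite addrC lerD// dev.
Qed.

Lemma copula_error_bound (p : R * R) : unit_square p ->
  `|local_emp_copula C U V n r p - local_approx C U V n r p| <=
  Num.sqrt n%:R / n%:R * (zeta + (10 + 2 * L) * rho + 4 * L * (n%:R / N%:R)).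
Proof.
case: p => p1 p2 [/= p1_ p2_].
rewrite /local_emp_copula /local_approx /emp_process /emp_process_fst /emp_process_snd /=.
rewrite emp_fstE emp_sndE /=.
have [s01 cs sp] := quantile_close U01 cellU0 cellU devU p1_.
have [t01 ct tp] := quantile_close V01 cellV0 cellV devV p2_.
set s := emp_quantile _ (p1 * r) in s01 cs sp *.
set t := emp_quantile _ (p2 * r) in t01 ct tp *.
have r01' := r01; case/andP: (r01') => r0 r1.
have u01 : 0 <= p1 * r <= 1 by case/andP: p1_ => ? ?; rewrite mulr_ge0//= mulr_ile1.
have v01 : 0 <= p2 * r <= 1 by case/andP: p2_ => ? ?; rewrite mulr_ge0//= mulr_ile1.
set u := p1 * r in u01 cs sp *; set v := p2 * r in v01 ct tp *.
set ax := boundary_ext (partial_u C) (u, v).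
set bx := boundary_ext (partial_v C) (u, v).
have jointE x y : emp_joint U V n (x, y) = n%:R^-1 * count2 x y by [].
rewrite !jointE.
pose OS := count2 s t - count2 u v - ax * (count U n s - count U n u)
  - bx * (count V n t - count V n v).
(* The values of C at (u, v) cancel, and the marginal terms are completed to increments between u
   and s, v and t. The two corrections left are small because s and t are empirical quantiles at the
   levels u and v. *)
rewrite (_ : _ - _ = Num.sqrt n%:R / n%:R *
   (OS + ax * (count U n s - n%:R * u) + bx * (count V n t - n%:R * v))); last first.
  by rewrite /OS; field; rewrite gt_eqF.
rewrite normrM ger0_norm ?divr_ge0 ?sqrtr_ge0//.
rewrite ler_wpM2l ?divr_ge0 ?sqrtr_ge0//.
have [i i_ [si csi]] := interior_round (@count_homo U) N2 cellU s01.
have [j j_ [tj ctj]] := interior_round (@count_homo V) N2 cellV t01.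
have [k k_ [uk cuk]] := interior_round (@count_homo U) N2 cellU u01.
have [l l_ [vl cvl]] := interior_round (@count_homo V) N2 cellV v01.
have grid_in a : (0 < a < N)%N -> 0 < (a%:R : R) / N%:R < 1.
  move=> /andP[a0 aN]; apply/andP; split; first by rewrite divr_gt0// ltr0n.
  by rewrite ltr_pdivrMr// mul1r ltr_nat.
have near_dl (x y x' y' : R) : `|x - x'| <= N%:R^-1 -> `|y - y'| <= N%:R^-1 ->
    `|x - y| <= (E + rho) / n%:R -> `|x' - y'| <= dl.
  move=> xx' yy' xy; apply: (le_trans _ dlE).
  have -> : x' - y' = (x - y) - ((x - x') - (y - y')) by ring.
  apply: (le_trans (ler_normB _ _)); rewrite lerD//.
  by apply: (le_trans (ler_normB _ _)); rewrite two lerD.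
have := grid_osc i_ j_ k_ l_ (near_dl _ _ _ _ si uk sp) (near_dl _ _ _ _ tj vl tp).
have Okl : @open_square R (k%:R / N%:R, l%:R / N%:R) by split => /=; [exact: (grid_in _ k_) | exact: (grid_in _ l_)].
have Uuv : unit_square (u, v) by [].
have l1kl : l1dist (u, v) (k%:R / N%:R, l%:R / N%:R) <= 2 / N%:R.
  by rewrite /l1dist /= two lerD.
have a_ax : `|ax - partial_u C (k%:R / N%:R, l%:R / N%:R)| <= L * (2 / N%:R) :=
  le_trans (extu Uuv Okl) (ler_wpM2l L0 l1kl).
have b_bx : `|bx - partial_v C (k%:R / N%:R, l%:R / N%:R)| <= L * (2 / N%:R) :=
  le_trans (extv Uuv Okl) (ler_wpM2l L0 l1kl).
have a1 := Cu1 Okl; have b1 := Cv1 Okl.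
set a := partial_u C _ in a_ax a1 *; set bb := partial_v C _ in b_bx b1 *.
set i' := i%:R / N%:R in si csi *; set j' := j%:R / N%:R in tj ctj *.
set k' := k%:R / N%:R in uk cuk *; set l' := l%:R / N%:R in vl cvl *.
have -> : \sum_(x < n) osc i' j' k' l' a bb (U x, V x) =
    count2 i' j' - count2 k' l' - a * (count U n i' - count U n k')
    - bb * (count V n j' - count V n l').
  by rewrite /osc /count2 /count /= !sumrB -!mulr_sumr !sumrB.
set OS0 := (X in `|X| <= zeta) => OSz.
clearbody ax bx a bb.
have Nhalf : 2 / N%:R <= 1 :> R by rewrite ler_pdivrMr// mul1r ler_nat.
have axL : `|ax| <= 1 + L.
  have -> : ax = a + (ax - a) by ring.
  apply: (le_trans (ler_normD _ _)); rewrite lerD//.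
  by apply: (le_trans a_ax); rewrite -[leRHS]mulr1 ler_wpM2l.
have bxL : `|bx| <= 1 + L.
  have -> : bx = bb + (bx - bb) by ring.
  apply: (le_trans (ler_normD _ _)); rewrite lerD//.
  by apply: (le_trans b_bx); rewrite -[leRHS]mulr1 ler_wpM2l.
have rho0 : 0 <= rho by apply: le_trans cellU0.
have A1 : `|ax * (count U n s - n%:R * u)| <= (1 + L) * rho.
  by rewrite normrM; apply: ler_pM.
have A2 : `|bx * (count V n t - n%:R * v)| <= (1 + L) * rho.
  by rewrite normrM; apply: ler_pM.
have B1 : `|(ax - a) * (count U n s - count U n u)| <= L * (2 / N%:R) * n%:R.
  by rewrite normrM; apply: ler_pM.
have B2 : `|(bx - bb) * (count V n t - count V n v)| <= L * (2 / N%:R) * n%:R.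
  by rewrite normrM; apply: ler_pM.
have D1 : `|a * ((count U n s - count U n i') - (count U n u - count U n k'))| <= 2 * rho.
  rewrite normrM -[leRHS]mul1r ler_pM// two.
  by apply: (le_trans (ler_normB _ _)); rewrite lerD.
have D2 : `|bb * ((count V n t - count V n j') - (count V n v - count V n l'))| <= 2 * rho.
  rewrite normrM -[leRHS]mul1r ler_pM// two.
  by apply: (le_trans (ler_normB _ _)); rewrite lerD.
have F1 : `|count2 s t - count2 i' j'| <= 2 * rho.
  by rewrite (le_trans (count2_diff _ _ _ _))// two lerD.
have F2 : `|count2 u v - count2 k' l'| <= 2 * rho.
  by rewrite (le_trans (count2_diff _ _ _ _))// two lerD.
(* Rounding budget: A1, A2 give 2 (1 + L) rho, D1, D2 give 4 rho and F1, F2 give 4 rho, in all (10 +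
   2 L) rho; B1, B2 give 4 L n / N. *)
have -> : OS = OS0 + ((count2 s t - count2 i' j') - (count2 u v - count2 k' l'))
  - ((ax - a) * (count U n s - count U n u)
     + a * ((count U n s - count U n i') - (count U n u - count U n k')))
  - ((bx - bb) * (count V n t - count V n v)
     + bb * ((count V n t - count V n j') - (count V n v - count V n l'))).
  by rewrite /OS /OS0; ring.
clear - A1 A2 B1 B2 D1 D2 F1 F2 OSz.
move: A1 A2 B1 B2 D1 D2 F1 F2 OSz.
move: (ax * (_ - _)) (bx * (_ - _)) ((ax - a) * _) ((bx - bb) * _) (a * (_ - _)) (bb * (_ - _))
  (count2 s t - _) (count2 u v - _) OS0 => x1 x2 x3 x4 x5 x6 x7 x8 x9.
rewrite !ler_norml => /andP[? ?] /andP[? ?] /andP[? ?] /andP[? ?] /andP[? ?] /andP[? ?] /andP[? ?] /andP[? ?] /andP[? ?].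
by apply/andP; split; lra.
Qed.

End ErrorBound.

(** * Oscillations at grid points *)

Section OscillationEvents.
Context {d : measure_display} {Omega : measurableType d} {R : realType}.
Context {P : probability Omega R} {Z : nat -> Omega -> R * R}.
Hypothesis Z_iid : iid_sample P Z.

(** For the deviation q / 8 and variance at most q the exponent is (q / 8)^2 / (2 q) times 1 - 4 /
    8, that is q / 256. *)
Lemma cell_tail (g : R * R -> R) (a b m q : R) (n : nat) :
  measurable_fun setT g -> a <= b ->
  m = Pr P [set w | g (Z 0%N w) <= b] - Pr P [set w | g (Z 0%N w) <= a] ->
  0 <= m -> 0 < q -> n%:R * m <= q ->
  Pr P (interval_hit (Z := Z) g a b m (q / 8) n) <= 2 * expR (- (q / 256)).
Proof.
move=> mg ab mE m0 q0 nq.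
apply: (le_trans (bernstein_interval Z_iid mg ab mE (q := q) _ q0 _ _)).
- apply: le_trans nq; rewrite ler_wpM2l// ler_piMr// gerBl//.
- by rewrite divr_ge0// ltW.
- lra.
rewrite ler_wpM2l// ler_expR lerN2 le_eqVlt; apply/orP; left; apply/eqP.
by field; rewrite gt_eqF.
Qed.

(** For n / N <= q, every cell holds at most 2 q sample points off this event. The component with
    lower endpoint -1 gives the same for the points at 0, which belong to no half-open cell. *)
Definition cells_event (g : R * R -> R) (n N : nat) (q : R) : set Omega :=
  [set w | interval_hit (Z := Z) g (-1) 0 0 (q / 8) n w \/
    exists j : 'I_N, interval_hit (Z := Z) g (j%:R / N%:R) (j.+1%:R / N%:R)
      (N%:R^-1) (q / 8) n w].

Lemma measurable_interval_hit (g : R * R -> R) (a b m x : R) (n : nat) :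
  measurable_fun setT g -> measurable (interval_hit (Z := Z) g a b m x n).
Proof. by move=> mg; exact: (measurable_interval_dev_hit Z_iid mg). Qed.

Lemma measurable_cells_event g n N q : measurable_fun setT g ->
  measurable (cells_event g n N q).
Proof.
move=> mg; apply: measurableU; first exact: measurable_interval_hit.
by apply: measurable_exists_fin => j; exact: measurable_interval_hit.
Qed.

Lemma Pr_cells_event (g : R * R -> R) (n N : nat) (q : R) :
  measurable_fun setT g -> (forall i w, 0 <= g (Z i w)) ->
  (forall x, 0 <= x <= 1 -> Pr P [set w | g (Z 0%N w) <= x] = x) ->
  (0 < N)%N -> 0 < q -> n%:R / N%:R <= q ->
  Pr P (cells_event g n N q) <= 2 * (N.+1)%:R * expR (- (q / 256)).
Proof.
move=> mg g0 glaw N0 q0 nNq.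
have N0' : 0 < N%:R :> R by rewrite ltr0n.
have mhit a b m : measurable (interval_hit (Z := Z) g a b m (q / 8) n).
  exact: measurable_interval_hit.
have gN1 : Pr P [set w | g (Z 0%N w) <= -1] = 0.
  rewrite (_ : [set _ | _] = set0) ?Pr_set0//; apply/seteqP; split => // w /=.
  by move=> /(le_trans (g0 _ _)); rewrite lerNr oppr0 ler10.
pose F (o : option 'I_N) := if o is Some j then
    interval_hit (Z := Z) g (j%:R / N%:R) (j.+1%:R / N%:R) (N%:R^-1) (q / 8) n
  else interval_hit (Z := Z) g (-1) 0 0 (q / 8) n.
apply: (@le_trans _ _ (\sum_o Pr P (F o))).
  apply: Pr_fin_subadditive => [|[j|]//=|w [H|[j H]]].
  - exact: measurable_cells_event.
  - by exists None.
  - by exists (Some j).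
apply: (@le_trans _ _ (\sum_(o : option 'I_N) 2 * expR (- (q / 256)))); last first.
  rewrite sumr_const card_option card_ord -[leLHS]mulr_natl.
  by rewrite le_eqVlt; apply/orP; left; apply/eqP; ring.
apply: ler_sum => -[j|] _ /=.
  have step : j.+1%:R / N%:R = j%:R / N%:R + N%:R^-1 :> R.
    by rewrite -natr1 mulrDl mul1r.
  have j1 : j.+1%:R / N%:R <= 1 :> R by rewrite ler_pdivrMr// mul1r ler_nat.
  have jj : j%:R / N%:R <= j.+1%:R / N%:R :> R.
    by rewrite ler_pM2r ?invr_gt0// ler_nat.
  apply: cell_tail => //.
  rewrite !glaw ?divr_ge0//= ?(le_trans jj)// step; ring.
apply: cell_tail => //.
- by rewrite gN1 glaw ?lexx ?ler01// subr0.
- by rewrite mulr0 ltW.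
Qed.

Lemma not_cells_event (g : R * R -> R) (n N : nat) (q : R) (w : Omega) :
  (forall i, 0 <= g (Z i w)) -> (0 < N)%N -> n%:R / N%:R <= q -> 0 < q ->
  ~ cells_event g n N q w ->
  \sum_(i < n) (g (Z i w) <= 0)%R%:R <= 2 * q /\
  forall j, (j < N)%N -> \sum_(i < n) (g (Z i w) <= j.+1%:R / N%:R)%R%:R -
      \sum_(i < n) (g (Z i w) <= j%:R / N%:R)%R%:R <= 2 * q.
Proof.
move=> g0 N0 nNq q0 /not_orP[H1 H2]; split.
  rewrite leNgt; apply/negP => H; apply: H1; exists n => //.
  rewrite (le_trans _ (ler_norm _))// !sumrB.
  rewrite [X in _ - X - _]big1; last first.
    by move=> i _; rewrite leNgt (lt_le_trans _ (g0 i))// ltrN10.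
  rewrite sumr_const mul0rn !subr0; move: H; set S := \sum_(i < n) _; lra.
move=> j jN; rewrite leNgt; apply/negP => H; apply: H2; exists (Ordinal jN).
exists n => //=; rewrite (le_trans _ (ler_norm _))// !sumrB sumr_const card_ord.
rewrite -(mulr_natl (N%:R^-1)).
move: H; set S1 := \sum_(i < n) _; set S2 := \sum_(i < n) _ => H.
clear -H nNq q0; lra.
Qed.

Section OscEvent.
Variables (C : R * R -> R) (L : R).
Hypothesis Z_u : forall x, 0 <= x <= 1 -> Pr P [set w | (Z 0%N w).1 <= x] = x.
Hypothesis Z_v : forall x, 0 <= x <= 1 -> Pr P [set w | (Z 0%N w).2 <= x] = x.
Hypothesis Z_cdf : forall s t, 0 < s < 1 -> 0 < t < 1 ->
  sample_cdf (P := P) (Z := Z) s t = C (s, t).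
Hypothesis L0 : 0 <= L.
Hypothesis C_exp : forall s t u v dl, 0 < s < 1 -> 0 < t < 1 -> 0 < u < 1 -> 0 < v < 1 ->
  `|s - u| <= dl -> `|t - v| <= dl -> [/\
  `|C (s, v) - C (u, v) - partial_u C (u, v) * (s - u)| <= L * dl ^+ 2,
  `|C (u, t) - C (u, v) - partial_v C (u, v) * (t - v)| <= L * dl ^+ 2 &
  `|C (s, t) - C (s, v) - C (u, t) + C (u, v)| <= L * dl ^+ 2].
Hypothesis Cu1 : forall q, open_square q -> `|partial_u C q| <= 1.
Hypothesis Cv1 : forall q, open_square q -> `|partial_v C q| <= 1.

(** Inadmissible quadruples receive the empty event, so that the union bound runs over one finite
    type with N^4 elements. *)
Definition grid_osc_hit (n N : nat) (dl y : R)
    (x : ('I_N * 'I_N) * ('I_N * 'I_N)) : set Omega :=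
  let: ((i, j), (k, l)) := x in
  if [&& (0 < i)%N, (0 < j)%N, (0 < k)%N, (0 < l)%N,
      `|i%:R / N%:R - k%:R / N%:R| <= dl & `|j%:R / N%:R - l%:R / N%:R| <= dl]
  then [set w | y <= `|\sum_(a < n) osc (i%:R / N%:R) (j%:R / N%:R)
     (k%:R / N%:R) (l%:R / N%:R)
     (partial_u C (k%:R / N%:R, l%:R / N%:R))
     (partial_v C (k%:R / N%:R, l%:R / N%:R)) (Z a w)|]
  else set0.

Definition osc_event (n N : nat) (dl y : R) : set Omega :=
  [set w | exists x, @grid_osc_hit n N dl y x w].

Lemma measurable_grid_osc_hit n N dl y x : measurable (@grid_osc_hit n N dl y x).
Proof.
by case: x => -[i j] [k l]; rewrite /grid_osc_hit; case: ifP => // _;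
  exact: (measurable_osc_event Z_iid).
Qed.

Lemma measurable_osc_events n N dl y : measurable (osc_event n N dl y).
Proof. by apply: measurable_exists_fin => x; exact: measurable_grid_osc_hit. Qed.

Lemma Pr_osc_event (n N : nat) (dl y q : R) :
  n%:R * (dl / 2 + 23 * (L * dl ^+ 2)) <= q -> 0 < q ->
  3 * (L * dl ^+ 2) * n%:R <= y -> 6 * y <= q ->
  Pr P (osc_event n N dl y) <= N%:R ^+ 4 *
   (2 * expR (- ((y - 3 * (L * dl ^+ 2) * n%:R) ^+ 2 / (2 * q) * (1 - 12 * y / q)))).
Proof.
move=> nq q0 Ky yq; set e := 2 * _.
apply: (@le_trans _ _ (\sum_x Pr P (@grid_osc_hit n N dl y x))).
  apply: Pr_fin_subadditive => // [|x]; first exact: measurable_osc_events.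
  exact: measurable_grid_osc_hit.
apply: (@le_trans _ _ (\sum_(x : ('I_N * 'I_N) * ('I_N * 'I_N)) e)); last first.
  rewrite sumr_const !card_prod !card_ord -[leLHS]mulr_natl !natrM.
  by rewrite le_eqVlt; apply/orP; left; apply/eqP; ring.
apply: ler_sum => -[[i j] [k l]] _; rewrite /grid_osc_hit.
case: ifPn => [/and5P[i0 j0 k0 l0 /andP[ik jl]]|_]; last first.
  by rewrite Pr_set0 /e mulr_ge0// expR_ge0.
have grid_in (a : 'I_N) : (0 < a)%N -> 0 < (a%:R : R) / N%:R < 1.
  move=> a0; have N0 : (0 < N)%N by rewrite (leq_ltn_trans _ (ltn_ord a)).
  apply/andP; split; first by rewrite divr_gt0// ltr0n.
  by rewrite ltr_pdivrMr ?ltr0n// mul1r ltr_nat.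
have wk (x : R) : 0 < x < 1 -> 0 <= x <= 1.
  by move=> /andP[? ?]; rewrite !ltW.
have i1 := grid_in _ i0; have j1 := grid_in _ j0.
have k1 := grid_in _ k0; have l1 := grid_in _ l0.
have [e1 e2 e3] := C_exp i1 j1 k1 l1 ik jl.
have Okl : @open_square R (k%:R / N%:R, l%:R / N%:R) by split.
apply: (bernstein_osc Z_iid (Z_u (wk _ i1)) (Z_u (wk _ k1)) (Z_v (wk _ j1)) (Z_v (wk _ l1))
  (Cu1 Okl) (Cv1 Okl) ik jl) => //.
- by rewrite !Z_cdf.
- by rewrite !Z_cdf.
- by rewrite !Z_cdf.
Qed.

End OscEvent.
End OscillationEvents.

(** * Choice of the constants in the oscillation bound *)

Section OscillationTuning.
Context {R : realType}.

(** To be read with a = n^{1/4}, l = (log_2 n)^{1/4} and t = (log_1 n)^{1/2}: [dl] is the range of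
    the quantile deviations, [y] the threshold and [q] the variance bound. With D1^2 just above 2 v,
    the hypothesis [4 * D1 < c1 ^+ 2] is the condition c^4 > 32 v, and it yields p > 4. Error terms
    are smaller than the main ones by a power of a, up to powers of l and t, so they vanish once a
    >= K0 t^4. *)
Lemma osc_algebra (D1 c1 L : R) : 0 < D1 -> 0 < c1 -> 4 * D1 < c1 ^+ 2 -> 0 <= L ->
  exists D2 D3 c2 p K0, [/\ 0 < D2, 0 < D3, 0 < c2 < c1, 4 < p & 
  forall a l t : R, 1 <= a -> 1 <= l -> 1 <= t -> l ^+ 4 <= t ^+ 2 -> K0 * t ^+ 4 <= a ->
  let dl := D2 * l ^+ 2 / a ^+ 2 in
  let y := c2 * (a * l * t) in
  let q := a ^+ 2 * l ^+ 2 * D3 / 2 in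
  [/\ a ^+ 4 * (dl / 2 + 23 * (L * dl ^+ 2)) <= q,
   3 * (L * dl ^+ 2) * a ^+ 4 <= y, 6 * y <= q,
   p * t ^+ 2 <= (y - 3 * (L * dl ^+ 2) * a ^+ 4) ^+ 2 / (2 * q) * (1 - 12 * y / q)
   & (D1 * (a ^+ 2 * l ^+ 2) + 2 * a) / a ^+ 4 + 2 / a ^+ 3 <= dl /\
     (p - 2) * t ^+ 2 <= a / 256]].
Proof.
move=> D10 c10 Dc L0.
(* Each gap pays for one loss: D1 < D2 for the jumps and the mesh inside dl, D2 < D3 for the dl^2
   part of the variance, c3 < c2 for the mean of the sum, p < tau for the Bernstein correction, and
   c2 < c1 for the later rounding to the grid. That sqrt (4 D3) < c3 makes tau exceed 4. *)
pose D3 := (D1 + c1 ^+ 2 / 4) / 2.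
have D13 : D1 < D3 by rewrite /D3; lra.
have D30 : 0 < D3 by rewrite (lt_trans D10).
have D3c : 4 * D3 < c1 ^+ 2 by rewrite /D3; lra.
pose D2 := (D1 + D3) / 2.
have D12 : D1 < D2 by rewrite /D2; lra.
have D23 : D2 < D3 by rewrite /D2; lra.
have D20 : 0 < D2 by rewrite (lt_trans D10).
pose s := Num.sqrt (4 * D3).
have s2 : s ^+ 2 = 4 * D3 by rewrite sqr_sqrtr// mulr_ge0// ltW.
have s0 : 0 < s by rewrite sqrtr_gt0 mulr_gt0.
have sc1 : s < c1 by rewrite -(@ltr_pXn2r _ 2) ?nnegrE ?(ltW s0) ?(ltW c10)// s2.
pose c3 := (s + c1) / 2; pose c2 := (c3 + c1) / 2.
have sc3 : s < c3 by rewrite /c3; lra.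
have c31 : c3 < c1 by rewrite /c3; lra.
have c32 : c3 < c2 by rewrite /c2; lra.
have c21 : c2 < c1 by rewrite /c2; lra.
have c30 : 0 < c3 by rewrite (lt_trans s0).
have c20 : 0 < c2 by rewrite (lt_trans c30).
pose tau := c3 ^+ 2 / D3.
have tau4 : 4 < tau.
  by rewrite ltr_pdivlMr// -s2 ltr_pXn2r ?nnegrE ?(ltW s0) ?(ltW c30).
pose p := (4 + tau) / 2.
have p4 : 4 < p by rewrite /p; lra.
have ptau : p < tau by rewrite /p; lra.
have tau0 : 0 < tau by rewrite (lt_trans _ tau4).
have tauE : tau = c3 ^+ 2 / D3 by [].
clearbody p tau c2 c3 s D2 D3.
(* K1 to K5 are solved from the inequalities H1 to H5, and K6 from the one for the cell
   probabilities. The powers of l and t that occur there are all at most t^4. *)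
pose K1 := 46 * L * D2 ^+ 2 / (D3 - D2).
pose K2 := 3 * L * D2 ^+ 2 / (c2 - c3).
pose K3 := 12 * c2 / D3.
pose K4 := 24 * c2 * tau / (D3 * (tau - p)).
pose K5 := 4 / (D2 - D1).
pose K6 := 256 * (p - 2).
have K10 : 0 <= K1.
  by rewrite /K1 divr_ge0 ?subr_ge0 ?(ltW D23)//; nneg.
have K20 : 0 <= K2.
  by rewrite /K2 divr_ge0 ?subr_ge0 ?(ltW c32)//; nneg.
have K30 : 0 <= K3 by rewrite /K3; nneg.
have K40 : 0 <= K4.
  by rewrite /K4 divr_ge0//; [nneg|rewrite mulr_ge0 ?subr_ge0// ltW].
have K50 : 0 <= K5 by rewrite /K5 divr_ge0// subr_ge0 ltW.
have K60 : 0 <= K6 by rewrite /K6; lra.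
exists D2, D3, c2, p, (K1 + K2 + K3 + K4 + K5 + K6); split => //.
  by rewrite c20.
move=> a l t a1 l1 t1 lt Ka dl y q.
have a0 : 0 < a by rewrite (lt_le_trans ltr01).
have l0 : 0 < l by rewrite (lt_le_trans ltr01).
have t0 : 0 < t by rewrite (lt_le_trans ltr01).
have Kle K : 0 <= K -> K <= K1 + K2 + K3 + K4 + K5 + K6 -> K * t ^+ 4 <= a.
  move=> K0 KK; apply: (le_trans _ Ka); rewrite ler_wpM2r// exprn_ge0// ltW//.
have a_K1 : K1 * t ^+ 4 <= a by apply: Kle => //; lra.
have a_K2 : K2 * t ^+ 4 <= a by apply: Kle => //; lra.
have a_K3 : K3 * t ^+ 4 <= a by apply: Kle => //; lra.
have a_K4 : K4 * t ^+ 4 <= a by apply: Kle => //; lra.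
have a_K5 : K5 * t ^+ 4 <= a by apply: Kle => //; lra.
have a_K6 : K6 * t ^+ 4 <= a by apply: Kle => //; lra.
clear Ka Kle.
have t14 : t <= t ^+ 4 by rewrite ler_eXnr.
have t24 : t ^+ 2 <= t ^+ 4 by rewrite ler_weXn2l.
have t04 : 1 <= t ^+ 4 by rewrite exprn_ege1.
have l2t : l ^+ 2 <= t ^+ 4.
  by rewrite (le_trans _ t24)// (le_trans _ lt)// ler_weXn2l.
have l3t : l ^+ 3 <= t ^+ 4.
  by rewrite (le_trans _ t24)// (le_trans _ lt)// ler_weXn2l.
have wk K x : 0 <= K -> K * t ^+ 4 <= a -> x <= t ^+ 4 -> K * x <= a.
  by move=> K0 Ka xt; rewrite (le_trans _ Ka)// ler_wpM2l.
have q0 : 0 < q by rewrite /q !mulr_gt0 ?exprn_gt0.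
have dl2a : dl ^+ 2 * a ^+ 4 = D2 ^+ 2 * l ^+ 4.
  by rewrite /dl; field; rewrite gt_eqF.
have H1 : 46 * L * D2 ^+ 2 * l ^+ 2 <= a ^+ 2 * (D3 - D2).
  have := wk _ _ K10 a_K1 l2t; rewrite /K1 mulrAC ler_pdivrMr ?subr_gt0// => H.
  apply: (le_trans H); rewrite ler_wpM2r ?subr_ge0 ?(ltW D23)//.
  by rewrite ler_eXnr.
have H2 : 3 * L * D2 ^+ 2 * l ^+ 3 <= a * t * (c2 - c3).
  have := wk _ _ K20 a_K2 l3t; rewrite /K2 mulrAC ler_pdivrMr ?subr_gt0// => H.
  apply: (le_trans H); rewrite ler_wpM2r ?subr_ge0 ?(ltW c32)//.
  by rewrite ler_peMr// ltW.
have H3 : 12 * c2 * t <= a * l * D3.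
  have := wk _ _ K30 a_K3 t14; rewrite /K3 mulrAC ler_pdivrMr// => H.
  apply: (le_trans H); rewrite ler_pM2r//.
  by rewrite ler_peMr// ltW.
have H4 : 24 * c2 * tau * t <= a * l * (D3 * (tau - p)).
  have dtp : 0 < D3 * (tau - p) by rewrite mulr_gt0// subr_gt0.
  have := wk _ _ K40 a_K4 t14; rewrite /K4 mulrAC ler_pdivrMr// => H.
  apply: (le_trans H); rewrite ler_pM2r//.
  by rewrite ler_peMr// ltW.
have H5 : 4 <= a * (D2 - D1).
  have := wk _ _ K50 a_K5 t04; rewrite mulr1 /K5 ler_pdivrMr// subr_gt0//.
have E1 : a ^+ 4 * (dl / 2 + 23 * (L * dl ^+ 2)) <= q.
  have -> : a ^+ 4 * (dl / 2 + 23 * (L * dl ^+ 2)) =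
      l ^+ 2 / 2 * (D2 * a ^+ 2 + 46 * L * D2 ^+ 2 * l ^+ 2).
    by rewrite /dl; field; rewrite gt_eqF.
  have -> : q = l ^+ 2 / 2 * (D3 * a ^+ 2) by rewrite /q; field.
  rewrite ler_wpM2l ?divr_ge0 ?exprn_ge0 ?(ltW l0)//; lra.
have y_c3 : c3 * (a * l * t) <= y - 3 * (L * dl ^+ 2) * a ^+ 4.
  have -> : 3 * (L * dl ^+ 2) * a ^+ 4 = l * (3 * L * D2 ^+ 2 * l ^+ 3).
    by rewrite -mulrA -(mulrA L) dl2a; ring.
  have := ler_wpM2l (ltW l0) H2; rewrite /y; lra.
have alt0 : 0 < a * l * t by rewrite !mulr_gt0.
have E2 : 3 * (L * dl ^+ 2) * a ^+ 4 <= y.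
  rewrite -subr_ge0; apply: le_trans y_c3.
  by rewrite mulr_ge0// ltW.
have E3 : 6 * y <= q.
  have -> : q = a * l * (a * l * D3) / 2 by rewrite /q; field.
  have -> : 6 * y = a * l * (12 * c2 * t) / 2 by rewrite /y; field.
  by rewrite ler_wpM2r// ler_wpM2l// mulr_ge0// ltW.
split => //.
- have F1 : 12 * y / q <= (tau - p) / tau.
    rewrite ler_pdivrMr// mulrAC ler_pdivlMr//.
    have -> : 12 * y * tau = a * l / 2 * (24 * c2 * tau * t) by rewrite /y; field.
    have -> : (tau - p) * q = a * l / 2 * (a * l * (D3 * (tau - p))).
      by rewrite /q; field.
    by rewrite ler_wpM2l// divr_ge0// mulr_ge0// ltW.
  have F2 : tau * t ^+ 2 <= (y - 3 * (L * dl ^+ 2) * a ^+ 4) ^+ 2 / (2 * q).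
    rewrite ler_pdivlMr ?mulr_gt0//.
    have -> : tau * t ^+ 2 * (2 * q) = (c3 * (a * l * t)) ^+ 2.
      by rewrite tauE /q; field; rewrite gt_eqF.
    have c3alt : 0 <= c3 * (a * l * t) by rewrite mulr_ge0 ?ltW.
    by rewrite ler_pXn2r ?nnegrE// (le_trans c3alt).
  have -> : p * t ^+ 2 = tau * t ^+ 2 * (1 - (tau - p) / tau).
    by field; rewrite gt_eqF.
  have tp : 0 <= 1 - (tau - p) / tau.
    by rewrite subr_ge0 ler_pdivrMr// mul1r lerBlDr lerDl (le_trans _ (ltW p4)).
  apply: ler_pM => //; first by rewrite mulr_ge0 ?sqr_ge0// ltW.
  by rewrite lerD2l lerN2.
- split.
    rewrite /dl -(@ler_pM2r _ (a ^+ 4)) ?exprn_gt0//.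
    have -> : ((D1 * (a ^+ 2 * l ^+ 2) + 2 * a) / a ^+ 4 + 2 / a ^+ 3) * a ^+ 4 =
       a * (a * l ^+ 2 * D1 + 4) by field; rewrite gt_eqF.
    have -> : D2 * l ^+ 2 / a ^+ 2 * a ^+ 4 = a * (a * l ^+ 2 * D2).
      by field; rewrite gt_eqF.
    rewrite ler_pM2l//.
    have : a * (D2 - D1) <= a * l ^+ 2 * (D2 - D1).
      rewrite ler_wpM2r ?subr_ge0 ?(ltW D12)// ler_peMr ?(ltW a0)//.
      by rewrite exprn_ege1.
    by rewrite mulrBr; move: H5; lra.
  rewrite ler_pdivlMr// mulrC mulrA.
  exact: (wk _ _ K60 a_K6 t24).
Qed.

End OscillationTuning.

(** * Almost sure bound on the error *)

Section ProbabilityOfUnions.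
Context {d : measure_display} {Omega : measurableType d} {R : realType}.
Context {P : probability Omega R}.

Lemma Pr_cover2 (A B D : set Omega) : measurable A -> measurable B -> measurable D ->
  (A `<=` B `|` D) -> Pr P A <= Pr P B + Pr P D.
Proof.
move=> mA mB mD AB.
apply: (@le_trans _ _ (\sum_(x : bool) Pr P (if x then B else D))).
  apply: Pr_fin_subadditive => [//|[]//|w /AB [?|?]]; first by exists true.
  by exists false.
by rewrite big_bool.
Qed.

(** The part of B \ A inside D is no larger than B \ A. This gives the Lipschitz property of
    copulas, and it also allows nested events of equal probability to be exchanged inside an
    intersection. *)
Lemma Pr_increment (A B D : set Omega) : measurable A -> measurable B -> measurable D ->
  A `<=` B -> Pr P (B `&` D) - Pr P (A `&` D) <= Pr P B - Pr P A.
Proof.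
move=> mA mB mD AB.
have H : Pr P (B `&` D) + Pr P A <= Pr P B + Pr P (A `&` D).
  have H1 : Pr P (B `&` D) <= Pr P (A `&` D) + Pr P ((B `\` A) `&` D).
    apply: Pr_cover2.
    - exact: measurableI.
    - exact: measurableI.
    - by apply: measurableI => //; exact: measurableD.
    - by move=> w [Bw Dw]; have [Aw|nAw] := pselect (A w); [left|right].
  have H2 : Pr P ((B `\` A) `&` D) <= Pr P (B `\` A).
    apply: le_Pr; [|exact: measurableD|by move=> w []].
    by apply: measurableI => //; exact: measurableD.
  have H3 : Pr P B = Pr P A + Pr P (B `\` A).
    transitivity (\sum_(x : bool) Pr P (if x then A else B `\` A)); last by rewrite big_bool.
    apply: Pr_fin_additive => [//|[]//|w|w].
    - exact: measurableD.
    - split; last by move=> [[]//]; [exact: AB|case].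
      by move=> Bw; have [Aw|nAw] := pselect (A w); [exists true|exists false].
    - by move=> [] [] //; [move=> ? []|move=> []].
  lra.
lra.
Qed.

End ProbabilityOfUnions.

Section AlmostSureError.
Context {d : measure_display} {Omega : measurableType d} {R : realType}.
Context {P : probability Omega R} {Z : nat -> Omega -> R * R}.
Hypothesis Z_iid : iid_sample P Z.
Hypothesis Z1_01 : forall i w, 0 <= (Z i w).1 <= 1.
Hypothesis Z2_01 : forall i w, 0 <= (Z i w).2 <= 1.
Hypothesis Z_u : forall x, 0 <= x <= 1 -> Pr P [set w | (Z 0%N w).1 <= x] = x.
Hypothesis Z_v : forall x, 0 <= x <= 1 -> Pr P [set w | (Z 0%N w).2 <= x] = x.
Variable C : R * R -> R.
Hypothesis Z_cdf : forall s t, 0 < s < 1 -> 0 < t < 1 ->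
  sample_cdf (P := P) (Z := Z) s t = C (s, t).
Hypothesis C_C2 : C2_on open_square C.
Hypothesis C_ext : second_partials_continuous C.

Let wk (x : R) : 0 < x < 1 -> 0 <= x <= 1.
Proof. by move=> /andP[? ?]; rewrite !ltW. Qed.

Let measurable_Z1 x : measurable [set w | (Z 0%N w).1 <= x].
Proof. exact: (measurable_level Z_iid (measurable_fst : measurable_fun setT fst)). Qed.

Let measurable_Z2 x : measurable [set w | (Z 0%N w).2 <= x].
Proof. exact: (measurable_level Z_iid (measurable_snd : measurable_fun setT snd)). Qed.

Let cdfE s t : sample_cdf (P := P) (Z := Z) s t =
  Pr P ([set w | (Z 0%N w).1 <= s] `&` [set w | (Z 0%N w).2 <= t]).
Proof. by []. Qed.

Let C_lip_u s u v : 0 < s < 1 -> 0 < u < 1 -> 0 < v < 1 ->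
  `|C (s, v) - C (u, v)| <= `|s - u|.
Proof.
wlog us : s u / u <= s => [W|] s01 u01 v01.
  have [/W|/ltW /W] := leP u s; first exact.
  by move=> /(_ u01 s01 v01); rewrite distrC (distrC u).
rewrite -!Z_cdf// !cdfE [X in _ <= X]ger0_norm ?subr_ge0//.
have sub : [set w | (Z 0%N w).1 <= u] `<=` [set w | (Z 0%N w).1 <= s].
  by move=> w /= /le_trans; apply.
have := Pr_increment (P := P) (measurable_Z1 u) (measurable_Z1 s) (measurable_Z2 v) sub.
rewrite (Z_u (wk u01)) (Z_u (wk s01)) => H.
rewrite ger0_norm// subr_ge0; apply: le_Pr; try exact: measurableI.
exact: setSI.
Qed.

Let C_lip_v t u v : 0 < t < 1 -> 0 < u < 1 -> 0 < v < 1 ->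
  `|C (u, t) - C (u, v)| <= `|t - v|.
Proof.
wlog vt : t v / v <= t => [W|] t01 u01 v01.
  have [/W|/ltW /W] := leP v t; first exact.
  by move=> /(_ v01 u01 t01); rewrite distrC (distrC v).
rewrite -!Z_cdf// !cdfE [X in _ <= X]ger0_norm ?subr_ge0//.
have sub : [set w | (Z 0%N w).2 <= v] `<=` [set w | (Z 0%N w).2 <= t].
  by move=> w /= /le_trans; apply.
have := Pr_increment (P := P) (measurable_Z2 v) (measurable_Z2 t) (measurable_Z1 u) sub.
rewrite (Z_v (wk v01)) (Z_v (wk t01)) ![_ `&` [set w | (Z 0%N w).1 <= u]]setIC => H.
rewrite ger0_norm// subr_ge0; apply: le_Pr; try exact: measurableI.
exact: setIS.
Qed.

Lemma copula_error_ae (b b' s2 D1 c1 g : R) (r : nat -> R) :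
  b < b' -> 0 <= b -> 0 < s2 -> 0 < D1 -> 0 < c1 -> 2 * s2 < D1 ^+ 2 ->
  4 * D1 < c1 ^+ 2 ->
  (forall x, 0 <= x <= 1 -> x <= b' -> x * (1 - x) <= s2) ->
  (\forall n \near \oo, 0 <= r n <= 1) -> g < b -> (\forall n \near \oo, r n <= g) ->
  {ae P, forall w, \forall n \near \oo, forall p, unit_square p ->
    `|local_emp_copula C (fun i => (Z i w).1) (fun i => (Z i w).2) n (r n) p
      - local_approx C (fun i => (Z i w).1) (fun i => (Z i w).2) n (r n) p| <=
    c1 * (Num.sqrt (Num.sqrt (iterlog 2 n%:R)) * Num.sqrt (iterlog 1 n%:R)
          / Num.sqrt (Num.sqrt n%:R))}.
Proof.
move=> bb' b0 s20 D10 c10 s2D Dc Hs2 r01 gb rg.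
have [L L0 [C_exp extu extv]] := C2_expansion C_C2 C_ext.
have Cu1 q : open_square q -> `|partial_u C q| <= 1.
  case: q => u v [/= u01 v01].
  apply: (slope_le1 (g := fun x => C (x, v)) L0 u01) => s s01.
    have [] := C_exp s v u v `|s - u| s01 v01 u01 v01 (lexx _) _ => //.
    by rewrite subrr normr0.
  exact: C_lip_u.
have Cv1 q : open_square q -> `|partial_v C q| <= 1.
  case: q => u v [/= u01 v01].
  apply: (slope_le1 (g := fun x => C (u, x)) L0 v01) => s s01.
    have [] := C_exp u s u v `|s - v| u01 s01 u01 v01 _ (lexx _) => //.
    by rewrite subrr normr0.
  exact: C_lip_v.
have [D2 [D3 [c2 [p [K0 [D20 D30 /andP[c20 c21] p4 alg]]]]]] :=
  osc_algebra D10 c10 Dc L0.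
pose t n : R := Num.sqrt (iterlog 1 n%:R).
pose l n : R := Num.sqrt (Num.sqrt (iterlog 2 n%:R)).
(* Eventually this is n^{1/4}; the exponential form gives 1 <= a n for every n, n = 0 included. *)
pose a n : R := expR (iterlog 1 n%:R / 4).
pose dl n : R := D2 * l n ^+ 2 / a n ^+ 2.
pose y n : R := c2 * (a n * l n * t n).
pose q n : R := a n ^+ 2 * l n ^+ 2 * D3 / 2.
pose N n := (Num.truncn (a n ^+ 3)).+1.
have ell1 n : 1 <= iterlog 1 n%:R :> R by exact: log1_ge1.
have LL1 n : 1 <= iterlog 2 n%:R :> R by exact: log1_ge1.
have ell0 n : 0 <= iterlog 1 n%:R :> R by exact: le_trans ler01 (ell1 n).
have LL0 n : 0 <= iterlog 2 n%:R :> R by exact: le_trans ler01 (LL1 n).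
have t2 n : t n ^+ 2 = iterlog 1 n%:R by rewrite sqr_sqrtr.
have l2 n : l n ^+ 2 = Num.sqrt (iterlog 2 n%:R) by rewrite sqr_sqrtr// sqrtr_ge0.
have l4 n : l n ^+ 4 = iterlog 2 n%:R.
  by rewrite (_ : 4 = 2 * 2)%N// exprM l2 sqr_sqrtr.
have a4 n : a n ^+ 4 = expR (iterlog 1 n%:R).
  by rewrite /a -expRM_natl; congr expR; field.
have t1 n : 1 <= t n by rewrite -sqrtr1 ler_wsqrtr.
have sLL1 n : 1 <= Num.sqrt (iterlog 2 n%:R) :> R by rewrite -[leLHS]sqrtr1 ler_wsqrtr.
have l1 n : 1 <= l n by rewrite -[leLHS]sqrtr1 ler_wsqrtr.
have a1 n : 1 <= a n by rewrite -expR0 ler_expR divr_ge0.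
have a0 n : 0 < a n by exact: expR_gt0.
have lt n : l n ^+ 4 <= t n ^+ 2 by rewrite l4 t2 iterlog2_le1.
have N1 n : a n ^+ 3 < (N n)%:R by exact: truncnS_gt.
have N2 n : (N n)%:R <= a n ^+ 3 + 1.
  by rewrite /N -natr1 lerD2r truncn_le exprn_ge0// ltW.
have a31 n : 1 <= a n ^+ 3 by rewrite exprn_ege1.
have a30 n : 0 < a n ^+ 3 by rewrite exprn_gt0.
have Ngt1 n : (1 < N n)%N by rewrite -(ltr_nat R) (le_lt_trans (a31 n)).
have Ngt0 n : (0 < N n)%N by rewrite ltnW.
have near_a K : \forall n \near \oo, K * t n ^+ 4 <= a n.
  have q4 : 0 < (4^-1 : R) by rewrite invr_gt0.
  apply: filterS (near_sqr_iterlog1_le K q4) => n.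
  by rewrite mulrC (_ : 4 = 2 * 2)%N// exprM t2 /a mulrC [in expR _]mulrC mulrC.
have near_n : \forall n \near \oo, (0 < n)%N /\ n%:R = a n ^+ 4.
  apply: filterS2 near_iterlog1E (near_natr_ge (1 : R)) => n E n1.
  have n0 : 0 < n%:R :> R := lt_le_trans ltr01 n1.
  by split; [rewrite -(ltr0n R)|rewrite a4 E lnK].
pose A n : set Omega := [set w | osc_event (Z := Z) C n (N n) (dl n) (y n) w \/
  (cells_event (Z := Z) fst n (N n) (a n) w \/ cells_event (Z := Z) snd n (N n) (a n) w)].
have mf : measurable_fun setT (fst : R * R -> R) by exact: measurable_fst.
have ms : measurable_fun setT (snd : R * R -> R) by exact: measurable_snd.
have mO n : measurable (osc_event (Z := Z) C n (N n) (dl n) (y n)).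
  exact: (measurable_osc_events Z_iid).
have mC1 n : measurable (cells_event (Z := Z) fst n (N n) (a n)).
  exact: (measurable_cells_event Z_iid).
have mC2 n : measurable (cells_event (Z := Z) snd n (N n) (a n)).
  exact: (measurable_cells_event Z_iid).
have mA n : measurable (A n) by apply: measurableU => //; exact: measurableU.
have nNa n : n%:R = a n ^+ 4 -> n%:R / (N n)%:R <= a n.
  move=> ->; rewrite ler_pdivrMr ?ltr0n// (_ : a n ^+ 4 = a n * a n ^+ 3); last by ring.
  by rewrite ler_pM2l// ltW.
(* N <= 2 a^3 turns N^4 into 16 n^3, so the quadruples contribute 32 n^{3-p}. Each of the two
   families of cells contributes at most 6 n times n^{2-p}, and 32 + 6 + 6 = 44. *)
pose u n : R := 44 * expR (- ((p - 3) * ln n%:R)).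
have near_PA : \forall n \near \oo, Pr P (A n) <= u n.
  apply: filterS2 (filterI near_n near_iterlog1E) (near_a K0) => n [[n_gt0 nE] ellE] Ka.
  have [E1 E2 E3 E4 [_ E6]] := alg _ _ _ (a1 n) (l1 n) (t1 n) (lt n) Ka.
  have q0 : 0 < q n by rewrite /q !mulr_gt0 ?exprn_gt0// (lt_le_trans ltr01).
  have PO : Pr P (osc_event (Z := Z) C n (N n) (dl n) (y n)) <=
      32 * expR (- ((p - 3) * ln n%:R)).
    have H := @Pr_osc_event _ _ _ P Z Z_iid C L Z_u Z_v Z_cdf C_exp Cu1 Cv1 n (N n)
      (dl n) (y n) (q n).
    rewrite nE in H.
    apply: (le_trans (H E1 q0 E2 E3)).
    apply: (@le_trans _ _ ((2 * a n ^+ 3) ^+ 4 * (2 * expR (- (p * t n ^+ 2))))).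
      apply: ler_pM; first by nneg.
      - by nneg.
      - have NN : (N n)%:R <= 2 * a n ^+ 3.
          by rewrite mulr_natl mulr2n (le_trans (N2 n))// lerD2l.
        apply: lerXn2r => //; first by rewrite nnegrE.
        by rewrite nnegrE (le_trans _ NN).
      - by rewrite ler_wpM2l// ler_expR lerN2.
    rewrite t2 ellE le_eqVlt; apply/orP; left; apply/eqP.
    have -> : (2 * a n ^+ 3) ^+ 4 = 16 * (a n ^+ 4) ^+ 3 by ring.
    rewrite a4 ellE -expRM_natl.
    have -> : 32 * expR (- ((p - 3) * ln n%:R)) =
      32 * expR (3 * ln n%:R - p * ln n%:R) by congr (_ * expR _); ring.
    by rewrite expRD; ring.
  have PC (h : R * R -> R) : measurable_fun setT h -> (forall i w, 0 <= h (Z i w)) ->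
      (forall x, 0 <= x <= 1 -> Pr P [set w | h (Z 0%N w) <= x] = x) ->
      Pr P (cells_event (Z := Z) h n (N n) (a n)) <= 6 * expR (- ((p - 3) * ln n%:R)).
    move=> mh h0 hlaw.
    apply: (le_trans (Pr_cells_event Z_iid mh h0 hlaw (Ngt0 n) (a0 n) (nNa n nE))).
    apply: (@le_trans _ _ (2 * (3 * a n ^+ 4) * expR (- ((p - 2) * ln n%:R)))).
      apply: ler_pM.
      - by nneg.
      - by nneg.
      - rewrite ler_wpM2l// -natr1.
        have : a n ^+ 3 <= a n ^+ 4 by rewrite ler_weXn2l.
        have := N2 n; have := a31 n; set x3 := a n ^+ 3; set x4 := a n ^+ 4.
        lra.
      - by rewrite ler_expR lerN2 -ellE -t2.
    rewrite a4 ellE le_eqVlt; apply/orP; left; apply/eqP.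
    have -> : 6 * expR (- ((p - 3) * ln n%:R)) =
      6 * expR (ln n%:R - (p - 2) * ln n%:R) by congr (_ * expR _); ring.
    by rewrite expRD; ring.
  have PC1 := PC fst mf (fun i w => proj1 (andP (Z1_01 i w))) Z_u.
  have PC2 := PC snd ms (fun i w => proj1 (andP (Z2_01 i w))) Z_v.
  have PCC : Pr P (cells_event (Z := Z) fst n (N n) (a n) `|`
      cells_event (Z := Z) snd n (N n) (a n)) <= 12 * expR (- ((p - 3) * ln n%:R)).
    apply: (le_trans (Pr_cover2 _ (mC1 n) (mC2 n) (@subset_refl _ _))).
      exact: measurableU.
    apply: (le_trans (lerD PC1 PC2)).
    by rewrite -mulrDl ler_wpM2r ?expR_ge0// -natrD.
  apply: (le_trans (Pr_cover2 (mA n) (mO n) (measurableU _ _ (mC1 n) (mC2 n))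
    (@subset_refl _ _))).
  apply: (le_trans (lerD PO PCC)).
  by rewrite /u -mulrDl ler_wpM2r ?expR_ge0// -natrD.
have u0 n : 0 <= u n by rewrite /u; nneg.
have p31 : 1 < p - 3 by lra.
have uC n : \sum_(k < n) u k <= 44 * (2 + (p - 3 - 1)^-1).
  by rewrite -mulr_sumr ler_wpM2l// pseries_bounded.
have AE := borel_cantelli_ae mA u0 uC near_PA.
have S1 := smirnov Z_iid mf (fun i w => proj1 (andP (Z1_01 i w))) Z_u bb' s20 D10 s2D Hs2.
have S2 := smirnov Z_iid ms (fun i w => proj1 (andP (Z2_01 i w))) Z_v bb' s20 D10 s2D Hs2.
apply: filterS3 AE S1 S2 => w wA w1 w2.
have gb0 : 0 < b - g by rewrite subr_gt0.
have c210 : 0 < c1 - c2 by rewrite subr_gt0.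
(* The rounding terms (10 + 2 L) rho + 4 L n / N of the error bound, for rho = 2 a and n / N <= a,
   are at most K' a. The gap (c1 - c2) t dominates K' because t tends to infinity. *)
pose K' := 20 + 8 * L.
have near_t : \forall n \near \oo, K' / (c1 - c2) <= t n.
  apply: filterS (near_iterlog1_ge ((K' / (c1 - c2)) ^+ 2)) => n Hn.
  rewrite -[leLHS]ger0_norm; last by rewrite divr_ge0 ?(ltW c210)// /K'; nneg.
  by rewrite -sqrtr_sqr ler_wsqrtr.
near=> n.
have [n_gt0 nE] : (0 < n)%N /\ n%:R = a n ^+ 4 by near: n; exact: near_n.
have Ka : K0 * t n ^+ 4 <= a n by near: n; exact: near_a.
have Kb : D1 / (b - g) * t n ^+ 4 <= a n by near: n; exact: near_a.
have Kt : K' / (c1 - c2) <= t n by near: n; exact: near_t.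
have nA : ~ A n w by near: n; exact: wA.
have rn : 0 <= r n <= 1 by near: n.
have rng : r n <= g by near: n.
have d1 : forall x, 0 <= x <= 1 -> x <= b ->
    `|\sum_(i < n) ((Z i w).1 <= x)%R%:R - n%:R * x| <=
    D1 * Num.sqrt (n%:R * iterlog 2 n%:R) by near: n.
have d2 : forall x, 0 <= x <= 1 -> x <= b ->
    `|\sum_(i < n) ((Z i w).2 <= x)%R%:R - n%:R * x| <=
    D1 * Num.sqrt (n%:R * iterlog 2 n%:R) by near: n.
have [_ _ _ _ [E5 _]] := alg _ _ _ (a1 n) (l1 n) (t1 n) (lt n) Ka.
have sqn : Num.sqrt n%:R = a n ^+ 2.
  by rewrite nE (_ : 4 = 2 * 2)%N// exprM sqrtr_sqr ger0_norm// sqr_ge0.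
have sqqn : Num.sqrt (Num.sqrt n%:R) = a n.
  by rewrite sqn sqrtr_sqr ger0_norm// ltW.
have EE : Num.sqrt (n%:R * iterlog 2 n%:R) = a n ^+ 2 * l n ^+ 2.
  by rewrite sqrtrM// sqn l2.
rewrite EE in d1 d2; rewrite sqqn -/(l n) -/(t n).
have n0 : 0 < n%:R :> R by rewrite ltr0n.
have nO : ~ osc_event (Z := Z) C n (N n) (dl n) (y n) w by move=> H; apply: nA; left.
have nC1 : ~ cells_event (Z := Z) fst n (N n) (a n) w by move=> H; apply: nA; right; left.
have nC2 : ~ cells_event (Z := Z) snd n (N n) (a n) w by move=> H; apply: nA; right; right.
have [c10' c1j] := not_cells_event (fun i => proj1 (andP (Z1_01 i w))) (Ngt0 n)
  (nNa n nE) (a0 n) nC1.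
have [c20' c2j] := not_cells_event (fun i => proj1 (andP (Z2_01 i w))) (Ngt0 n)
  (nNa n nE) (a0 n) nC2.
have slack : b < 1 -> n%:R * r n + D1 * (a n ^+ 2 * l n ^+ 2) <= n%:R * b.
  move=> _; have H : D1 * l n ^+ 2 <= (b - g) * a n ^+ 2.
    have : D1 * t n ^+ 4 <= (b - g) * a n.
      by move: Kb; rewrite mulrAC ler_pdivrMr// [a n * _]mulrC.
    have l2t4 : l n ^+ 2 <= t n ^+ 4.
      rewrite (@le_trans _ _ (l n ^+ 4))// ?ler_weXn2l//.
      by rewrite (le_trans (lt n))// ler_weXn2l.
    move=> H; apply: (@le_trans _ _ (D1 * t n ^+ 4)); first by rewrite ler_pM2l.
    by apply: (le_trans H); rewrite ler_pM2l// ler_eXnr.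
  have : n%:R * r n <= n%:R * g by rewrite ler_pM2l.
  have := ler_wpM2l (sqr_ge0 (a n)) H.
  rewrite nE (_ : a n ^+ 2 * ((b - g) * a n ^+ 2) = a n ^+ 4 * b - a n ^+ 4 * g); last by ring.
  rewrite (_ : a n ^+ 2 * (D1 * l n ^+ 2) = D1 * (a n ^+ 2 * l n ^+ 2)); last by ring.
  set x1 := D1 * _; set x2 := a n ^+ 4 * b; set x3 := a n ^+ 4 * g; set x4 := a n ^+ 4 * r n.
  lra.
have dlE : (D1 * (a n ^+ 2 * l n ^+ 2) + 2 * a n) / n%:R + 2 / (N n)%:R <= dl n.
  rewrite nE; apply: le_trans E5; rewrite lerD2l ler_pM2l// lef_pV2 ?posrE ?ltr0n//.
  exact: ltW.
have G i j k m : (0 < i < N n)%N -> (0 < j < N n)%N -> (0 < k < N n)%N -> (0 < m < N n)%N ->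
  `|i%:R / (N n)%:R - k%:R / (N n)%:R| <= dl n ->
  `|j%:R / (N n)%:R - m%:R / (N n)%:R| <= dl n ->
  `|\sum_(x < n) osc (i%:R / (N n)%:R) (j%:R / (N n)%:R) (k%:R / (N n)%:R) (m%:R / (N n)%:R)
     (partial_u C (k%:R / (N n)%:R, m%:R / (N n)%:R))
     (partial_v C (k%:R / (N n)%:R, m%:R / (N n)%:R)) ((Z x w).1, (Z x w).2)| <= y n.
  move=> /andP[i0 iN] /andP[j0 jN] /andP[k0 kN] /andP[m0 mN] ik jm.
  rewrite leNgt; apply/negP => H; apply: nO.
  exists ((Ordinal iN, Ordinal jN), (Ordinal kN, Ordinal mN)); rewrite /grid_osc_hit /=.
  rewrite i0 j0 k0 m0 ik jm /=; exact: (ltW H).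
move=> z Uz.
have := copula_error_bound n_gt0 (Ngt1 n) (fun i => Z1_01 i w) (fun i => Z2_01 i w)
  c10' c20' c1j c2j L0 extu extv Cu1 Cv1 rn b0 d1 d2 slack dlE G Uz.
move=> /le_trans; apply.
have ltK : K' <= (c1 - c2) * (l n * t n).
  move: Kt; rewrite ler_pdivrMr// => /le_trans; apply.
  rewrite mulrC ler_pM2l// ler_peMl// (le_trans ler01)//.
rewrite sqn nE.
apply: (@le_trans _ _ (a n ^+ 2 / a n ^+ 4 *
   (y n + (10 + 2 * L) * (2 * a n) + 4 * L * a n))).
  apply: ler_wpM2l; first by rewrite divr_ge0 ?exprn_ge0 ?ltW.
  by rewrite lerD2l ler_wpM2l ?mulr_ge0// -nE nNa.
have -> : a n ^+ 2 / a n ^+ 4 * (y n + (10 + 2 * L) * (2 * a n) + 4 * L * a n) =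
   (c2 * (l n * t n) + K') / a n.
  by rewrite /y /K'; field; rewrite gt_eqF.
rewrite [leRHS]mulrA ler_pM2r ?invr_gt0//.
move: ltK; rewrite mulrBl; set x1 := c1 * _; set x2 := c2 * _; lra.
Unshelve. all: by end_near.
Qed.

End AlmostSureError.

(** * Transfer to the copula *)

Section ContinuousDistribution.
Context {d : measure_display} {Omega : measurableType d} {R : realType}.
Context {P : probability Omega R}.
Variable X : {RV P >-> R}.
Hypothesis G_cont : continuous (distr_fun X).
Local Notation G := (distr_fun X).

Lemma distr_funE x : G x = Pr P [set w | X w <= x].
Proof.
rewrite /distr_fun /cdf /distribution /pushforward /Pr; congr (fine (P _)).
Qed.

Lemma measurable_RV_le x : measurable [set w | X w <= x].
Proof.
have := measurable_funP X measurableT _ (measurable_itv `]-oo, x]).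
by rewrite setTI; congr measurable; apply/seteqP; split => w /=; rewrite in_itv.
Qed.

Lemma distr_fun_homo : {homo G : x y / x <= y}.
Proof.
move=> x y xy; rewrite !distr_funE; apply: le_Pr; try exact: measurable_RV_le.
by move=> w /= /le_trans; apply.
Qed.

Lemma distr_fun01 x : 0 <= G x <= 1.
Proof.
rewrite distr_funE Pr_ge0 -(Pr_setT P); apply: le_Pr => //.
exact: measurable_RV_le.
Qed.

Lemma distr_fun_attained u : 0 < u < 1 -> exists x, G x = u.
Proof.
move=> /andP[u0 u1].
have Gy : G x @[x --> +oo] --> (1 : R) by apply: fine_cvg; exact: cvg_cdfy1.
have GNy : G x @[x --> -oo] --> (0 : R) by apply: fine_cvg; exact: cvg_cdfNy0.
have [b ub] : exists b, u < G b by apply: (@filter_ex _ (pinfty_nbhs R)); exact: (cvgr_gt 1 Gy u u1).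
have [a au] : exists a, G a < u by apply: (@filter_ex _ (ninfty_nbhs R)); exact: (cvgr_lt 0 GNy u u0).
have ab : a <= b.
  by rewrite leNgt; apply/negP => /ltW /distr_fun_homo; rewrite leNgt (lt_trans au).
have [||c _ <-] := @IVT R G a b u ab.
- exact: continuous_subspaceT.
- by rewrite ge_min (ltW au) /= le_max (ltW ub) orbT.
- by exists c.
Qed.

Lemma measurable_distr_fun : measurable_fun setT G.
Proof. exact: measurable_realfun.continuous_measurable_fun. Qed.

Lemma measurable_distr_le u : measurable [set w | G (X w) <= u].
Proof.
have mG : measurable_fun setT G by exact: measurable_distr_fun.
have := measurableT_comp mG (measurable_funP X) measurableT (measurable_itv `]-oo, u]).
by rewrite setTI; congr measurable; apply/seteqP; split => w /=; rewrite in_itv.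
Qed.

(** Where G is flat, G(X) <= u may be a larger event than X <= x with G x = u. The upper bound
    therefore goes through attained levels above u that decrease to u. *)
Lemma Pr_distr_le u : 0 <= u <= 1 -> Pr P [set w | G (X w) <= u] = u.
Proof.
have upper v v' : v < v' -> 0 < v' < 1 -> Pr P [set w | G (X w) <= v] <= v'.
  move=> vv' /distr_fun_attained [x xv'].
  rewrite -xv' distr_funE; apply: le_Pr => [||w /= Gw].
  - exact: measurable_distr_le.
  - exact: measurable_RV_le.
  rewrite leNgt; apply/negP => /ltW /distr_fun_homo; rewrite xv' leNgt.
  by rewrite (le_lt_trans Gw).
move=> /andP[u0 u1]; apply/eqP; rewrite eq_le; apply/andP; split.
  have [u1'|u1'] := ltP u 1; last first.
    apply: (le_trans _ u1'); rewrite -(Pr_setT P); apply: le_Pr => //.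
    exact: measurable_distr_le.
  apply/ler_addgt0Pr => e e0.
  pose v := Num.min (u + e) ((u + 1) / 2).
  have uv : u < v by rewrite lt_min; apply/andP; split; lra.
  apply: (@le_trans _ _ v); last by rewrite ge_min lexx.
  apply: (upper _ _ uv); rewrite (le_lt_trans u0 uv) /=.
  by rewrite gt_min; apply/orP; right; lra.
have [u0'|u0'] := ltP 0 u; last by rewrite (le_trans u0') ?Pr_ge0.
have [u1'|u1'] := ltP u 1; last first.
  rewrite (le_trans u1)// -(Pr_setT P); apply: le_Pr => //.
    exact: measurable_distr_le.
  by move=> w _ /=; apply: le_trans u1'; case/andP: (distr_fun01 (X w)).
have [|x xu] := @distr_fun_attained u; first by rewrite u0'.
rewrite -{1}xu distr_funE; apply: le_Pr.
- exact: measurable_RV_le.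
- exact: measurable_distr_le.
- by move=> w /= /distr_fun_homo; rewrite xu.
Qed.

Lemma quantile_attained u : 0 < u < 1 ->
  exists2 q, quantile X u = q%:E & G q = u.
Proof.
move=> /andP[u0 u1].
pose S := [set x : R | u <= G x].
have [|x0 x0u] := @distr_fun_attained u; first by rewrite u0.
have S0 : S !=set0 by exists x0; rewrite /S /= x0u.
have lbS x1 : G x1 < u -> lbound S x1.
  move=> x1u y /= uy; rewrite leNgt; apply/negP => /ltW /distr_fun_homo.
  by rewrite leNgt (lt_le_trans x1u).
have [|x1 x1u] := @distr_fun_attained (u / 2); first by apply/andP; split; lra.
have lb : has_lbound S by exists x1; apply: lbS; rewrite x1u; lra.
exists (inf S); first exact: ereal_inf_EFin.
apply/eqP; rewrite eq_le; apply/andP; split.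
  by rewrite -x0u; apply: distr_fun_homo; apply: ge_inf => //; rewrite /S /= x0u.
apply/ler_addgt0Pr => e e0.
pose v := Num.max (u - e) (u / 2).
have vu : v < u by rewrite gt_max; apply/andP; split; lra.
have [|x2 x2v] := @distr_fun_attained v.
  by rewrite lt_max (lt_trans vu u1) andbT; apply/orP; right; lra.
rewrite -lerBlDr; apply: (@le_trans _ _ v); first by rewrite le_max lexx.
rewrite -x2v; apply: distr_fun_homo; apply: lb_le_inf => //.
by apply: lbS; rewrite x2v.
Qed.

End ContinuousDistribution.

Section Copula.
Context {d : measure_display} {Omega : measurableType d} {R : realType}.
Context {P : probability Omega R}.
Variables X Y : {RV P >-> R}.
Hypothesis G_cont : continuous (distr_fun X).
Hypothesis H_cont : continuous (distr_fun Y).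

(** X <= q implies G(X) <= s, and both events have probability s; likewise for Y. Exchanging them
    one after the other leaves the joint probability unchanged, even if G or H has flat pieces. *)
Lemma copulaE s t : 0 < s < 1 -> 0 < t < 1 ->
  copula X Y (s, t) =
  Pr P [set w | distr_fun X (X w) <= s /\ distr_fun Y (Y w) <= t].
Proof.
move=> s01 t01.
have [q qE Gq] := quantile_attained G_cont s01.
have [r rE Hr] := quantile_attained H_cont t01.
rewrite /copula /joint_distr_fun /= qE rE -/(Pr P _).
rewrite (_ : [set w | _] = [set w | X w <= q] `&` [set w | Y w <= r]); last first.
  by apply/seteqP; split => w /=; rewrite !lee_fin.
have wk (x : R) : 0 < x < 1 -> 0 <= x <= 1 by move=> /andP[? ?]; rewrite !ltW.
have mX := measurable_RV_le X q; have mY := measurable_RV_le Y r.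
have mGX := measurable_distr_le G_cont s; have mHY := measurable_distr_le H_cont t.
have subX : [set w | X w <= q] `<=` [set w | distr_fun X (X w) <= s].
  by move=> w /= Xq; rewrite -Gq; exact: distr_fun_homo.
have subY : [set w | Y w <= r] `<=` [set w | distr_fun Y (Y w) <= t].
  by move=> w /= Yr; rewrite -Hr; exact: distr_fun_homo.
have PA : Pr P [set w | X w <= q] = s by rewrite -distr_funE Gq.
have PB : Pr P [set w | Y w <= r] = t by rewrite -distr_funE Hr.
have PGA : Pr P [set w | distr_fun X (X w) <= s] = s by apply: Pr_distr_le => //; exact: wk.
have PHB : Pr P [set w | distr_fun Y (Y w) <= t] = t by apply: Pr_distr_le => //; exact: wk.
have h1 : Pr P ([set w | distr_fun X (X w) <= s] `&` [set w | Y w <= r]) <=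
    Pr P ([set w | X w <= q] `&` [set w | Y w <= r]).
  rewrite -subr_le0 [leRHS](_ : 0 =
    Pr P [set w | distr_fun X (X w) <= s] - Pr P [set w | X w <= q]).
    exact: (Pr_increment mX mGX mY subX).
  by rewrite PGA PA subrr.
have h2 : Pr P ([set w | distr_fun Y (Y w) <= t] `&` [set w | distr_fun X (X w) <= s]) <=
    Pr P ([set w | Y w <= r] `&` [set w | distr_fun X (X w) <= s]).
  rewrite -subr_le0 [leRHS](_ : 0 =
    Pr P [set w | distr_fun Y (Y w) <= t] - Pr P [set w | Y w <= r]).
    exact: (Pr_increment mY mHY mGX subY).
  by rewrite PHB PB subrr.
apply/eqP; rewrite eq_le; apply/andP; split.
  apply: le_Pr; try exact: measurableI.
  by move=> w [/subX ? /subY ?].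
apply: (@le_trans _ _ (Pr P ([set w | distr_fun Y (Y w) <= t] `&`
    [set w | distr_fun X (X w) <= s]))); first by rewrite setIC.
by apply: (le_trans h2); rewrite setIC; exact: h1.
Qed.

End Copula.

(** * Normalization and passage to the upper limit *)

Section QuarterPowers.
Context {R : realType}.

Lemma powR_quarter (x : R) : 0 <= x -> x `^ 4^-1 = Num.sqrt (Num.sqrt x).
Proof.
move=> x0; rewrite -(powR12_sqrt (sqrtr_ge0 x)) -(powR12_sqrt x0) -powRrM; congr (_ `^ _).
by field.
Qed.

(** The logarithms cancel and n^{1/4} k^{-1/4} is left. Since k >= gamma n, it is at most
    gamma^{-1/4}, a factor present in the bounds of both cases. *)
Lemma rate_bound (k gamma n L LL : R) : 0 < gamma -> 0 < n -> 0 < L -> 0 < LL ->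
  gamma * n <= k ->
  Num.sqrt n * k `^ (- 4^-1) * LL `^ (- 4^-1) * L `^ (- 2^-1) *
  (Num.sqrt (Num.sqrt LL) * Num.sqrt L / Num.sqrt (Num.sqrt n)) <= gamma `^ (- 4^-1).
Proof.
move=> g0 n0 L0 LL0 gk.
have gn0 : 0 < gamma * n by rewrite mulr_gt0.
have k0 : 0 < k by exact: lt_le_trans gk.
have qn : Num.sqrt (Num.sqrt n) != 0 by rewrite gt_eqF// !sqrtr_gt0.
have qLL : Num.sqrt (Num.sqrt LL) != 0 by rewrite gt_eqF// !sqrtr_gt0.
have sL : Num.sqrt L != 0 by rewrite gt_eqF// !sqrtr_gt0.
have nE : Num.sqrt n = Num.sqrt (Num.sqrt n) ^+ 2 by rewrite sqr_sqrtr ?sqrtr_ge0.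
rewrite !powRN (powR_quarter (ltW LL0)) (powR12_sqrt (ltW L0)).
have -> : Num.sqrt n * (k `^ 4^-1)^-1 * (Num.sqrt (Num.sqrt LL))^-1 * (Num.sqrt L)^-1 *
  (Num.sqrt (Num.sqrt LL) * Num.sqrt L / Num.sqrt (Num.sqrt n)) =
  Num.sqrt (Num.sqrt n) * (k `^ 4^-1)^-1.
  rewrite {1}nE; field; rewrite qn qLL sL /= gt_eqF// powR_gt0//.
have gq : 0 < gamma `^ 4^-1 by rewrite powR_gt0.
have kq : 0 < k `^ 4^-1 by rewrite powR_gt0.
rewrite ler_pdivrMr// [leRHS]mulrC ler_pdivlMr// -(powR_quarter (ltW n0)).
rewrite -(powRM _ (ltW n0) (ltW g0)); apply: ge0_ler_powR => //.
- by rewrite nnegrE ltW// mulr_gt0.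
- by rewrite nnegrE ltW.
- by rewrite mulrC.
Qed.

End QuarterPowers.

Lemma limn_esup_le_near (R : realType) (u : nat -> \bar R) (c : \bar R) :
  (\forall n \near \oo, (u n <= c)%E) -> (limn_esup u <= c)%E.
Proof.
move=> uc; rewrite /limn_esup limf_esupE.
apply: (@le_trans _ _ (ereal_sup [set u n | n in [set n | (u n <= c)%E]])).
  by apply: ereal_inf_lbound; exists [set n | (u n <= c)%E].
by apply: ge_ereal_sup => _ [n nc <-].
Qed.

Section Main.
Context {d : measure_display} {Omega : measurableType d} {R : realType}.
Context {P : probability Omega R}.
Variables (X Y : {RV P >-> R}) (Xs Ys : nat -> {RV P >-> R}).
Hypothesis copies : independent_copies X Y Xs Ys.
Hypothesis G_cont : continuous (distr_fun X).
Hypothesis H_cont : continuous (distr_fun Y).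

Definition uniformized (i : nat) (w : Omega) : R * R :=
  (distr_fun X (Xs i w), distr_fun Y (Ys i w)).

Let unif (z : R * R) : R * R := (distr_fun X z.1, distr_fun Y z.2).

Let measurable_unif : measurable_fun setT unif.
Proof.
apply: measurable_fun_pair; apply: measurableT_comp.
- exact: measurable_distr_fun.
- exact: measurable_fst.
- exact: measurable_distr_fun.
- exact: measurable_snd.
Qed.

Let measurable_unif_pre (B : set (R * R)) : measurable B -> measurable (unif @^-1` B).
Proof. by move=> mB; rewrite -[_ @^-1` _]setTI; apply: measurable_unif. Qed.

Let uniformized_law i (B : set (R * R)) : measurable B ->
  P (uniformized i @^-1` B) = P [set w | B (unif (X w, Y w))].
Proof.
by move=> mB; exact: (copies.2 i (unif @^-1` B) (measurable_unif_pre mB)).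
Qed.

Lemma uniformized_iid : iid_sample P uniformized.
Proof.
split => [i|m B mB].
  apply: measurable_fun_pair.
    by apply: measurableT_comp; [exact: measurable_distr_fun|exact: measurable_funP].
  by apply: measurableT_comp; [exact: measurable_distr_fun|exact: measurable_funP].
have := copies.1 (iota 0 m) (fun i => unif @^-1` B i) (iota_uniq 0 m)
  (fun i => measurable_unif_pre (mB i)).
rewrite (_ : [set` iota 0 m] = `I_m); last first.
  by apply/seteqP; split => i /=; rewrite mem_iota.
move=> E; apply: (etrans E).
rewrite -(big_mkord xpredT (fun i => P (uniformized 0 @^-1` B i))) /index_iota subn0.
apply: eq_bigr => i _.
by rewrite (uniformized_law 0 (mB i)) -(uniformized_law i (mB i)).
Qed.

Lemma uniformized_fst_law u : 0 <= u <= 1 ->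
  Pr P [set w | (uniformized 0 w).1 <= u] = u.
Proof.
move=> u01; rewrite -[RHS](Pr_distr_le G_cont u01) /Pr; congr fine.
have mB : measurable [set z : R * R | z.1 <= u].
  have mf : measurable_fun setT (fst : R * R -> R) := measurable_fst.
  have := mf measurableT _ (measurable_itv `]-oo, u]).
  by rewrite setTI; congr measurable; apply/seteqP; split => z /=; rewrite in_itv.
exact: (uniformized_law 0 mB).
Qed.

Lemma uniformized_snd_law u : 0 <= u <= 1 ->
  Pr P [set w | (uniformized 0 w).2 <= u] = u.
Proof.
move=> u01; rewrite -[RHS](Pr_distr_le H_cont u01) /Pr; congr fine.
have mB : measurable [set z : R * R | z.2 <= u].
  have ms : measurable_fun setT (snd : R * R -> R) := measurable_snd.
  have := ms measurableT _ (measurable_itv `]-oo, u]).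
  by rewrite setTI; congr measurable; apply/seteqP; split => z /=; rewrite in_itv.
exact: (uniformized_law 0 mB).
Qed.

Lemma uniformized_cdf s t : 0 < s < 1 -> 0 < t < 1 ->
  sample_cdf (P := P) (Z := uniformized) s t = copula X Y (s, t).
Proof.
move=> s01 t01; rewrite copulaE// /sample_cdf /Pr; congr fine.
have mB : measurable [set z : R * R | z.1 <= s /\ z.2 <= t].
  have mf : measurable_fun setT (fst : R * R -> R) := measurable_fst.
  have ms : measurable_fun setT (snd : R * R -> R) := measurable_snd.
  have -> : [set z : R * R | z.1 <= s /\ z.2 <= t] =
      ([set: R * R] `&` fst @^-1` [set` `]-oo, s]]) `&`
      ([set: R * R] `&` snd @^-1` [set` `]-oo, t]]).
    apply/seteqP; split => z /=; rewrite !in_itv /=; first by move=> [? ?].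
    by move=> [[_ ?] [_ ?]].
  apply: measurableI; first by apply: mf => //; exact: measurable_itv.
  by apply: ms => //; exact: measurable_itv.
exact: (uniformized_law 0 mB).
Qed.

End Main.

Section RateBound.
Context {d : measure_display} {Omega : measurableType d} {R : realType}.
Context {P : probability Omega R}.
Variables (X Y : {RV P >-> R}) (Xs Ys : nat -> {RV P >-> R}).
Variables (k : nat -> R) (gamma v c : R).
Hypothesis copies : independent_copies X Y Xs Ys.
Hypothesis G_cont : continuous (distr_fun X).
Hypothesis H_cont : continuous (distr_fun Y).
Hypothesis C_C2 : C2_on open_square (copula X Y).
Hypothesis C_ext : second_partials_continuous (copula X Y).
Hypothesis k_gt0 : forall n, (0 < n)%N -> 0 < k n.
Hypothesis k_le : forall n, (1 < n)%N -> k n <= n%:R.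
Hypothesis k_ratio_nonincr : forall m n, (1 < m <= n)%N ->
  k n / n%:R <= k m / m%:R.
Hypothesis k_ratio_cvg : k n / n%:R @[n --> \oo] --> gamma.
Hypothesis gamma_gt0 : 0 < gamma.
Hypothesis v_gt0 : 0 < v.
Hypothesis c_gt0 : 0 < c.
Hypothesis cE : c ^+ 4 = 81 / 2 * v.
Hypothesis var_le : forall x e, 0 <= x <= 1 -> 0 <= e -> x <= gamma + e ->
  x * (1 - x) <= v + e.

Lemma limn_esup_rate_error :
  {ae P, forall w, (limn_esup (fun n => (rate k n)%:E *
    sup_norm (fun p =>
      local_emp_copula (copula X Y) (fun i => distr_fun X (Xs i w))
        (fun i => distr_fun Y (Ys i w)) n (k n / n%:R) p
      - local_approx (copula X Y) (fun i => distr_fun X (Xs i w))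
        (fun i => distr_fun Y (Ys i w)) n (k n / n%:R) p)%R) <=
    (c * gamma `^ (- 4^-1))%:E)%E}.
Proof.
have v0 : 0 < v := v_gt0.
(* [smirnov] with s2 = 6 v / 5 requires D1^2 > 12 v / 5, and 4 D1 < c^2 requires D1^2 < 81 v / 32;
   the value 5 v / 2 lies between the two. *)
pose D1 := Num.sqrt (5 / 2 * v).
have D12 : D1 ^+ 2 = 5 / 2 * v by rewrite sqr_sqrtr// mulr_ge0// ltW.
have D10 : 0 < D1 by rewrite sqrtr_gt0 mulr_gt0.
have Dc : 4 * D1 < c ^+ 2.
  rewrite -(@ltr_pXn2r _ 2)// ?nnegrE ?sqr_ge0//; last by rewrite mulr_ge0// ltW.
  have -> : (4 * D1) ^+ 2 = 40 * v by rewrite exprMn D12; field.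
  have -> : (c ^+ 2) ^+ 2 = 81 / 2 * v by rewrite -cE; ring.
  lra.
pose ratio n := k n / n%:R.
have lo n : (1 < n)%N -> gamma <= ratio n.
  move=> n1; apply: (cvgr_to_le k_ratio_cvg); exists n => // m /= nm.
  by apply: k_ratio_nonincr; rewrite n1.
have hi : \forall n \near \oo, ratio n <= gamma + v / 20.
  have : gamma < gamma + v / 20 by rewrite ltrDl divr_gt0.
  by move=> /(cvgr_lt gamma k_ratio_cvg); apply: filterS => n /ltW.
have n_gt1 : \forall n \near \oo, (1 < n)%N by exists 2%N.
have r01 : \forall n \near \oo, 0 <= ratio n <= 1.
  apply: filterS n_gt1 => n n1; have n0 : 0 < n%:R :> R by rewrite ltr0n ltnW.
  apply/andP; split; first by rewrite divr_ge0// ltW// k_gt0// ltnW.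
  by rewrite ler_pdivrMr// mul1r k_le.
(* Three margins above gamma: k_n / n is eventually at most gamma + v / 20, the empirical quantiles
   stay below gamma + v / 10, and the variance bound is available up to gamma + v / 5. *)
have v10 : gamma + v / 10 < gamma + v / 5 by lra.
have v20 : gamma + v / 20 < gamma + v / 10 by lra.
have := copula_error_ae (uniformized_iid copies G_cont H_cont)
  (fun i w => distr_fun01 X (Xs i w)) (fun i w => distr_fun01 Y (Ys i w))
  (uniformized_fst_law copies G_cont H_cont) (uniformized_snd_law copies G_cont H_cont)
  (uniformized_cdf copies G_cont H_cont) C_C2 C_ext
  (b := gamma + v / 10) (b' := gamma + v / 5) (s2 := v + v / 5) (D1 := D1) (c1 := c)
  (g := gamma + v / 20) (r := ratio).
move=> /(_ v10) H.
have {}H := H (addr_ge0 (ltW gamma_gt0) (divr_ge0 (ltW v_gt0) (ler0n _ 10))).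
have {}H := H (addr_gt0 v_gt0 (divr_gt0 v_gt0 (ltr0n _ 5))) D10 c_gt0.
have s2D : 2 * (v + v / 5) < D1 ^+ 2 by rewrite D12; lra.
have var x : 0 <= x <= 1 -> x <= gamma + v / 5 -> x * (1 - x) <= v + v / 5.
  by move=> x01; apply: var_le => //; rewrite divr_ge0// ltW.
have {}H := H s2D Dc var r01 v20 hi.
apply: filterS H => w Hw; apply: limn_esup_le_near.
apply: filterS2 n_gt1 Hw => n n1 Hn.
have n0 : 0 < n%:R :> R by rewrite ltr0n ltnW.
have L0 : 0 < iterlog 1 n%:R :> R := lt_le_trans ltr01 (log1_ge1 _).
have LL0 : 0 < iterlog 2 n%:R :> R := lt_le_trans ltr01 (log1_ge1 _).
have rate0 : 0 <= rate k n by rewrite /rate; nneg.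
set x := c * _ in Hn.
apply: (@le_trans _ _ ((rate k n)%:E * x%:E)%E).
  apply: lee_wpmul2l; first by rewrite lee_fin.
  by apply: ge_ereal_sup => _ [p Up <-]; rewrite lee_fin Hn.
rewrite -EFinM lee_fin /x mulrCA ler_pM2l//.
apply: rate_bound => //.
by have := lo _ n1; rewrite /ratio ler_pdivlMr.
Qed.

End RateBound.

Theorem theorem2p4 (d : measure_display) (Omega : measurableType d)
  (R : realType) (P : probability Omega R)
  (X Y : {RV P >-> R}) (Xs Ys : nat -> {RV P >-> R})
  (k : nat -> R) (gamma : R)
  (copies : independent_copies X Y Xs Ys)
  (G_cont : continuous (distr_fun X))
  (H_cont : continuous (distr_fun Y))
  (C_C2 : C2_on open_square (copula X Y))
  (C_ext : second_partials_continuous (copula X Y))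
  (k_gt0 : forall n, (0 < n)%N -> 0 < k n)
  (k_le : forall n, (1 < n)%N -> k n <= n%:R)
  (k_nondecr : forall m n, (1 < m <= n)%N -> k m <= k n)
  (k_ratio_nonincr : forall m n, (1 < m <= n)%N ->
     k n / n%:R <= k m / m%:R)
  (k_ratio_cvg : k n / n%:R @[n --> \oo] --> gamma)
  (gamma_ge0 : 0 <= gamma)
  (gamma_le1 : gamma <= 1)
  (k_loglog : k n / iterlog 2 n%:R @[n --> \oo] --> +oo) :
  let C := copula X Y in
  let U (w : Omega) (i : nat) : R := distr_fun X (Xs i w) in
  let V (w : Omega) (i : nat) : R := distr_fun Y (Ys i w) in
  let error (w : Omega) (n : nat) : \bar R :=
    sup_norm (fun p => local_emp_copula C (U w) (V w) n (k n / n%:R) p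
                       - local_approx C (U w) (V w) n (k n / n%:R) p) in
  (0 < gamma <= 2^-1 ->
   {ae P, forall w,
     (limn_esup (fun n => (rate k n)%:E * error w n) <=
      ((3 * 2 `^ (- 4^-1) + gamma * 2 `^ (5 / 4))
       * (1 - gamma) `^ 4^-1)%:E)%E}) /\
  (2^-1 < gamma <= 1 ->
   {ae P, forall w,
     (limn_esup (fun n => (rate k n)%:E * error w n) <=
      ((3 * 2 `^ (- (3 / 4)) + gamma * 2 `^ (3 / 4))
       * gamma `^ (- 4^-1))%:E)%E}).
Proof.
move=> C U V error.
have quart4 (x : R) : 0 <= x -> (x `^ 4^-1) ^+ 4 = x.
  by move=> x0; rewrite -powR_mulrn ?powR_ge0// -powRrM mulVf// powRr1.
split=> /andP[g0 g1].
- have g1' : 0 < 1 - gamma by lra.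
  (* Chosen so that c gamma^{-1/4} is exactly the first summand of the bound times (1 -
     gamma)^{1/4}; the other summand is nonnegative. *)
  pose c : R := 3 * 2 `^ (- 4^-1) * (gamma * (1 - gamma)) `^ 4^-1.
  have v0 : 0 < gamma * (1 - gamma) by rewrite mulr_gt0.
  have c0 : 0 < c by rewrite !mulr_gt0// powR_gt0.
  have cE : c ^+ 4 = 81 / 2 * (gamma * (1 - gamma)).
    rewrite /c powRN !exprMn exprVn !quart4//; last exact: ltW.
    by field.
  (* On [0, gamma] with gamma <= 1/2 the function x (1 - x) is increasing, and beyond gamma its
     slope is at most 1. *)
  have var x e : 0 <= x <= 1 -> 0 <= e -> x <= gamma + e ->
      x * (1 - x) <= gamma * (1 - gamma) + e.
    move=> /andP[x0 x1] e0 xe; have [xg|gx] := leP x gamma.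
      have : 0 <= (gamma - x) * (1 - gamma - x) by rewrite mulr_ge0//; lra.
      lra.
    have : 0 <= (x - gamma) * (gamma + x) by rewrite mulr_ge0//; lra.
    lra.
  apply: filterS (limn_esup_rate_error copies G_cont H_cont C_C2 C_ext k_gt0 k_le
    k_ratio_nonincr k_ratio_cvg g0 v0 c0 cE var) => w /le_trans; apply.
  rewrite lee_fin /c (powRM _ (ltW g0) (ltW g1')) !powRN.
  have gq : 0 < gamma `^ 4^-1 by rewrite powR_gt0.
  rewrite [leLHS](_ : _ = 3 * (2 `^ 4^-1)^-1 * (1 - gamma) `^ 4^-1); last first.
    by field; rewrite !gt_eqF// powR_gt0.
  rewrite ler_wpM2r ?powR_ge0// lerDl mulr_ge0 ?powR_ge0//; exact: ltW.
- have g0' : 0 < gamma by lra.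
  (* For gamma > 1/2 the interval [0, gamma] contains the maximum point 1/2 of x (1 - x), so v =
     1/4, and 81 / 8 is c^4. *)
  pose c : R := 3 * 2 `^ (- (3 / 4)).
  have c0 : 0 < c by rewrite mulr_gt0// powR_gt0.
  have cE : c ^+ 4 = 81 / 2 * 4^-1.
    rewrite /c (_ : 3 / 4 = 4^-1 * 3 :> R); last by rewrite mulrC.
    rewrite powRN powRrM powR_mulrn ?powR_ge0// exprMn exprVn -exprM mulnC exprM quart4//.
    by field.
  have var x e : 0 <= x <= 1 -> 0 <= e -> x <= gamma + e -> x * (1 - x) <= 4^-1 + e.
    by move=> _ e0 _; have := sqr_ge0 (x - 2^-1); lra.
  have v0 : 0 < 4^-1 :> R by rewrite invr_gt0.
  apply: filterS (limn_esup_rate_error copies G_cont H_cont C_C2 C_ext k_gt0 k_le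
    k_ratio_nonincr k_ratio_cvg g0' v0 c0 cE var) => w /le_trans; apply.
  rewrite lee_fin ler_wpM2r ?powR_ge0// lerDl mulr_ge0 ?powR_ge0//; exact: ltW.
Qed.
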